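(* Let $p\in\{2,3,4\}$. For all integers $k\ge1$, $\ell\ge0$ there exist $a_{k,\ell}\in\mathbb{R}$ and $C^\infty$ functions $A_{k,\ell},B_{k,\ell}:\mathbb{R}\to\mathbb{R}$ such that, for any $0<c<1$, any integer $k_0\ge1$ and any integer $\ell_0\ge0$, the function $$v(t,x)=Q(y)+Q_c(y_c)+\sum_{(k,\ell)\in\Sigma_0}c^\ell\Big(Q_c^k(y_c)A_{k,\ell}(y)+(Q_c^k)'(y_c)B_{k,\ell}(y)\Big),$$ where $\Sigma_0=\{(k,\ell):1\le k\le k_0,\ 0\le\ell\le\ell_0\}$, $y_c=x+(1-c)t$, $y=x-\alpha(y_c)$ and $\alpha(s)=\sum_{(k,\ell)\in\Sigma_0}a_{k,\ell}c^\ell\int_0^sQ_c^k(s')\,ds'$, satisfies: 1. with $S(t,x)=\partial_tv+\partial_x(\partial_x^2v-v+v^p)$, for all $j\ge0$ and all $t\in[-T_c,T_c]$, $$\|\partial_x^jS(t)\|_{L^2(\mathbb{R})}\le Kc^{n_0},\qquad n_0=\big(\tfrac12-\tfrac1{100}\big)\min\Big(\frac{k_0}{p-1},1+\ell_0\Big),$$ where $K=K(j,k_0,\ell_0)>0$; 2. $v(t)\in H^1(\mathbb{R})$ for all $t\in\mathbb{R}$, and for all $t\in[-T_c,T_c]$, $$\|v(t)-Q(y)-Q_c(y_c)\|_{H^1(\mathbb{R})}\le Kc^{\frac1{p-1}},$$ where $K=K(k_0,\ell_0)>0$ (here $Q(y)$, $Q_c(y_c)$ denote the functions $x\mapsto Q(x-\alpha(x+(1-c)t))$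 and $x\mapsto Q_c(x+(1-c)t)$).
   Context: $Q$ is the unique even positive $H^1$ solution of $Q''+Q^p=Q$, i.e. $Q(x)=\big(\frac{p+1}{2\cosh^2(\frac{p-1}2x)}\big)^{1/(p-1)}$, and for $c>0$, $Q_c(x)=c^{1/(p-1)}Q(\sqrt c\,x)$. $T_c=c^{-\frac12-\frac1{100}}$. *)

(* Defs.v *)
From Stdlib Require Import Reals.
From Coquelicot Require Import Coquelicot.
Open Scope R_scope.

Definition Q (p : nat) (x : R) : R :=
  Rpower ((INR p + 1) / (2 * (cosh ((INR p - 1) / 2 * x)) ^ 2)) (1 / (INR p - 1)).

Definition Qc (p : nat) (c : R) (x : R) : R :=
  Rpower c (1 / (INR p - 1)) * Q p (sqrt c * x).

Definition Tc (c : R) : R := Rpower c (- (1/2) - 1/100).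

Definition sigma0 (k0 l0 : nat) (F : nat -> nat -> R) : R :=
  sum_n_m (fun k => sum_n_m (fun l => F k l) 0 l0) 1 k0.

Definition alpha (p : nat) (c : R) (a : nat -> nat -> R) (k0 l0 : nat) (s : R) : R :=
  sigma0 k0 l0 (fun k l => a k l * c ^ l * RInt (fun s' => (Qc p c s') ^ k) 0 s).

Definition ycoord (c t x : R) : R := x + (1 - c) * t.

Definition ycoord' (p : nat) (c : R) (a : nat -> nat -> R) (k0 l0 : nat) (t x : R) : R :=
  x - alpha p c a k0 l0 (ycoord c t x).

Definition vapp (p : nat) (c : R) (a : nat -> nat -> R) (A B : nat -> nat -> R -> R)
  (k0 l0 : nat) (t x : R) : R :=
  let yc := ycoord c t x in
  let y := ycoord' p c a k0 l0 t x in
  Q p y + Qc p c yc +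
  sigma0 k0 l0 (fun k l => c ^ l *
     ((Qc p c yc) ^ k * A k l y + Derive (fun s => (Qc p c s) ^ k) yc * B k l y)).

Definition Serr (p : nat) (c : R) (a : nat -> nat -> R) (A B : nat -> nat -> R -> R)
  (k0 l0 : nat) (t x : R) : R :=
  let v := vapp p c a A B k0 l0 in
  Derive (fun t' => v t' x) t +
  Derive (fun x' => Derive_n (fun x'' => v t x'') 2 x' - v t x' + (v t x') ^ p) x.

Definition smooth (f : R -> R) : Prop := forall (n : nat) (x : R), ex_derive_n f n x.

Definition is_L2 (f : R -> R) : Prop :=
  ex_RInt_gen (fun x => (f x) ^ 2) (Rbar_locally m_infty) (Rbar_locally p_infty).

Definition L2norm (f : R -> R) : R :=
  sqrt (RInt_gen (fun x => (f x) ^ 2) (Rbar_locally m_infty) (Rbar_locally p_infty)).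

Definition is_H1 (f : R -> R) : Prop :=
  (forall x, ex_derive f x) /\ is_L2 f /\ is_L2 (Derive f).

Definition H1norm (f : R -> R) : R :=
  sqrt (L2norm f ^ 2 + L2norm (Derive f) ^ 2).

(* Main.v *)
(**
Write [R = Q_c] and [rho = R'/R].  Since [rho^2 = c - 2/(p+1) R^(p-1)] and
[rho' = - (p-1)/(p+1) R^(p-1)], the polynomials in [c], [R], [rho] with coefficients depending
smoothly on [y] are stable under products and under [d/dx = (1 - alpha') d/dy + d/dy_c], and under
[d/dt].  The coefficient of [c^l R^k rho^e] in the residual involves only the unknowns of index
at most [(k,l)], and those of index [(k,l)] enter through [L u = - u'' + u - p Q^(p-1) u]:
   [- (L A)' - a (3 Q - 2 Q^p)' + F = 0] and [- (L B)' + 3 A'' + p Q^(p-1) A - 3 a Q'' + G = 0].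
The first equation is solvable for even [A] and every [a]; the second one, for odd [B], requires one
orthogonality condition to [Q'], which fixes [a] because the coefficient of [a] in it is a positive
multiple of the integral of [Q^(p+1)].  The unknowns are thus constructed by recursion on [k + l].

Growth is controlled by counting [c] and [R^(p-1)] as [p - 1]: at weight [w = (p-1) l + k] the
coefficients of the solution are polynomials of degree at most [(w-1)/(p-1)] at infinity, up to
exponentially small terms, and the residual, which involves two derivatives or [p] factors, loses one
degree.  For [|t| <= T_c] one has [1 + |y| <= C T_c (1 + sqrt c |y_c|)], so each power of [y] costs
[c^(-1/2-1/100)], while [c^l R^k] gains [c^(l + k/(p-1))]; this leaves the power of [c] of the theorem.
*)

Require Import Defs.
From Stdlib Require Import Bool Reals Lra Lia Psatz FunctionalExtensionality ClassicalEpsilon.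
From Coquelicot Require Import Coquelicot.
Open Scope R_scope.

(** * Classes of functions *)

(** Since [p] is an integer, [v^p] is a polynomial and the residual is an exact finite sum over
    indices: there is no Taylor remainder, and the estimate reduces to one bound per monomial
    outside [Sigma_0]. Each coefficient only sees lower indices, so truncation creates nothing
    inside [Sigma_0] and one table serves for all [k0] and [l0]. The obstacle is the growth in [y].
    Each level integrates its residual once, and the primitive of an even function has in general
    nonzero limits at infinity, so decay is lost and degrees accumulate. The weights keep a margin
    [1/(p-1)] in the exponent of [c], which pays for [c^(-1/4)], the [L2] norm of a profile of width
    [c^(-1/2)]. The second estimate has no margin for [R A] at index (1,0): a bounded [A] would only
    give [c^(1/(p-1) - 1/4)]. There the residual is odd and localized, so its primitive still decays
    and [A] is localized near the large soliton. Both homogeneous solutions of the linearized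
    equation are explicit, and improper integrals are controlled by comparison with an exponential
    or with [atan]. *)

Definition expbd (nu : R) (f : R -> R) : Prop :=
  exists C, forall x, Rabs (f x) <= C * exp (nu * Rabs x).

Fixpoint Bn (nu : R) (n : nat) (f : R -> R) : Prop :=
  expbd nu f /\
  match n with
  | O => True
  | S m => (forall x, ex_derive f x) /\ Bn nu m (Derive f)
  end.

Definition Ecl (nu : R) (f : R -> R) : Prop := forall n, Bn nu n f.
(** The strict inequality absorbs polynomial factors: [x * dQ p x], or a solution of the linearized
    equation whose source has size [exp (- Rabs x)], can fail the bound at the rate -1 itself. *)
Definition Loc (f : R -> R) : Prop := forall nu, -1 < nu -> Ecl nu f.
Definition Tame (f : R -> R) : Prop := forall nu, 0 < nu -> Ecl nu f.

(* Up to a localized error, a function in [Pol (S n)] is a polynomial of degree at most [n] near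
   each end of the line; [Pol 0] is the class of localized functions. *)
Fixpoint Pol (n : nat) (f : R -> R) : Prop :=
  match n with
  | O => Loc f
  | S m => (forall x, ex_derive f x) /\ Pol m (Derive f)
  end.

(* [auto_derive] leaves derivatives of atoms in this eta-expanded form. *)
Lemma Derive_eta (f : R -> R) (x l : R) : is_derive f x l -> Derive (fun z : R => f z) x = l.
Proof. apply is_derive_unique. Qed.

Lemma Derive_fun (f f' : R -> R) : (forall x, is_derive f x (f' x)) -> Derive f = f'.
Proof. intros H; apply functional_extensionality; intros x; now apply is_derive_unique. Qed.

Lemma is_derive_mult_R (f g : R -> R) x df dg :
  is_derive f x df -> is_derive g x dg -> is_derive (fun x => f x * g x) x (df * g x + f x * dg).
Proof. intros F G; apply @is_derive_mult; auto. intros; apply Rmult_comm. Qed.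

Lemma expbd_mono nu nu' f : nu <= nu' -> expbd nu f -> expbd nu' f.
Proof.
  intros Hn [C HC]; exists (Rabs C); intros x.
  eapply Rle_trans; [apply HC|].
  apply Rle_trans with (Rabs C * exp (nu * Rabs x)).
  - apply Rmult_le_compat_r; [left; apply exp_pos | apply Rle_abs].
  - apply Rmult_le_compat_l; [apply Rabs_pos|].
    assert (H := Rabs_pos x).
    destruct (Rle_lt_or_eq_dec (nu * Rabs x) (nu' * Rabs x)) as [H1|H1]; [nra | | rewrite H1; lra].
    left; now apply exp_increasing.
Qed.

Lemma expbd_pos nu f : expbd nu f -> exists C, 0 < C /\ forall x, Rabs (f x) <= C * exp (nu * Rabs x).
Proof.
  intros [C HC]; exists (Rabs C + 1); split; [assert (H := Rabs_pos C); lra|].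
  intros x; eapply Rle_trans; [apply HC|].
  apply Rmult_le_compat_r; [left; apply exp_pos|]. assert (H := Rle_abs C); lra.
Qed.

Lemma expbd_plus nu f g : expbd nu f -> expbd nu g -> expbd nu (fun x => f x + g x).
Proof.
  intros [C HC] [D HD]; exists (C + D); intros x.
  eapply Rle_trans; [apply Rabs_triang|]. specialize (HC x); specialize (HD x); lra.
Qed.

Lemma expbd_mult nu nu' f g : expbd nu f -> expbd nu' g -> expbd (nu + nu') (fun x => f x * g x).
Proof.
  intros [C HC] [D HD]; exists (C * D); intros x.
  rewrite Rabs_mult, Rmult_plus_distr_r, exp_plus.
  replace (C * D * (exp (nu * Rabs x) * exp (nu' * Rabs x)))
    with ((C * exp (nu * Rabs x)) * (D * exp (nu' * Rabs x))) by ring.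
  apply Rmult_le_compat; auto using Rabs_pos.
Qed.

Lemma Bn_0 nu n f : Bn nu n f -> expbd nu f.
Proof. destruct n; simpl; tauto. Qed.

Lemma Bn_pred nu n f : Bn nu (S n) f -> Bn nu n f.
Proof.
  revert f; induction n; intros f.
  - simpl; tauto.
  - intros [H0 [H1 H2]]; repeat split; auto.
Qed.

Lemma Bn_mono nu nu' n f : nu <= nu' -> Bn nu n f -> Bn nu' n f.
Proof.
  intros H; revert f; induction n; intros f [H0 H1]; split; eauto using expbd_mono.
  destruct H1; split; auto.
Qed.

Lemma Bn_plus nu n f g : Bn nu n f -> Bn nu n g -> Bn nu n (fun x => f x + g x).
Proof.
  revert f g; induction n; intros f g [F0 F1] [G0 G1]; split; auto using expbd_plus.
  destruct F1 as [F1 F2], G1 as [G1 G2]; split.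
  - intros x; apply @ex_derive_plus; auto.
  - erewrite Derive_fun; [apply (IHn _ _ F2 G2)|]; intros x; cbv beta.
    apply @is_derive_plus; apply Derive_correct; auto.
Qed.

Lemma Bn_mult nu nu' n f g : Bn nu n f -> Bn nu' n g -> Bn (nu + nu') n (fun x => f x * g x).
Proof.
  revert f g; induction n; intros f g F G; split; eauto using expbd_mult, Bn_0.
  destruct F as [F0 [F1 F2]] eqn:HF, G as [G0 [G1 G2]] eqn:HG; split.
  - intros x; apply ex_derive_mult; auto.
  - rewrite (Derive_fun _ (fun x => Derive f x * g x + f x * Derive g x)).
    + apply Bn_plus; apply IHn; auto; apply Bn_pred; assumption.
    + intros x; apply is_derive_mult_R; apply Derive_correct; auto.
Qed.

Lemma expbd_const nu a : 0 <= nu -> expbd nu (fun _ => a).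
Proof.
  intros H; exists (Rabs a); intros x.
  rewrite <- (Rmult_1_r (Rabs a)) at 1. apply Rmult_le_compat_l; [apply Rabs_pos|].
  rewrite <- exp_0. assert (H1 := Rabs_pos x).
  destruct (Rle_lt_or_eq_dec 0 (nu * Rabs x)) as [H2|H2]; [nra| |rewrite <- H2; lra].
  left; now apply exp_increasing.
Qed.

Lemma expbd_zero nu : expbd nu (fun _ => 0).
Proof. exists 0; intros x; rewrite Rabs_R0; lra. Qed.

Lemma Bn_zero nu n : Bn nu n (fun _ => 0).
Proof.
  induction n; split; auto using expbd_zero.
  split; [intros; apply ex_derive_const|].
  rewrite (Derive_fun _ (fun _ => 0)); auto. intros; apply @is_derive_const.
Qed.

Lemma Bn_const nu n a : 0 <= nu -> Bn nu n (fun _ => a).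
Proof.
  intros H; destruct n; split; auto using expbd_const.
  split; [intros; apply ex_derive_const|].
  rewrite (Derive_fun _ (fun _ => 0)); [apply Bn_zero|]. intros; apply @is_derive_const.
Qed.

Lemma Bn_scal nu n a f : Bn nu n f -> Bn nu n (fun x => a * f x).
Proof.
  intros F; replace nu with (0 + nu) by ring. apply Bn_mult; auto. apply Bn_const; lra.
Qed.

Lemma Ecl_mono nu nu' f : nu <= nu' -> Ecl nu f -> Ecl nu' f.
Proof. intros H H1 n; eauto using Bn_mono. Qed.
Lemma Ecl_plus nu f g : Ecl nu f -> Ecl nu g -> Ecl nu (fun x => f x + g x).
Proof. intros F G n; apply Bn_plus; auto. Qed.
Lemma Ecl_mult nu nu' f g : Ecl nu f -> Ecl nu' g -> Ecl (nu + nu') (fun x => f x * g x).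
Proof. intros F G n; apply Bn_mult; auto. Qed.
Lemma Ecl_const nu a : 0 <= nu -> Ecl nu (fun _ => a).
Proof. intros H n; now apply Bn_const. Qed.
Lemma Ecl_bd nu f : Ecl nu f -> expbd nu f.
Proof. intros H; apply (H O). Qed.
Lemma Ecl_ex nu f x : Ecl nu f -> ex_derive f x.
Proof. intros H; apply (H 1%nat). Qed.
Lemma Ecl_Derive nu f : Ecl nu f -> Ecl nu (Derive f).
Proof. intros H n; apply (H (S n)). Qed.
Lemma Ecl_intro nu f : expbd nu f -> (forall x, ex_derive f x) -> Ecl nu (Derive f) -> Ecl nu f.
Proof. intros H0 H1 H2 n; destruct n; split; auto. Qed.
Lemma Ecl_scal nu a f : Ecl nu f -> Ecl nu (fun x => a * f x).
Proof. intros H n; apply Bn_scal; auto. Qed.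

Lemma Loc_plus f g : Loc f -> Loc g -> Loc (fun x => f x + g x).
Proof. intros F G nu H; apply Ecl_plus; auto. Qed.
Lemma Tame_plus f g : Tame f -> Tame g -> Tame (fun x => f x + g x).
Proof. intros F G nu H; apply Ecl_plus; auto. Qed.
Lemma Loc_scal a f : Loc f -> Loc (fun x => a * f x).
Proof. intros F nu H; apply Ecl_scal; auto. Qed.
Lemma Tame_scal a f : Tame f -> Tame (fun x => a * f x).
Proof. intros F nu H; apply Ecl_scal; auto. Qed.
Lemma Tame_const a : Tame (fun _ => a).
Proof. intros nu H; apply Ecl_const; lra. Qed.
Lemma Tame_mult f g : Tame f -> Tame g -> Tame (fun x => f x * g x).
Proof.
  intros F G nu H; replace nu with (nu/2 + nu/2) by field. apply Ecl_mult; [apply F | apply G]; lra.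
Qed.
Lemma Loc_mult_Tame f g : Loc f -> Tame g -> Loc (fun x => f x * g x).
Proof.
  (* The rate is split so that the first half stays above -1 and the second one above 0. *)
  intros F G nu H; replace nu with ((nu - 1)/2 + (nu+1)/2) by field.
  apply Ecl_mult; [apply F | apply G]; lra.
Qed.
Lemma Loc_Tame f : Loc f -> Tame f.
Proof. intros F nu H; apply F; lra. Qed.
Lemma Loc_Derive f : Loc f -> Loc (Derive f).
Proof. intros F nu H; apply Ecl_Derive; auto. Qed.
Lemma Tame_Derive f : Tame f -> Tame (Derive f).
Proof. intros F nu H; apply Ecl_Derive; auto. Qed.
Lemma Tame_ex f x : Tame f -> ex_derive f x.
Proof. intros F; apply (Ecl_ex 1), F; lra. Qed.

Lemma Loc_zero : Loc (fun _ => 0).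
Proof. intros nu H n; apply Bn_zero. Qed.

(** [C / nu * exp (nu * x)] has the bound on [f'] as its derivative; subtracting it from [f] or from
    [- f] gives a nonincreasing function. *)
Lemma exp_bound_int (nu C : R) (f f' : R -> R) :
  0 < nu -> (forall x, is_derive f x (f' x)) ->
  (forall x, 0 <= x -> Rabs (f' x) <= C * exp (nu * x)) ->
  forall x, 0 <= x -> Rabs (f x - f 0) <= C / nu * exp (nu * x).
Proof.
  intros Hnu Hd Hb x Hx.
  assert (HC : 0 <= C).
  { assert (H := Hb 0 (Rle_refl 0)). rewrite Rmult_0_r, exp_0 in H. assert (H1 := Rabs_pos (f' 0)). lra. }
  assert (K : forall s, (s = 1 \/ s = -1) -> s * (f x - f 0) <= C / nu * (exp (nu * x) - 1)).
  { intros s Hs.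
    destruct (MVT_gen (fun z => s * f z - C / nu * exp (nu * z)) 0 x
      (fun z => s * f' z - C * exp (nu * z))) as [z [Hz1 Hz2]].
    - intros z _. assert (Df := Hd z). auto_derive; [exists (f' z); auto|].
      rewrite (Derive_eta _ _ _ Df). field; lra.
    - intros z _. apply derivable_continuous_pt, ex_derive_Reals_0.
      assert (Df := Hd z). auto_derive. exists (f' z); auto.
    - rewrite Rmin_left, Rmax_right in Hz1 by lra.
      rewrite Rmult_0_r, exp_0 in Hz2.
      assert (H := Hb z (proj1 Hz1)).
      assert (s * f' z - C * exp (nu * z) <= 0).
      { apply Rabs_le_between in H. destruct Hs; subst s; lra. }
      assert ((s * f' z - C * exp (nu * z)) * (x - 0) <= 0) by nra. lra. }
  assert (K1 := K 1 (or_introl eq_refl)). assert (K2 := K (-1) (or_intror eq_refl)).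
  assert (0 <= C / nu) by (apply Rdiv_le_0_compat; lra).
  apply Rabs_le; split; lra.
Qed.

Lemma is_derive_refl (f f' : R -> R) : (forall x, is_derive f x (f' x)) ->
  forall x : R, is_derive (fun x : R => f (- x)) x (- f' (- x)).
Proof.
  intros H x. assert (Hx := H (- x)). auto_derive; [exists (f' (-x)); auto|].
  rewrite (Derive_eta _ _ _ Hx). ring.
Qed.

Lemma expbd_int nu f : 0 < nu -> (forall x, ex_derive f x) -> expbd nu (Derive f) -> expbd nu f.
Proof.
  intros Hnu Hd [C HC].
  assert (Hd' : forall x, is_derive f x (Derive f x)) by (intros; apply Derive_correct; auto).
  assert (H0 := expbd_const nu (f 0) (Rlt_le _ _ Hnu)). destruct H0 as [C0 HC0].
  exists (C / nu + C0); intros x.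
  assert (K : Rabs (f x - f 0) <= C / nu * exp (nu * Rabs x)).
  { destruct (Rle_dec 0 x) as [Hx|Hx].
    - rewrite (Rabs_pos_eq x) by lra.
      apply (exp_bound_int nu C f (Derive f)); auto.
      intros z Hz; rewrite <- (Rabs_pos_eq z) at 2 by lra; auto.
    - rewrite (Rabs_left x) by lra.
      assert (H := exp_bound_int nu C (fun x => f (- x)) _ Hnu (is_derive_refl _ _ Hd')).
      cbv beta in H. specialize (fun h => H h (- x)). rewrite Ropp_involutive, Ropp_0 in H.
      apply H; [|lra].
      intros z Hz; rewrite Rabs_Ropp. eapply Rle_trans; [apply HC|].
      rewrite Rabs_Ropp, Rabs_pos_eq by lra; lra. }
  specialize (HC0 x). replace (f x) with ((f x - f 0) + f 0) by ring.
  eapply Rle_trans; [apply Rabs_triang|]. lra.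
Qed.

(** Tame functions are stable under primitives, contrary to localized ones: all rates are positive,
    so a constant of integration is harmless. *)
Lemma Tame_int f : (forall x, ex_derive f x) -> Tame (Derive f) -> Tame f.
Proof.
  intros H1 H2 nu Hnu; apply Ecl_intro; auto.
  apply expbd_int; auto; apply Ecl_bd; auto.
Qed.

Lemma Pol_Tame n f : Pol n f -> Tame f.
Proof.
  revert f; induction n; intros f; [apply Loc_Tame|].
  intros [H1 H2]; apply Tame_int; auto.
Qed.

Lemma Pol_S n f : Pol n f -> Pol (S n) f.
Proof.
  revert f; induction n; intros f.
  - intros H; split; [intros x; apply Tame_ex, Loc_Tame, H | apply Loc_Derive, H].
  - intros [H1 H2]; split; [auto | apply IHn, H2].
Qed.

Lemma Pol_mono n m f : (n <= m)%nat -> Pol n f -> Pol m f.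
Proof. induction 1; auto. intros; apply Pol_S; auto. Qed.

Lemma Loc_Pol n f : Loc f -> Pol n f.
Proof. apply (Pol_mono 0 n); lia. Qed.

Lemma Pol_plus n f g : Pol n f -> Pol n g -> Pol n (fun x => f x + g x).
Proof.
  revert f g; induction n; intros f g; [apply Loc_plus|].
  intros [F1 F2] [G1 G2]; split; [intros; apply @ex_derive_plus; auto|].
  erewrite Derive_fun; [apply (IHn _ _ F2 G2)|]. intros x; cbv beta.
  apply @is_derive_plus; apply Derive_correct; auto.
Qed.

Lemma Pol_scal n a f : Pol n f -> Pol n (fun x => a * f x).
Proof.
  revert f; induction n; intros f; [apply Loc_scal|].
  intros [F1 F2]; split; [intros; apply ex_derive_scal; auto|].
  rewrite (Derive_fun _ (fun x => a * Derive f x)); [apply IHn; auto|].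
  intros x; apply is_derive_scal, Derive_correct; auto.
Qed.

Lemma Pol_ext n f g : (forall x, f x = g x) -> Pol n f -> Pol n g.
Proof. intros H; replace g with f; auto. now apply functional_extensionality. Qed.

Lemma Pol_minus n f g : Pol n f -> Pol n g -> Pol n (fun x => f x - g x).
Proof.
  intros F G; apply (Pol_ext _ (fun x => f x + (-1) * g x)); [intros; ring|].
  apply Pol_plus, Pol_scal; auto.
Qed.

Lemma Pol_zero n : Pol n (fun _ => 0).
Proof. apply Loc_Pol, Loc_zero. Qed.

Lemma Pol_const n a : Pol (S n) (fun _ => a).
Proof.
  split; [intros; apply ex_derive_const|].
  rewrite (Derive_fun _ (fun _ => 0)); [apply Pol_zero|]. intros; apply @is_derive_const.
Qed.

Lemma Pol_Derive n f : Pol n f -> Pol (pred n) (Derive f).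
Proof. destruct n; simpl; [apply Loc_Derive | tauto]. Qed.

(** Induction on the total degree through the Leibniz rule: each term loses one degree, and a factor
    of degree zero has a localized derivative, which absorbs the other factor. *)
Lemma Pol_mult n m f g : Pol (S n) f -> Pol (S m) g -> Pol (S (n + m)) (fun x => f x * g x).
Proof.
  remember (n + m)%nat as s eqn:Hs. revert n m f g Hs; induction s; intros n m f g Hs F G.
  all: assert (ZF := Pol_Tame _ _ F); assert (ZG := Pol_Tame _ _ G).
  all: destruct F as [F1 F2], G as [G1 G2]; split; [intros; apply ex_derive_mult; auto|].
  all: rewrite (Derive_fun _ (fun x => Derive f x * g x + f x * Derive g x));
       [| intros x; apply is_derive_mult_R; apply Derive_correct; auto].
  all: apply Pol_plus.
  - replace n with O in F2 by lia. simpl in *. apply Loc_mult_Tame; auto.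
  - replace m with O in G2 by lia. simpl in *.
    replace (fun x => f x * Derive g x) with (fun x => Derive g x * f x)
      by (apply functional_extensionality; intros; ring). apply Loc_mult_Tame; auto.
  - destruct n as [|n]; [apply Loc_Pol, Loc_mult_Tame; auto|].
    apply (IHs n m); [lia | auto | split; auto].
  - destruct m as [|m].
    + replace (fun x => f x * Derive g x) with (fun x => Derive g x * f x)
        by (apply functional_extensionality; intros; ring). apply Loc_Pol, Loc_mult_Tame; auto.
    + apply (IHs n m); [lia | split; auto | auto].
Qed.

Lemma Bn_ex_derive_n nu n f : Bn nu n f -> forall x, ex_derive_n f n x.
Proof.
  revert f; induction n; intros f H x; [exact I|].
  destruct H as [_ [H1 H2]].
  destruct n as [|n].
  - apply H1.
  - assert (HD := IHn _ H2 x). simpl in HD |- *.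
    apply (ex_derive_ext (Derive_n (Derive f) n)); auto.
    intros t. etransitivity; [apply (Derive_n_comp f n 1)|].
    now replace (n + 1)%nat with (S n) by lia.
Qed.

Lemma Tame_smooth f : Tame f -> smooth f.
Proof. intros H n; apply (Bn_ex_derive_n 1), H; lra. Qed.

(** [true] stands for odd, so that the parity of a product is an exclusive or. *)
Definition sg (b : bool) : R := if b then -1 else 1.
Definition parity (b : bool) (f : R -> R) : Prop := forall x, f (- x) = sg b * f x.

Lemma parity_plus b f g : parity b f -> parity b g -> parity b (fun x => f x + g x).
Proof. intros F G x; rewrite F, G; ring. Qed.
Lemma parity_minus b f g : parity b f -> parity b g -> parity b (fun x => f x - g x).
Proof. intros F G x; rewrite F, G; ring. Qed.
Lemma parity_scal b a f : parity b f -> parity b (fun x => a * f x).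
Proof. intros F x; rewrite F; ring. Qed.
Lemma sg_xorb b b' : sg (xorb b b') = sg b * sg b'.
Proof. destruct b, b'; simpl; ring. Qed.
Lemma sg_negb b : sg (negb b) = - sg b.
Proof. destruct b; simpl; ring. Qed.
Lemma parity_mult b b' f g : parity b f -> parity b' g -> parity (xorb b b') (fun x => f x * g x).
Proof. intros F G x; rewrite F, G, sg_xorb; ring. Qed.
Lemma parity_zero b : parity b (fun _ => 0).
Proof. intros x; ring. Qed.
Lemma parity_const a : parity false (fun _ => a).
Proof. intros x; simpl; ring. Qed.

Lemma parity_Derive b f : (forall x, ex_derive f x) -> parity b f -> parity (negb b) (Derive f).
Proof.
  intros Hd F x.
  assert (H := is_derive_refl f (Derive f) (fun z => Derive_correct f z (Hd z)) x).
  assert (H' : is_derive (fun x : R => f (- x)) x (sg b * Derive f x)).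
  { apply (is_derive_ext (fun x : R => sg b * f x)); [intros t; symmetry; apply F|].
    apply is_derive_scal, Derive_correct, Hd. }
  assert (K := is_derive_unique _ _ _ H). rewrite (is_derive_unique _ _ _ H') in K.
  rewrite sg_negb. lra.
Qed.

(** * The soliton profile *)

Lemma cosh_pos x : 0 < cosh x.
Proof. unfold cosh. assert (H := exp_pos x). assert (H' := exp_pos (- x)). lra. Qed.
Lemma cosh2_sinh2 x : cosh x ^ 2 - sinh x ^ 2 = 1.
Proof.
  unfold cosh, sinh. assert (H : exp x * exp (- x) = 1) by (rewrite <- exp_plus, Rplus_opp_r; apply exp_0).
  nra.
Qed.
Lemma cosh_even x : cosh (- x) = cosh x.
Proof. unfold cosh; rewrite Ropp_involutive; lra. Qed.
Lemma sinh_odd x : sinh (- x) = - sinh x.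
Proof. unfold sinh; rewrite Ropp_involutive; lra. Qed.
Lemma cosh_abs x : cosh (Rabs x) = cosh x.
Proof. destruct (Rcase_abs x); [rewrite Rabs_left, cosh_even | rewrite Rabs_right]; auto. Qed.
Lemma cosh_bounds x : exp (Rabs x) / 2 <= cosh x <= exp (Rabs x).
Proof.
  rewrite <- cosh_abs. assert (H0 := Rabs_pos x). set (z := Rabs x) in *.
  unfold cosh. assert (H := exp_pos z). assert (H' := exp_pos (- z)).
  assert (exp (- z) <= exp z).
  { destruct (Rle_lt_or_eq_dec 0 z H0) as [Hz|Hz]; [left; apply exp_increasing; lra|].
    rewrite <- Hz, Ropp_0; lra. }
  lra.
Qed.

Section Soliton.
Context (p : nat) (hp2 : (2 <= p)%nat).

Definition mm : R := (INR p - 1) / 2.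
(** [- T] is the logarithmic derivative of [Q], and [Q^(p-1) = (p+1)/2 (1 - T^2)]: derivatives of
    [Q] and its powers become polynomials in [T] and [Q], within reach of [field]. *)
Definition T (x : R) : R := sinh (mm * x) / cosh (mm * x).

Lemma INRp_ge : 2 <= INR p.
Proof. replace 2 with (INR 2) by reflexivity. apply le_INR; auto. Qed.

Lemma mm_pos : 0 < mm.
Proof. unfold mm; assert (H := INRp_ge); lra. Qed.

Lemma is_derive_T x : is_derive T x (mm * (1 - T x ^ 2)).
Proof.
  unfold T. assert (H := cosh_pos (mm * x)).
  auto_derive; [lra | field; lra].
Qed.

Lemma Q_alt x : Q p x = exp (1 / (INR p - 1) * ln ((INR p + 1) / 2)) * exp (- (/ mm * ln (cosh (mm * x)))).
Proof.
  unfold Q, Rpower. rewrite <- exp_plus. f_equal.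
  assert (H := cosh_pos (mm * x)). assert (Hp := INRp_ge). fold mm.
  replace ((INR p + 1) / (2 * cosh (mm * x) ^ 2))
    with ((INR p + 1) / 2 * / (cosh (mm * x) * cosh (mm * x))) by (field; lra).
  rewrite ln_mult; [| lra | apply Rinv_0_lt_compat; nra].
  rewrite ln_Rinv by nra. rewrite ln_mult by lra.
  unfold mm in *. field. lra.
Qed.

Lemma Q_pos x : 0 < Q p x.
Proof. apply exp_pos. Qed.

Lemma is_derive_Q x : is_derive (Q p) x (- (T x * Q p x)).
Proof.
  apply (is_derive_ext (fun x => exp (1 / (INR p - 1) * ln ((INR p + 1) / 2)) * exp (- (/ mm * ln (cosh (mm * x)))))).
  - intros t; symmetry; apply Q_alt.
  - rewrite Q_alt. unfold T. assert (H := cosh_pos (mm * x)). assert (Hm := mm_pos).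
    auto_derive; [auto | field; lra].
Qed.

Lemma T_sq x : T x ^ 2 = 1 - / cosh (mm * x) ^ 2.
Proof.
  unfold T. assert (H := cosh_pos (mm * x)). assert (H1 := cosh2_sinh2 (mm * x)).
  replace ((sinh (mm * x) / cosh (mm * x)) ^ 2) with (sinh (mm * x) ^ 2 / cosh (mm * x) ^ 2) by (field; lra).
  replace (sinh (mm * x) ^ 2) with (cosh (mm * x) ^ 2 - 1) by lra. field; lra.
Qed.

Lemma T_lt x : T x ^ 2 < 1.
Proof. rewrite T_sq. assert (0 < / cosh (mm * x) ^ 2); [apply Rinv_0_lt_compat, pow_lt, cosh_pos | lra]. Qed.

Lemma T_abs x : Rabs (T x) <= 1.
Proof. assert (H := T_lt x). apply Rabs_le; split; nra. Qed.

Lemma Q_pow x : Q p x ^ p = (INR p + 1) / 2 * (1 - T x ^ 2) * Q p x.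
Proof.
  assert (Hp := INRp_ge).
  replace p with (S (p - 1)) at 2 by lia.
  rewrite <- tech_pow_Rmult, Rmult_comm. f_equal.
  assert (H := cosh_pos (mm * x)).
  rewrite <- Rpower_pow by apply Q_pos. unfold Q. rewrite Rpower_mult.
  rewrite minus_INR by lia. change (INR 1) with 1.
  replace (1 / (INR p - 1) * (INR p - 1)) with 1 by (field; lra).
  fold mm. rewrite Rpower_1; [| apply Rdiv_lt_0_compat; nra].
  rewrite T_sq. field; lra.
Qed.

Lemma T_odd x : T (- x) = - T x.
Proof.
  unfold T. replace (mm * - x) with (- (mm * x)) by ring. rewrite sinh_odd, cosh_even.
  field. assert (H := cosh_pos (mm * x)); lra.
Qed.

Lemma Q_even x : Q p (- x) = Q p x.
Proof. rewrite !Q_alt. replace (mm * - x) with (- (mm * x)) by ring. now rewrite cosh_even. Qed.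

Lemma exp_le x y : x <= y -> exp x <= exp y.
Proof.
  intros H; destruct (Rle_lt_or_eq_dec _ _ H) as [H1|H1]; [left; now apply exp_increasing | rewrite H1; lra].
Qed.

(** The lower bound serves to control [/ rr], hence the growing solution of the linearized
    equation. *)
Lemma Q_bounds : exists c1 c2, 0 < c1 /\ 0 < c2 /\
  forall x, c1 * exp (- Rabs x) <= Q p x <= c2 * exp (- Rabs x).
Proof.
  set (K := exp (1 / (INR p - 1) * ln ((INR p + 1) / 2))).
  assert (HK : 0 < K) by apply exp_pos. assert (Hm := mm_pos).
  exists K, (K * exp (/ mm * ln 2)).
  split; auto. split; [apply Rmult_lt_0_compat; auto; apply exp_pos|].
  intros x. rewrite Q_alt. fold K.
  assert (H := cosh_bounds (mm * x)).
  rewrite Rabs_mult, (Rabs_pos_eq mm) in H by lra.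
  assert (Hc := cosh_pos (mm * x)).
  assert (H1 : ln (cosh (mm * x)) <= mm * Rabs x).
  { rewrite <- (ln_exp (mm * Rabs x)). apply ln_le; lra. }
  assert (H2 : mm * Rabs x - ln 2 <= ln (cosh (mm * x))).
  { rewrite <- (ln_exp (mm * Rabs x)), <- ln_div by (try apply exp_pos; lra).
    apply ln_le; [apply Rdiv_lt_0_compat; [apply exp_pos | lra] | lra]. }
  assert (Hi : 0 < / mm) by (apply Rinv_0_lt_compat; auto).
  assert (Hmi : / mm * mm = 1) by (field; lra).
  rewrite Rmult_assoc, <- exp_plus.
  split; (apply Rmult_le_compat_l; [lra|]; apply exp_le).
  - assert (/ mm * ln (cosh (mm * x)) <= / mm * (mm * Rabs x)) by (apply Rmult_le_compat_l; lra).
    rewrite <- Rmult_assoc, Hmi in *. lra.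
  - assert (/ mm * (mm * Rabs x - ln 2) <= / mm * ln (cosh (mm * x))) by (apply Rmult_le_compat_l; lra).
    rewrite Rmult_minus_distr_l, <- Rmult_assoc, Hmi in *. lra.
Qed.

(** The derivative of [T] is a polynomial in [T], so the bound on [T] propagates to all orders. *)
Lemma T_Ecl : Ecl 0 T.
Proof.
  assert (B : expbd 0 T).
  { exists 1; intros x. rewrite Rmult_0_l, exp_0. assert (H := T_abs x); lra. }
  intros n; induction n; split; auto.
  split; [intros x; eexists; apply is_derive_T|].
  rewrite (Derive_fun _ (fun x => mm + (- mm) * (T x * T x))).
  - apply Bn_plus; [apply Bn_const; lra|].
    apply Bn_scal. replace 0 with (0 + 0) by ring. apply Bn_mult; auto.
  - intros x. replace (mm + - mm * (T x * T x)) with (mm * (1 - T x ^ 2)) by ring. apply is_derive_T.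
Qed.

Lemma Q_Ecl : Ecl (-1) (Q p).
Proof.
  assert (B : expbd (-1) (Q p)).
  { destruct Q_bounds as [c1 [c2 [H1 [H2 H]]]]. exists c2; intros x.
    rewrite Rabs_pos_eq by (left; apply Q_pos). replace (-1 * Rabs x) with (- Rabs x) by ring. apply H. }
  intros n; induction n; split; auto.
  split; [intros x; eexists; apply is_derive_Q|].
  rewrite (Derive_fun _ (fun x => (-1) * (T x * Q p x))).
  - apply Bn_scal. replace (-1) with (0 + -1) by ring. apply Bn_mult; [apply T_Ecl | auto].
  - intros x. replace (-1 * (T x * Q p x)) with (- (T x * Q p x)) by ring. apply is_derive_Q.
Qed.

Lemma Q_Loc : Loc (Q p).
Proof. intros nu H; eapply Ecl_mono; [|apply Q_Ecl]; lra. Qed.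

End Soliton.

(** * Primitives and limits at infinity *)

Definition prim (f : R -> R) (y : R) : R := RInt f 0 y.

Definition Cont (f : R -> R) : Prop := forall x : R, continuous f x.

Lemma ex_derive_continuous_R (f : R -> R) x : ex_derive f x -> continuous f x.
Proof. apply @ex_derive_continuous. Qed.

Lemma is_derive_prim (f : R -> R) y : Cont f -> is_derive (prim f) y (f y).
Proof.
  intros H. apply (is_derive_RInt f (prim f) 0 y); auto.
  exists (mkposreal 1 Rlt_0_1); intros z _. apply (RInt_correct f 0 z), ex_RInt_continuous; auto.
Qed.

Lemma prim_0 f : prim f 0 = 0.
Proof. exact (RInt_point 0 f). Qed.

Lemma is_derive_const_eq (f : R -> R) : (forall x, is_derive f x 0) -> forall x, f x = f 0.
Proof.
  intros H x. destruct (MVT_gen f 0 x (fun _ => 0)) as [z [_ Hz]].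
  - intros; apply H.
  - intros z _. apply derivable_continuous_pt, ex_derive_Reals_0. eexists; apply H.
  - lra.
Qed.

Lemma eq_of_is_derive (f g h : R -> R) :
  (forall x, is_derive f x (h x)) -> (forall x, is_derive g x (h x)) -> f 0 = g 0 -> forall x, f x = g x.
Proof.
  intros F G H0 x.
  assert (K := is_derive_const_eq (fun x => f x - g x)).
  assert (forall x, is_derive (fun x => f x - g x) x 0).
  { intros z. replace 0 with (h z - h z) by ring. apply @is_derive_minus; auto. }
  specialize (K H x). simpl in K. lra.
Qed.

Lemma prim_unique f F : (forall x, is_derive F x (f x)) -> Cont f ->
  forall x, prim f x = F x - F 0.
Proof.
  intros H Hc. apply (eq_of_is_derive _ _ f).
  - intros; apply is_derive_prim; auto.
  - intros x. replace (f x) with (f x - 0) by ring. apply @is_derive_minus; auto. apply @is_derive_const.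
  - rewrite prim_0; ring.
Qed.

Lemma prim_parity b f : Cont f -> parity b f -> parity (negb b) (prim f).
Proof.
  intros Hc Hb. intros x.
  apply (eq_of_is_derive (fun x => prim f (- x)) (fun x => sg (negb b) * prim f x) (fun x => sg (negb b) * f x)).
  - intros z. replace (sg (negb b) * f z) with (- f (- z)) by (rewrite Hb, sg_negb; ring).
    apply is_derive_refl. intros; apply is_derive_prim; auto.
  - intros z. apply is_derive_scal, is_derive_prim; auto.
  - rewrite Ropp_0, prim_0; ring.
Qed.

Lemma is_derive_incr (f f' : R -> R) a : (forall x, is_derive f x (f' x)) ->
  (forall x, a <= x -> 0 <= f' x) -> forall x y, a <= x -> x <= y -> f x <= f y.
Proof.
  intros H H0 x y Hx Hy.
  destruct (MVT_gen f x y f') as [z [Hz1 Hz2]].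
  - intros; apply H.
  - intros z _. apply derivable_continuous_pt, ex_derive_Reals_0. eexists; apply H.
  - rewrite Rmin_left, Rmax_right in Hz1 by lra. assert (K := H0 z ltac:(lra)). nra.
Qed.

(** Subtracting or adding the tail bound to the primitive gives a nondecreasing function [lo] and a
    nonincreasing function [hi] that enclose it. The improper integral is the supremum of [lo], and
    the enclosure gives the rate. *)
Lemma prim_lim (nu C : R) f : 0 < nu -> Cont f ->
  (forall x, 0 <= x -> Rabs (f x) <= C * exp (- nu * x)) ->
  exists I, forall y, 0 <= y -> Rabs (I - prim f y) <= C / nu * exp (- nu * y).
Proof.
  intros Hnu Hc Hf.
  set (lo := fun y => prim f y - C / nu * exp (- nu * y)).
  set (hi := fun y => prim f y + C / nu * exp (- nu * y)).
  assert (Dlo : forall x, is_derive lo x (f x + C * exp (- nu * x))).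
  { intros x. assert (Df := is_derive_prim f x Hc). unfold lo.
    auto_derive; [exists (f x); auto|]. rewrite (Derive_eta _ _ _ Df). field; lra. }
  assert (Dhi : forall x, is_derive (fun y => - hi y) x (- (f x - C * exp (- nu * x)))).
  { intros x. assert (Df := is_derive_prim f x Hc). unfold hi.
    auto_derive; [exists (f x); auto|]. rewrite (Derive_eta _ _ _ Df). field; lra. }
  assert (Ilo := is_derive_incr lo _ 0 Dlo).
  assert (Ihi := is_derive_incr (fun y => - hi y) _ 0 Dhi).
  assert (HC : 0 <= C).
  { assert (H := Hf 0 (Rle_refl 0)). rewrite Rmult_0_r, exp_0 in H. assert (H1 := Rabs_pos (f 0)). lra. }
  assert (HC' : 0 <= C / nu) by (apply Rdiv_le_0_compat; lra).
  assert (Hlo : forall x y, 0 <= x -> x <= y -> lo x <= lo y).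
  { apply Ilo. intros x Hx. assert (H := Hf x Hx). apply Rabs_le_between in H. lra. }
  assert (Hhi : forall x y, 0 <= x -> x <= y -> hi y <= hi x).
  { intros x y Hx Hy. assert (- hi x <= - hi y); [|lra]. apply Ihi; auto.
    intros z Hz. assert (H := Hf z Hz). apply Rabs_le_between in H. lra. }
  assert (Hlh : forall x y, 0 <= x -> 0 <= y -> lo x <= hi y).
  { intros x y Hx Hy. apply Rle_trans with (lo (Rmax x y)); [apply Hlo; auto; apply Rmax_l|].
    apply Rle_trans with (hi (Rmax x y)); [|apply Hhi; auto; apply Rmax_r].
    unfold lo, hi. assert (0 <= C / nu * exp (- nu * Rmax x y)); [|lra].
    apply Rmult_le_pos; auto; left; apply exp_pos. }
  destruct (completeness (fun z => exists x, 0 <= x /\ z = lo x)) as [I [HI1 HI2]].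
  - exists (hi 0). intros z [x [Hx ->]]. apply Hlh; lra.
  - exists (lo 0), 0; split; [lra | auto].
  - exists I. intros y Hy.
    assert (lo y <= I) by (apply HI1; exists y; auto).
    assert (I <= hi y) by (apply HI2; intros z [x [Hx ->]]; apply Hlh; auto).
    unfold lo, hi in *. apply Rabs_le; split; lra.
Qed.

(** Only the end at plus infinity is considered; the other one is reached by parity or by
    reflection. *)
Definition tends (f : R -> R) (l : R) : Prop :=
  forall eps, 0 < eps -> exists M, forall y, M <= y -> Rabs (f y - l) <= eps.

Lemma tends_plus f g l m : tends f l -> tends g m -> tends (fun y => f y + g y) (l + m).
Proof.
  intros F G eps He. destruct (F (eps / 2)) as [M HM]; [lra|]. destruct (G (eps / 2)) as [N HN]; [lra|].
  exists (Rmax M N); intros y Hy.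
  assert (H1 := Rmax_l M N). assert (H2 := Rmax_r M N).
  replace (f y + g y - (l + m)) with ((f y - l) + (g y - m)) by ring.
  eapply Rle_trans; [apply Rabs_triang|].
  specialize (HM y ltac:(lra)). specialize (HN y ltac:(lra)). lra.
Qed.

Lemma tends_scal f a l : tends f l -> tends (fun y => a * f y) (a * l).
Proof.
  intros F eps He. assert (Ha := Rabs_pos a).
  destruct (F (eps / (Rabs a + 1))) as [M HM]; [apply Rdiv_lt_0_compat; lra|].
  exists M; intros y Hy. specialize (HM y Hy).
  rewrite <- Rmult_minus_distr_l, Rabs_mult.
  apply (Rmult_le_compat_l (Rabs a)) in HM; [|auto].
  eapply Rle_trans; [apply HM|]. apply (Rmult_le_reg_r (Rabs a + 1)); [lra|].
  replace (Rabs a * (eps / (Rabs a + 1)) * (Rabs a + 1)) with (Rabs a * eps) by (field; lra). nra.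
Qed.

Lemma tends_ext f g l : (forall y, f y = g y) -> tends f l -> tends g l.
Proof. intros H F eps He. destruct (F eps He) as [M HM]. exists M; intros y Hy. rewrite <- H; auto. Qed.

Lemma tends_unique f l m : tends f l -> tends f m -> l = m.
Proof.
  intros F G. apply cond_eq. intros eps He.
  destruct (F (eps / 4)) as [M HM]; [lra|]. destruct (G (eps / 4)) as [N HN]; [lra|].
  specialize (HM (Rmax M N) (Rmax_l _ _)). specialize (HN (Rmax M N) (Rmax_r _ _)).
  set (z := f (Rmax M N)) in *. replace (l - m) with ((z - m) - (z - l)) by ring.
  eapply Rle_lt_trans; [apply Rabs_triang|]. rewrite Rabs_Ropp. lra.
Qed.

Lemma tends_const_ge f l m a : tends f l -> (forall y, a <= y -> m <= f y) -> m <= l.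
Proof.
  intros F Hf. apply le_epsilon. intros e He. destruct (F e He) as [M HM].
  specialize (HM (Rmax M a) (Rmax_l _ _)). specialize (Hf (Rmax M a) (Rmax_r _ _)).
  apply Rabs_le_between in HM. lra.
Qed.

Lemma tends_exp nu C f l : 0 < nu ->
  (forall y, 0 <= y -> Rabs (f y - l) <= C * exp (- nu * y)) -> tends f l.
Proof.
  intros Hnu H eps He. assert (HC := Rabs_pos C).
  assert (HM : 0 <= Rabs C / (nu * eps)) by (apply Rdiv_le_0_compat; [auto | nra]).
  (* The threshold comes from [exp (nu * y) >= 1 + nu * y]. *)
  exists (Rabs C / (nu * eps)). intros y Hy.
  assert (Hy0 : 0 <= y) by lra.
  eapply Rle_trans; [apply H; auto|].
  apply Rle_trans with (Rabs C * exp (- nu * y)).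
  { apply Rmult_le_compat_r; [left; apply exp_pos | apply Rle_abs]. }
  replace (- nu * y) with (- (nu * y)) by ring. rewrite exp_Ropp.
  assert (He1 := exp_ineq1_le (nu * y)).
  assert (Hp : 0 <= nu * y) by nra.
  apply (Rmult_le_reg_r (exp (nu * y))); [apply exp_pos|].
  rewrite Rmult_assoc, Rinv_l, Rmult_1_r by (apply Rgt_not_eq, exp_pos).
  apply Rle_trans with (eps * (1 + nu * y)); [|apply Rmult_le_compat_l; lra].
  apply (Rmult_le_compat_r (nu * eps)) in Hy; [|nra].
  replace (Rabs C / (nu * eps) * (nu * eps)) with (Rabs C) in Hy by (field; lra). nra.
Qed.

Lemma tends_zero nu f : nu < 0 -> expbd nu f -> tends f 0.
Proof.
  intros Hn [C HC]. apply (tends_exp (- nu) C); [lra|]. intros y Hy.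
  rewrite Rminus_0_r, Ropp_involutive. rewrite <- (Rabs_pos_eq y) at 2 by auto. auto.
Qed.

Lemma prim_lim_eq nu C f I : 0 < nu -> Cont f ->
  (forall x, 0 <= x -> Rabs (f x) <= C * exp (- nu * x)) -> tends (prim f) I ->
  forall y, 0 <= y -> Rabs (I - prim f y) <= C / nu * exp (- nu * y).
Proof.
  intros Hnu Hc Hf HI. destruct (prim_lim nu C f Hnu Hc Hf) as [I' HI'].
  replace I with I'; auto. apply (tends_unique (prim f)); auto.
  apply (tends_exp nu (C / nu)); auto. intros y Hy. rewrite Rabs_minus_sym; auto.
Qed.

Lemma Loc_Cont f : Loc f -> Cont f.
Proof. intros H x; apply ex_derive_continuous_R, Tame_ex, Loc_Tame, H. Qed.

Lemma Loc_prim_tends f : Loc f -> exists I, tends (prim f) I.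
Proof.
  intros Hf. destruct (Ecl_bd _ _ (Hf (- (1/2)) ltac:(lra))) as [C HC].
  destruct (prim_lim (1/2) C f) as [I HI]; [lra | apply Loc_Cont, Hf | |].
  - intros x Hx. rewrite <- (Rabs_pos_eq x) at 2 by auto. apply HC.
  - exists I. apply (tends_exp (1/2) (C / (1/2))); [lra|].
    intros y Hy. rewrite Rabs_minus_sym; auto.
Qed.

(** * The linearized operator *)

Section Operator.
Context (p : nat) (hp2 : (2 <= p)%nat).

(** The potential [1 - p Q^(p-1)] of [L], written through [T]; [dQ] solves [u'' = V u]. *)
Definition V (x : R) : R := 1 - INR p * ((INR p + 1) / 2 * (1 - T p x ^ 2)).
Definition dQ (x : R) : R := - (T p x * Q p x).
Definition ddQ (x : R) : R := (T p x ^ 2 - mm p * (1 - T p x ^ 2)) * Q p x.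
(* The formula of Rofe-Beketov for a second solution of [u'' = V u]; unlike reduction of order,
   it is regular at the zero of [dQ]. *)
Definition rr (x : R) : R := dQ x ^ 2 + ddQ x ^ 2.
Definition jj (x : R) : R := (1 + V x) * (dQ x ^ 2 - ddQ x ^ 2) / rr x ^ 2.
Definition growing (x : R) : R := dQ x * prim jj x - ddQ x / rr x.
Definition growing' (x : R) : R := ddQ x * prim jj x + dQ x / rr x.

Ltac dTQ x := let HT := fresh in let HQ := fresh in
  assert (HT := is_derive_T p x); assert (HQ := is_derive_Q p hp2 x);
  auto_derive; [repeat split; eexists; eassumption |
  rewrite ?(Derive_eta _ _ _ HT), ?(Derive_eta _ _ _ HQ)].

Lemma INRp_mm : INR p = 2 * mm p + 1.
Proof. unfold mm; field. Qed.

Lemma is_derive_dQ x : is_derive dQ x (ddQ x).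
Proof. unfold dQ, ddQ. dTQ x. ring. Qed.

Lemma is_derive_ddQ x : is_derive ddQ x (V x * dQ x).
Proof. unfold dQ, ddQ, V. dTQ x. rewrite INRp_mm. field. Qed.

Lemma Derive_Q : Derive (Q p) = dQ.
Proof. apply Derive_fun. intros; apply is_derive_Q; auto. Qed.

(** Divided by [Q^2], the quantity is [1 - w + (1 - z)^2] with [w = 1 - T^2] and [z = (mm + 1) w].
    Since [mm >= 1/2], one has [w <= 2/3 z], and completing the square leaves
    [(z - 4/3)^2 + 2/9]. *)
Lemma rr_lower x : 2 / 9 * Q p x ^ 2 <= rr x.
Proof.
  unfold rr, dQ, ddQ. assert (H := T_lt p x). assert (Hm := INRp_ge p hp2). rewrite INRp_mm in Hm.
  set (t := T p x) in *. set (q := Q p x). set (m' := mm p) in *. clearbody t q m'.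
  replace ((- (t * q)) ^ 2 + ((t ^ 2 - m' * (1 - t ^ 2)) * q) ^ 2)
    with ((t ^ 2 + (t ^ 2 - m' * (1 - t ^ 2)) ^ 2) * q ^ 2) by ring.
  apply Rmult_le_compat_r; [apply pow2_ge_0|].
  set (w := 1 - t ^ 2). assert (Hw : 0 < w) by (unfold w; lra).
  replace (t ^ 2) with (1 - w) by (unfold w; ring). clearbody w. clear H q t.
  set (z := (m' + 1) * w). assert (Hz : w <= 2/3 * z) by (unfold z; nra).
  replace (1 - w - m' * w) with (1 - z) by (unfold z; ring).
  assert (H := pow2_ge_0 (z - 4/3)). nra.
Qed.

Lemma rr_pos x : 0 < rr x.
Proof. assert (H := rr_lower x). assert (H1 := Q_pos p x). assert (0 < Q p x ^ 2) by (apply pow_lt; auto). lra. Qed.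

Lemma ex_derive_rr x : is_derive rr x (2 * dQ x * ddQ x * (1 + V x)).
Proof.
  unfold rr. assert (H1 := is_derive_dQ x). assert (H2 := is_derive_ddQ x).
  auto_derive; [repeat split; eexists; eassumption|].
  rewrite (Derive_eta _ _ _ H1), (Derive_eta _ _ _ H2). ring.
Qed.

Lemma is_derive_V x : ex_derive V x.
Proof. assert (H := is_derive_T p x). unfold V. auto_derive. repeat split; eexists; eassumption. Qed.

Lemma Cont_jj : Cont jj.
Proof.
  intros x; apply ex_derive_continuous_R. unfold jj.
  assert (H1 := is_derive_dQ x). assert (H2 := is_derive_ddQ x). assert (H3 := ex_derive_rr x).
  assert (H4 := is_derive_V x). assert (H5 := rr_pos x).
  auto_derive. repeat split; auto; try (eexists; eassumption). nra.
Qed.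

Lemma is_derive_growing x : is_derive growing x (growing' x).
Proof.
  unfold growing, growing'.
  assert (H1 := is_derive_dQ x). assert (H2 := is_derive_ddQ x). assert (H3 := ex_derive_rr x).
  assert (H4 := is_derive_prim jj x Cont_jj). assert (H5 := rr_pos x).
  auto_derive; [repeat split; try lra; eexists; eassumption|].
  rewrite (Derive_eta _ _ _ H1), (Derive_eta _ _ _ H2), (Derive_eta _ _ _ H3), (Derive_eta _ _ _ H4).
  unfold jj. assert (H6 : rr x = dQ x ^ 2 + ddQ x ^ 2) by reflexivity.
  set (r := rr x) in *. clearbody r.
  apply (Rmult_eq_reg_r (r ^ 2)); [|nra]. field_simplify; [|lra|lra]. rewrite H6. ring.
Qed.

Lemma is_derive_growing' x : is_derive growing' x (V x * growing x).
Proof.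
  unfold growing, growing'.
  assert (H1 := is_derive_dQ x). assert (H2 := is_derive_ddQ x). assert (H3 := ex_derive_rr x).
  assert (H4 := is_derive_prim jj x Cont_jj). assert (H5 := rr_pos x).
  auto_derive; [repeat split; try lra; eexists; eassumption|].
  rewrite (Derive_eta _ _ _ H1), (Derive_eta _ _ _ H2), (Derive_eta _ _ _ H3), (Derive_eta _ _ _ H4).
  unfold jj. assert (H6 : rr x = dQ x ^ 2 + ddQ x ^ 2) by reflexivity.
  set (r := rr x) in *. clearbody r.
  apply (Rmult_eq_reg_r (r ^ 2)); [|nra]. field_simplify; [|lra|lra]. rewrite H6. ring.
Qed.

Lemma wronskian x : dQ x * growing' x - ddQ x * growing x = 1.
Proof.
  unfold growing, growing'. assert (H5 := rr_pos x). assert (H6 : rr x = dQ x ^ 2 + ddQ x ^ 2) by reflexivity.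
  replace (dQ x * (ddQ x * prim jj x + dQ x / rr x) - ddQ x * (dQ x * prim jj x - ddQ x / rr x))
    with ((dQ x ^ 2 + ddQ x ^ 2) / rr x) by (field; lra). rewrite <- H6. field; lra.
Qed.

Lemma V_Ecl : Ecl 0 V.
Proof.
  unfold V. intros n. set (K := INR p * ((INR p + 1) / 2)).
  replace (fun x => 1 - INR p * ((INR p + 1) / 2 * (1 - T p x ^ 2))) with (fun x => (1 - K) + K * (T p x * T p x))
    by (apply functional_extensionality; intros; unfold K; ring).
  apply Bn_plus; [apply Bn_const; lra|]. apply Bn_scal. replace 0 with (0 + 0) by ring.
  apply Bn_mult; apply T_Ecl; auto.
Qed.

Lemma dQ_Ecl : Ecl (-1) dQ.
Proof. rewrite <- Derive_Q. apply Ecl_Derive, Q_Ecl; auto. Qed.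

Lemma Derive_dQ : Derive dQ = ddQ.
Proof. apply Derive_fun, is_derive_dQ. Qed.

Lemma ddQ_Ecl : Ecl (-1) ddQ.
Proof. rewrite <- Derive_dQ. apply Ecl_Derive, dQ_Ecl. Qed.

Lemma rr_inv_bd : expbd 2 (fun x => / rr x).
Proof.
  destruct (Q_bounds p hp2) as [c1 [c2 [H1 [H2 H]]]].
  exists (/ (2/9 * c1 ^ 2)). intros x. destruct (H x) as [Hx _].
  rewrite Rabs_pos_eq by (left; apply Rinv_0_lt_compat, rr_pos).
  replace (2 * Rabs x) with (- (- Rabs x + - Rabs x)) by ring.
  rewrite exp_Ropp, exp_plus. assert (He := exp_pos (- Rabs x)). set (e := exp (- Rabs x)) in *.
  rewrite <- Rinv_mult. apply Rinv_le_contravar; [apply Rmult_lt_0_compat; nra|].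
  apply Rle_trans with (2/9 * Q p x ^ 2); [|apply rr_lower].
  assert ((c1 * e) * (c1 * e) <= Q p x * Q p x) by (apply Rmult_le_compat; nra). nra.
Qed.

Lemma expbd_ext nu f g : (forall x, f x = g x) -> expbd nu f -> expbd nu g.
Proof. intros H [C HC]; exists C; intros x; rewrite <- H; auto. Qed.

(** The factor [dQ^2 - ddQ^2] is at most [rr] in absolute value, which leaves a single inverse power
    of [rr]. *)
Lemma jj_bd : expbd 2 jj.
Proof.
  assert (B := rr_inv_bd). assert (BV := Ecl_bd _ _ V_Ecl).
  apply (expbd_plus 0 (fun _ => 1)) in BV; [|apply expbd_const; lra].
  assert (B' := expbd_mult _ _ _ _ BV B). rewrite Rplus_0_l in B'.
  destruct B' as [C HC]. exists C; intros x. eapply Rle_trans; [|apply HC].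
  unfold jj. assert (Hr := rr_pos x).
  replace ((1 + V x) * (dQ x ^ 2 - ddQ x ^ 2) / rr x ^ 2)
    with (((1 + V x) * / rr x) * ((dQ x ^ 2 - ddQ x ^ 2) / rr x)) by (field; lra).
  rewrite Rabs_mult. rewrite <- (Rmult_1_r (Rabs ((1 + V x) * / rr x))) at 2.
  apply Rmult_le_compat_l; [apply Rabs_pos|].
  unfold Rdiv; rewrite Rabs_mult, (Rabs_pos_eq (/ rr x)) by (left; apply Rinv_0_lt_compat; auto).
  apply (Rmult_le_reg_r (rr x)); auto. rewrite Rmult_assoc, Rinv_l, Rmult_1_r, Rmult_1_l by lra.
  unfold rr. assert (H1 := pow2_ge_0 (dQ x)). assert (H2 := pow2_ge_0 (ddQ x)).
  apply Rabs_le; split; lra.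
Qed.

Lemma prim_bd nu f : 0 < nu -> Cont f -> expbd nu f -> expbd nu (prim f).
Proof.
  intros Hn Hc Hf. apply expbd_int; auto.
  - intros x; eexists; apply is_derive_prim; auto.
  - rewrite (Derive_fun _ f); auto. intros; apply is_derive_prim; auto.
Qed.

Lemma growing_bd : expbd 1 growing.
Proof.
  assert (B1 := expbd_mult _ _ _ _ (Ecl_bd _ _ dQ_Ecl) (prim_bd 2 _ ltac:(lra) Cont_jj jj_bd)).
  assert (B2 := expbd_mult _ _ _ _ (Ecl_bd _ _ ddQ_Ecl) rr_inv_bd).
  replace (-1 + 2) with 1 in * by ring.
  apply (expbd_ext _ (fun x => dQ x * prim jj x + (-1) * (ddQ x * / rr x))).
  - intros x; unfold growing, Rdiv; ring.
  - apply expbd_plus; auto. replace 1 with (0 + 1) by ring.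
    apply (expbd_mult 0 1 (fun _ => -1)); auto. apply expbd_const; lra.
Qed.

Lemma growing'_bd : expbd 1 growing'.
Proof.
  assert (B1 := expbd_mult _ _ _ _ (Ecl_bd _ _ ddQ_Ecl) (prim_bd 2 _ ltac:(lra) Cont_jj jj_bd)).
  assert (B2 := expbd_mult _ _ _ _ (Ecl_bd _ _ dQ_Ecl) rr_inv_bd).
  replace (-1 + 2) with 1 in * by ring.
  apply (expbd_ext _ (fun x => ddQ x * prim jj x + (dQ x * / rr x))); auto using expbd_plus.
Qed.

Lemma V_even : parity false V.
Proof. intros x; unfold V; rewrite T_odd; simpl; ring. Qed.
Lemma dQ_odd : parity true dQ.
Proof. intros x; unfold dQ; rewrite T_odd, Q_even by auto; simpl; ring. Qed.
Lemma ddQ_even : parity false ddQ.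
Proof. intros x; unfold ddQ; rewrite T_odd, Q_even by auto; simpl; ring. Qed.
Lemma growing_even : parity false growing.
Proof.
  intros x; unfold growing. assert (P1 := dQ_odd x). assert (P2 := ddQ_even x). simpl in P1, P2.
  assert (Hr : rr (- x) = rr x) by (unfold rr; rewrite P1, P2; ring).
  rewrite (prim_parity false jj Cont_jj); [|intros z; unfold jj, rr;
    rewrite dQ_odd, ddQ_even, V_even; change (sg true) with (-1); change (sg false) with 1;
    replace (-1 * dQ z) with (- dQ z) by ring; rewrite !Rmult_1_l, <- !Rsqr_pow2, <- Rsqr_neg; auto].
  rewrite Hr, P1, P2. simpl. field. assert (H := rr_pos x); lra.
Qed.

(** The equation [L u = f], with [L u = - u'' + V u]. *)
Definition sol (u f : R -> R) : Prop :=
  (forall x, ex_derive u x) /\ forall x, is_derive (Derive u) x (V x * u x - f x).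

(** The equation expresses the second derivative through [u] and [f], so all derivatives inherit the
    rate of [u], [Derive u] and [f]. *)
Lemma sol_bootstrap nu u f : sol u f -> Ecl nu f -> expbd nu u -> expbd nu (Derive u) -> Ecl nu u.
Proof.
  intros [H1 H2] Hf Hu Hu'.
  assert (K : forall n, Bn nu n u /\ Bn nu n (Derive u)).
  { induction n as [|n [IH1 IH2]]; [simpl; auto|].
    split; split; auto; split; auto; [intros x; eexists; apply H2|].
    rewrite (Derive_fun _ (fun x => V x * u x + (-1) * f x)).
    - apply Bn_plus; [|apply Bn_scal; auto]. replace nu with (0 + nu) by ring.
      apply Bn_mult; auto. apply V_Ecl.
    - intros x. replace (V x * u x + -1 * f x) with (V x * u x - f x) by ring. apply H2. }
  intros n; apply K.
Qed.

Lemma sol_refl u f : sol u f -> sol (fun x => u (- x)) (fun x => f (- x)).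
Proof.
  intros [H1 H2].
  assert (D : forall x : R, is_derive (fun x : R => u (- x)) x (- Derive u (- x)))
    by (apply (is_derive_refl u (Derive u)); intros x; apply Derive_correct, H1).
  split; [intros x; eexists; apply D|].
  rewrite (Derive_fun _ _ D). intros x. assert (D2 := is_derive_refl _ _ H2 x).
  cbv beta in D2. rewrite V_even in D2. change (sg false) with 1 in D2. rewrite Rmult_1_l in D2.
  assert (D3 := is_derive_scal _ _ (-1) _ D2).
  replace (V x * u (- x) - f (- x)) with (-1 * - (V x * u (- x) - f (- x))) by ring.
  apply (is_derive_ext (fun x : R => -1 * Derive u (- x))); [intros t; lra | exact D3].
Qed.

(** In the first term the primitive grows at the rate [1 + nu > 0] and [g1] takes one unit back. In
    the second one, [I] being the half-line integral, the tail decays at the rate [1 - nu > 0],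
    against the growth of [g2]. The functions [g1], [g2] are free so as to cover both the solution
    and its derivative. *)
Lemma green_bound nu C f g1 g2 I : -1 < nu < 1 -> Cont f ->
  (forall x, Rabs (f x) <= C * exp (nu * Rabs x)) ->
  expbd (-1) g1 -> expbd 1 g2 -> tends (prim (fun x => dQ x * f x)) I ->
  exists C', forall y, 0 <= y ->
   Rabs (g1 y * prim (fun x => growing x * f x) y + g2 y * (I - prim (fun x => dQ x * f x) y)) <= C' * exp (nu * y).
Proof.
  intros Hnu Hc Hf [C1 H1] [C2 H2] HI.
  assert (Bf : expbd nu f) by (exists C; auto).
  assert (Bf1 := expbd_mult _ _ _ _ (Ecl_bd _ _ dQ_Ecl) Bf).
  assert (Bf2 := expbd_mult _ _ _ _ growing_bd Bf).
  assert (Hc1 : Cont (fun x => dQ x * f x)).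
  { intros x. apply (continuous_mult dQ f); auto.
    apply ex_derive_continuous_R; eexists; apply is_derive_dQ. }
  assert (Hc2 : Cont (fun x => growing x * f x)).
  { intros x. apply (continuous_mult growing f); auto.
    apply ex_derive_continuous_R; eexists; apply is_derive_growing. }
  destruct (prim_bd (1 + nu) _ ltac:(lra) Hc2 Bf2) as [D2 HD2].
  destruct Bf1 as [D1 HD1].
  assert (HI' : forall y, 0 <= y ->
    Rabs (I - prim (fun x => dQ x * f x) y) <= D1 / (1 - nu) * exp (- (1 - nu) * y)).
  { apply prim_lim_eq; auto; [lra|].
    intros x Hx. eapply Rle_trans; [apply HD1|]. rewrite (Rabs_pos_eq x) by auto.
    apply Req_le. f_equal. f_equal. ring. }
  exists (Rabs C1 * Rabs D2 + Rabs C2 * Rabs (D1 / (1 - nu))). intros y Hy.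
  specialize (H1 y); specialize (H2 y); specialize (HD2 y); specialize (HI' y Hy).
  rewrite (Rabs_pos_eq y) in H1, H2, HD2 by auto.
  eapply Rle_trans; [apply Rabs_triang|]. rewrite !Rabs_mult, Rmult_plus_distr_r.
  assert (Aux : forall a b c d e1 e2, Rabs a <= b * exp e1 -> Rabs c <= d * exp e2 -> e1 + e2 = nu * y ->
    Rabs a * Rabs c <= Rabs b * Rabs d * exp (nu * y)).
  { intros a b c d e1 e2 Ha Hb He. rewrite <- He, exp_plus.
    replace (Rabs b * Rabs d * (exp e1 * exp e2)) with ((Rabs b * exp e1) * (Rabs d * exp e2)) by ring.
    apply Rmult_le_compat; auto using Rabs_pos.
    - eapply Rle_trans; [apply Ha|]. apply Rmult_le_compat_r; [left; apply exp_pos | apply Rle_abs].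
    - eapply Rle_trans; [apply Hb|]. apply Rmult_le_compat_r; [left; apply exp_pos | apply Rle_abs]. }
  apply Rplus_le_compat; eapply Aux; eauto; ring.
Qed.

End Operator.

(** * Inversion of the linearized operator *)

Section Inversion.
Context (p : nat) (hp2 : (2 <= p)%nat).

Lemma Cont_dQ_mult f : Cont f -> Cont (fun x => dQ p x * f x).
Proof.
  intros Hc x. apply (continuous_mult (dQ p) f); auto.
  apply ex_derive_continuous_R; eexists; apply is_derive_dQ; auto.
Qed.

Lemma Cont_growing_mult f : Cont f -> Cont (fun x => growing p x * f x).
Proof.
  intros Hc x. apply (continuous_mult (growing p) f); auto.
  apply ex_derive_continuous_R; eexists; apply is_derive_growing; auto.
Qed.

(** Variation of constants. When [I] is the half-line integral of [dQ p x * f x], the coefficient of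
    the growing solution is a tail, which vanishes at plus infinity. *)
Definition green (f : R -> R) (I : R) (g1 g2 : R -> R) (y : R) : R :=
  g1 y * prim (fun x => growing p x * f x) y + g2 y * (I - prim (fun x => dQ p x * f x) y).

Lemma green_derive f I g1 g2 dg1 dg2 : Cont f ->
  (forall x, is_derive g1 x (dg1 x)) -> (forall x, is_derive g2 x (dg2 x)) ->
  forall x, is_derive (green f I g1 g2) x
    (green f I dg1 dg2 x + (g1 x * growing p x - g2 x * dQ p x) * f x).
Proof.
  intros Hc H1 H2 x. unfold green.
  assert (D1 := is_derive_prim _ x (Cont_dQ_mult f Hc)).
  assert (D2 := is_derive_prim _ x (Cont_growing_mult f Hc)).
  specialize (H1 x); specialize (H2 x).
  auto_derive; [repeat split; eexists; eassumption|].
  rewrite (Derive_eta _ _ _ H1), (Derive_eta _ _ _ H2), (Derive_eta _ _ _ D1), (Derive_eta _ _ _ D2).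
  ring.
Qed.

Lemma green_sol f I : Cont f ->
  (sol p) (green f I (dQ p) (growing p)) f /\ Derive (green f I (dQ p) (growing p)) = green f I (ddQ p) (growing' p).
Proof.
  intros Hc.
  assert (D : forall x, is_derive (green f I (dQ p) (growing p)) x (green f I (ddQ p) (growing' p) x)).
  { intros x. replace (green f I (ddQ p) (growing' p) x) with
      (green f I (ddQ p) (growing' p) x + (dQ p x * growing p x - growing p x * dQ p x) * f x) by ring.
    apply green_derive; auto; intros; [apply is_derive_dQ | apply is_derive_growing]; auto. }
  assert (HD : Derive (green f I (dQ p) (growing p)) = green f I (ddQ p) (growing' p)) by (apply Derive_fun, D).
  split; auto. split; [intros x; eexists; apply D|]. rewrite HD. intros x.
  assert (W := wronskian p hp2 x).
  replace (V p x * green f I (dQ p) (growing p) x - f x) with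
    (green f I (fun x => V p x * dQ p x) (fun x => V p x * growing p x) x + (ddQ p x * growing p x - growing' p x * dQ p x) * f x).
  - apply green_derive; auto; intros; [apply is_derive_ddQ | apply is_derive_growing']; auto.
  - replace (ddQ p x * growing p x - growing' p x * dQ p x) with (- 1) by lra. unfold green. ring.
Qed.

(** A solution that grows at most at the rate 1/2 has no growing component, so on the half-line it
    is the Green formula plus a multiple of [dQ p], and therefore has the rate of the source. *)
Lemma halfline_bound nu u f : -1 < nu < 1 -> Cont f -> expbd nu f -> sol p u f ->
  expbd (1/2) u -> expbd (1/2) (Derive u) ->
  exists C, forall y, 0 <= y -> Rabs (u y) <= C * exp (nu * y) /\ Rabs (Derive u y) <= C * exp (nu * y).
Proof.
  intros Hnu Hc [C HC] [S1 S2] B0 B1.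
  assert (D0 : forall x, is_derive u x (Derive u x)) by (intros; apply Derive_correct, S1).
  (* Lagrange identity: the Wronskian of [u] with a homogeneous solution [g] has derivative
     [- g f]. *)
  assert (Wd : forall g dg, (forall x, is_derive g x (dg x)) -> (forall x, is_derive dg x (V p x * g x)) ->
     Cont (fun x => g x * f x) ->
     forall y, g y * Derive u y - dg y * u y + prim (fun x => g x * f x) y
             = g 0 * Derive u 0 - dg 0 * u 0).
  { intros g dg Hg Hdg Hgc y.
    rewrite (is_derive_const_eq (fun y => g y * Derive u y - dg y * u y + prim (fun x => g x * f x) y)).
    - rewrite prim_0; ring.
    - intros x. assert (D1 := is_derive_prim _ x Hgc).
      specialize (Hg x); specialize (Hdg x); specialize (S2 x); specialize (D0 x).
      auto_derive; [repeat split; eexists; eassumption|].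
      rewrite (Derive_eta _ _ _ Hg), (Derive_eta _ _ _ Hdg), (Derive_eta _ _ _ D1).
      rewrite (Derive_eta _ _ _ S2). change (Derive (fun x0 : R => u x0) x) with (Derive u x). ring. }
  assert (W1 := Wd (dQ p) (ddQ p) (is_derive_dQ p hp2) (is_derive_ddQ p hp2) (Cont_dQ_mult f Hc)).
  assert (W2 := Wd (growing p) (growing' p) (is_derive_growing p hp2) (is_derive_growing' p hp2) (Cont_growing_mult f Hc)).
  set (I := dQ p 0 * Derive u 0 - ddQ p 0 * u 0) in *.
  set (J := growing p 0 * Derive u 0 - growing' p 0 * u 0) in *.
  (* The Wronskian with [dQ p] has the rate [-1 + 1/2] and tends to zero, which identifies the
     constant [I] as the half-line integral. *)
  assert (HI : tends (prim (fun x => dQ p x * f x)) I).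
  { assert (B2 := expbd_mult _ _ _ _ (Ecl_bd _ _ (dQ_Ecl p hp2)) B1).
    assert (B3 := expbd_mult _ _ _ _ (Ecl_bd _ _ (ddQ_Ecl p hp2)) B0).
    apply tends_zero in B2; [|lra]. apply tends_zero in B3; [|lra].
    assert (T := tends_plus _ _ _ _ (tends_scal _ (-1) _ B2) B3).
    assert (TI : tends (fun _ => I) I).
    { intros e He. exists 0. intros. rewrite Rminus_diag, Rabs_R0; lra. }
    assert (T' := tends_plus _ _ _ _ T TI).
    replace (-1 * 0 + 0 + I) with I in T' by ring.
    eapply tends_ext; [|apply T']. intros y; simpl. specialize (W1 y). lra. }
  (* Cramer's rule: the two Wronskians determine [u] and [Derive u], as the homogeneous solutions
     have Wronskian 1. *)
  assert (Rep : forall y, u y = green f I (dQ p) (growing p) y + - J * dQ p y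
                       /\ Derive u y = green f I (ddQ p) (growing' p) y + - J * ddQ p y).
  { intros y. assert (W := wronskian p hp2 y). specialize (W1 y); specialize (W2 y). unfold green.
    replace (I - prim (fun x => dQ p x * f x) y) with (dQ p y * Derive u y - ddQ p y * u y) by lra.
    replace (prim (fun x => growing p x * f x) y) with (J - (growing p y * Derive u y - growing' p y * u y)) by lra.
    split.
    - transitivity ((dQ p y * growing' p y - ddQ p y * growing p y) * u y); [rewrite W; ring | ring].
    - transitivity ((dQ p y * growing' p y - ddQ p y * growing p y) * Derive u y); [rewrite W; ring | ring]. }
  assert (G : forall g1 g2, expbd (-1) g1 -> expbd 1 g2 -> exists C', forall y, 0 <= y ->
     Rabs (green f I g1 g2 y + - J * g1 y) <= C' * exp (nu * y)).
  { intros g1 g2 Hg1 Hg2.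
    destruct (green_bound p hp2 nu C f g1 g2 I Hnu Hc HC Hg1 Hg2 HI) as [C1 H1].
    apply (expbd_mono _ nu) in Hg1; [|lra]. destruct Hg1 as [C2 H2].
    exists (C1 + Rabs J * C2). intros y Hy.
    eapply Rle_trans; [apply Rabs_triang|]. rewrite Rmult_plus_distr_r.
    apply Rplus_le_compat; [apply H1; auto|].
    rewrite Rabs_mult, Rabs_Ropp, Rmult_assoc. apply Rmult_le_compat_l; [apply Rabs_pos|].
    rewrite <- (Rabs_pos_eq y) at 2 by auto. apply H2. }
  destruct (G (dQ p) (growing p) (Ecl_bd _ _ (dQ_Ecl p hp2)) (growing_bd p hp2)) as [C1 H1].
  destruct (G (ddQ p) (growing' p) (Ecl_bd _ _ (ddQ_Ecl p hp2)) (growing'_bd p hp2)) as [C2 H2].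
  exists (Rabs C1 + Rabs C2). intros y Hy. destruct (Rep y) as [R1 R2].
  assert (He := exp_pos (nu * y)).
  assert (K1 := Rle_abs C1). assert (K2 := Rle_abs C2). assert (K3 := Rabs_pos C1). assert (K4 := Rabs_pos C2).
  rewrite R1, R2. split; (eapply Rle_trans; [first [apply H1 | apply H2]; auto|]; apply Rmult_le_compat_r; lra).
Qed.

Lemma expbd_halves nu u C : (forall y, 0 <= y -> Rabs (u y) <= C * exp (nu * y) /\ Rabs (u (- y)) <= C * exp (nu * y)) ->
  expbd nu u.
Proof.
  intros H; exists C; intros x. destruct (Rle_dec 0 x) as [Hx|Hx].
  - rewrite (Rabs_pos_eq x) by auto. apply H; auto.
  - rewrite (Rabs_left x) by lra. rewrite <- (Ropp_involutive x) at 1. apply H. lra.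
Qed.

Lemma sol_Ecl nu u f : -1 < nu < 1 -> Ecl nu f -> sol p u f -> Tame u -> Ecl nu u.
Proof.
  intros Hnu Hf Hs Hu.
  assert (Hc : Cont f) by (intros x; apply ex_derive_continuous_R, (Ecl_ex nu), Hf).
  assert (Hu' := Tame_Derive _ Hu).
  assert (B0 := Ecl_bd _ _ (Hu (1/2) ltac:(lra))). assert (B1 := Ecl_bd _ _ (Hu' (1/2) ltac:(lra))).
  destruct (halfline_bound nu u f Hnu Hc (Ecl_bd _ _ Hf) Hs B0 B1) as [C1 H1].
  assert (Refl : forall nu g, expbd nu g -> expbd nu (fun x => g (- x))).
  { intros mu g [C HC]; exists C; intros x. rewrite <- (Rabs_Ropp x). auto. }
  assert (DR : Derive (fun x : R => u (- x)) = fun x : R => - Derive u (- x)).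
  { apply Derive_fun. apply (is_derive_refl u (Derive u)). intros; apply Derive_correct, Hs. }
  assert (B1' : expbd (1/2) (Derive (fun x : R => u (- x)))).
  { rewrite DR. destruct (Refl _ _ B1) as [C HC]; exists C; intros x; rewrite Rabs_Ropp; apply HC. }
  destruct (halfline_bound nu (fun x : R => u (- x)) (fun x => f (- x))) as [C2 H2]; auto.
  - intros x. apply (continuous_comp Ropp f); auto. apply ex_derive_continuous_R. auto_derive; auto.
  - apply Refl, Ecl_bd, Hf.
  - apply sol_refl; auto.
  - rewrite DR in H2.
    assert (Hab : forall y, 0 <= y -> C1 * exp (nu * y) <= (Rabs C1 + Rabs C2) * exp (nu * y) /\
                           C2 * exp (nu * y) <= (Rabs C1 + Rabs C2) * exp (nu * y)).
    { intros y Hy. assert (He := exp_pos (nu * y)).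
      assert (K1 := Rle_abs C1). assert (K2 := Rle_abs C2).
      assert (K3 := Rabs_pos C1). assert (K4 := Rabs_pos C2).
      split; apply Rmult_le_compat_r; lra. }
    apply (sol_bootstrap p nu u f); auto; apply (expbd_halves nu _ (Rabs C1 + Rabs C2)); intros y Hy;
      specialize (H1 y Hy); specialize (H2 y Hy); specialize (Hab y Hy); cbv beta in H2;
      rewrite Rabs_Ropp in H2; lra.
Qed.

Lemma sol_Loc u f : Loc f -> sol p u f -> Tame u -> Loc u.
Proof.
  intros Hf Hs Hu nu Hnu. apply (Ecl_mono (Rmin nu 0)); [apply Rmin_l|].
  assert (H : -1 < Rmin nu 0 < 1) by (unfold Rmin; destruct Rle_dec; lra).
  apply (sol_Ecl _ u f); auto. apply Hf; lra.
Qed.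

Lemma Tame_V : Tame (V p).
Proof. intros nu Hnu; eapply Ecl_mono; [|apply V_Ecl; auto]; lra. Qed.


Lemma Q_pow_pred x : Q p x ^ (p - 1) = (INR p + 1) / 2 * (1 - T p x ^ 2).
Proof.
  assert (H := Q_pow p hp2 x). assert (H0 := Q_pos p x).
  replace p with (S (p - 1)) in H at 2 by lia. rewrite <- tech_pow_Rmult in H.
  apply (Rmult_eq_reg_l (Q p x)); lra.
Qed.

Lemma V_Q x : V p x = 1 - INR p * Q p x ^ (p - 1).
Proof. unfold V. rewrite Q_pow_pred. ring. Qed.

Lemma Tame_pow f n : Tame f -> Tame (fun x => f x ^ n).
Proof. intros Hf; induction n; simpl; [apply Tame_const | apply Tame_mult; auto]. Qed.

Lemma Loc_pow f n : Loc f -> Loc (fun x => f x ^ S n).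
Proof. intros Hf; simpl. apply Loc_mult_Tame, Tame_pow, Loc_Tame; auto. Qed.

Lemma Loc_Qpow n : (1 <= n)%nat -> Loc (fun x => Q p x ^ n).
Proof. intros H; destruct n; [lia|]. apply Loc_pow, Q_Loc; auto. Qed.

Lemma is_derive_V' (x : R) : is_derive (V p) x (- Derive (fun x => INR p * Q p x ^ (p - 1)) x).
Proof.
  assert (HV : V p = fun x => 1 - INR p * Q p x ^ (p - 1)) by (apply functional_extensionality, V_Q).
  rewrite HV.
  assert (D := Derive_correct (fun x => INR p * Q p x ^ (p - 1)) x).
  assert (ex_derive (fun x => INR p * Q p x ^ (p - 1)) x).
  { apply Tame_ex, Tame_scal, Loc_Tame, Loc_Qpow; lia. }
  replace (- Derive (fun x => INR p * Q p x ^ (p - 1)) x) with (0 - Derive (fun x => INR p * Q p x ^ (p - 1)) x) by ring.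
  apply @is_derive_minus; [apply @is_derive_const | auto].
Qed.

Lemma Loc_DV : Loc (Derive (V p)).
Proof.
  rewrite (Derive_fun _ _ is_derive_V').
  replace (fun x => - Derive (fun x => INR p * Q p x ^ (p - 1)) x)
    with (fun x => (-1) * Derive (fun x => INR p * Q p x ^ (p - 1)) x)
    by (apply functional_extensionality; intros; ring).
  apply Loc_scal, Loc_Derive, Loc_scal, Loc_Qpow; lia.
Qed.

(** [Derive u] solves the same equation with source [f' - V' u]. Since [V] is constant up to a
    localized term, [V' u] is localized, and the induction loses no degree. *)
Lemma sol_Pol n u f : Pol n f -> sol p u f -> Tame u -> Pol n u.
Proof.
  revert u f; induction n; intros u f Hf Hs Hu; [eapply sol_Loc; eauto|].
  split; [apply Hs|]. destruct Hs as [S1 S2]. destruct Hf as [F1 F2].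
  apply (IHn _ (fun x => Derive f x - Derive (V p) x * u x)).
  - apply Pol_minus; auto. apply Loc_Pol, Loc_mult_Tame; auto using Loc_DV.
  - split; [intros x; eexists; apply S2|].
    rewrite (Derive_fun _ _ S2). intros x.
    assert (DV := is_derive_V' x). assert (Du := Derive_correct _ _ (S1 x)).
    assert (Df := Derive_correct _ _ (F1 x)).
    replace (V p x * Derive u x - (Derive f x - Derive (V p) x * u x))
      with ((Derive (V p) x * u x + V p x * Derive u x) - Derive f x) by ring.
    apply @is_derive_minus; auto. apply is_derive_mult_R; auto.
    apply Derive_correct; eexists; eauto.
  - apply Tame_Derive; auto.
Qed.

Lemma Loc_dQ_mult f : Tame f -> Loc (fun x => dQ p x * f x).
Proof.
  intros H; apply Loc_mult_Tame; auto. rewrite <- Derive_Q by auto. apply Loc_Derive, Q_Loc; auto.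
Qed.

Lemma Tame_Cont f : Tame f -> Cont f.
Proof. intros H x; apply ex_derive_continuous_R, Tame_ex, H. Qed.

Lemma Tame_intro f : (forall nu, 0 < nu < 1 -> Ecl nu f) -> Tame f.
Proof.
  intros H nu Hnu. apply (Ecl_mono (Rmin nu (1/2))); [apply Rmin_l|]. apply H.
  unfold Rmin; destruct Rle_dec; lra.
Qed.

(** The kernel is spanned by the odd function [dQ p]. For an even source the Green formula is even
    whatever the value of [I]. For an odd source it is odd exactly when [I = 0], which is
    orthogonality to the kernel. Parity then carries the bound over to the left half-line. *)
Lemma sol_exists b f : Tame f -> parity b f -> (b = true -> tends (prim (fun x => dQ p x * f x)) 0) ->
  exists u, Tame u /\ parity b u /\ sol p u f.
Proof.
  intros Hf Hb Hcond. assert (Hc := Tame_Cont f Hf).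
  destruct (Loc_prim_tends _ (Loc_dQ_mult f Hf)) as [I HI].
  assert (HI0 : b = true -> I = 0) by (intros Hb'; apply (tends_unique _ _ _ HI); auto).
  destruct (green_sol f I Hc) as [HS HD].
  set (u := green f I (dQ p) (growing p)) in *.
  assert (Hp : parity b u).
  { intros y. unfold u, green.
    rewrite (prim_parity (xorb false b) _ (Cont_growing_mult f Hc)) by (apply parity_mult; auto; apply growing_even; auto).
    rewrite (prim_parity (xorb true b) _ (Cont_dQ_mult f Hc)) by (apply parity_mult; auto; apply dQ_odd; auto).
    rewrite dQ_odd, growing_even by auto.
    destruct b; simpl; [rewrite (HI0 eq_refl)|]; ring. }
  exists u; split; [|split]; auto.
  assert (Hpd := parity_Derive b u (proj1 HS) Hp).
  assert (Habs : forall b' y, Rabs (sg b' * y) = Rabs y).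
  { intros b' y; rewrite Rabs_mult. replace (Rabs (sg b')) with 1; [ring|].
    destruct b'; simpl; [rewrite Rabs_left | rewrite Rabs_right]; lra. }
  apply Tame_intro. intros nu Hnu.
  destruct (Ecl_bd _ _ (Hf nu ltac:(lra))) as [C HC].
  apply (sol_bootstrap p nu u f); auto; [apply Hf; lra| |].
  - destruct (green_bound p hp2 nu C f (dQ p) (growing p) I) as [C1 H1]; auto; [lra| | |].
    + apply Ecl_bd, dQ_Ecl; auto.
    + apply growing_bd; auto.
    + apply (expbd_halves nu _ C1). intros y Hy. rewrite Hp, Habs. split; apply H1; auto.
  - destruct (green_bound p hp2 nu C f (ddQ p) (growing' p) I) as [C1 H1]; auto; [lra| | |].
    + apply Ecl_bd, ddQ_Ecl; auto.
    + apply growing'_bd; auto.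
    + apply (expbd_halves nu _ C1). intros y Hy. rewrite Hpd, Habs, HD. split; apply H1; auto.
Qed.

End Inversion.

Lemma Pol_intro n f f' : (forall x : R, is_derive f x (f' x)) -> Pol n f' -> Pol (S n) f.
Proof.
  intros H H'; split; [intros x; eexists; apply H|]. rewrite (Derive_fun _ _ H); auto.
Qed.

Lemma Pol_prim n f : Pol n f -> Pol (S n) (prim f).
Proof.
  intros H; apply (Pol_intro n _ f); auto.
  intros; apply is_derive_prim, Tame_Cont, (Pol_Tame n), H.
Qed.

Lemma Tame_id : Tame (fun x => x).
Proof.
  apply (Pol_Tame 2). apply (Pol_intro 1 _ (fun _ => 1)); [intros; apply @is_derive_id|].
  apply (Pol_const 0).
Qed.

Lemma Tame_ext f g : (forall x, f x = g x) -> Tame f -> Tame g.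
Proof. intros H; replace g with f; auto. now apply functional_extensionality. Qed.

Lemma Loc_ext f g : (forall x, f x = g x) -> Loc f -> Loc g.
Proof. intros H; replace g with f; auto. now apply functional_extensionality. Qed.

Lemma Loc_mult_Tame_r f g : Tame f -> Loc g -> Loc (fun x => f x * g x).
Proof. intros F G; apply (Loc_ext (fun x => g x * f x)); [intros; ring|]. apply Loc_mult_Tame; auto. Qed.

Lemma Loc_tends f : Loc f -> tends f 0.
Proof. intros H; apply (tends_zero (-1/2)); [lra|]. apply Ecl_bd, H; lra. Qed.

Lemma prim_lin f g a : Cont f -> Cont g -> forall x, prim (fun x => f x + a * g x) x = prim f x + a * prim g x.
Proof.
  intros F G x.
  assert (Hc : Cont (fun x => f x + a * g x)).
  { intros z; apply (continuous_plus f (fun x => a * g x)); auto.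
    apply (continuous_scal_r a g); auto. }
  rewrite (prim_unique _ (fun x => prim f x + a * prim g x)); auto; [rewrite !prim_0; ring|].
  intros z. apply @is_derive_plus; [|apply is_derive_scal]; apply is_derive_prim; auto.
Qed.

(** The primitive that vanishes at plus infinity is even because [F] is odd, so it also vanishes at
    minus infinity and remains localized. *)
Lemma Loc_even_primitive F : Loc F -> parity true F ->
  exists S, Loc S /\ parity false S /\ forall x : R, is_derive S x (F x).
Proof.
  intros HF Hodd. assert (Hc := Loc_Cont F HF).
  destruct (Loc_prim_tends F HF) as [I HI].
  exists (fun x => prim F x - I).
  assert (D : forall x : R, is_derive (fun x => prim F x - I) x (F x)).
  { intros x. replace (F x) with (F x - 0) by ring.
    apply @is_derive_minus; [apply is_derive_prim; auto | apply @is_derive_const]. }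
  assert (Hp : parity false (fun x => prim F x - I)).
  { intros x; rewrite (prim_parity true F Hc Hodd); simpl; ring. }
  split; [|split]; auto.
  intros nu Hnu. apply (Ecl_mono (Rmin nu (-1/2))); [apply Rmin_l|].
  set (mu := Rmin nu (-1/2)). assert (Hmu : -1 < mu /\ mu <= -1/2).
  { unfold mu; split; [apply Rmin_glb_lt; lra | apply Rmin_r]. }
  apply Ecl_intro; [| intros x; eexists; apply D |].
  - destruct (Ecl_bd _ _ (HF mu ltac:(lra))) as [C HC].
    apply (expbd_halves mu _ (C / - mu)). intros y Hy. rewrite Hp. simpl sg. rewrite Rmult_1_l.
    assert (K : Rabs (prim F y - I) <= C / - mu * exp (mu * y)).
    { rewrite Rabs_minus_sym. replace mu with (- - mu) at 2 by ring.
      apply (prim_lim_eq (- mu) C F); auto; [lra|].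
      intros x Hx. rewrite Ropp_involutive. rewrite <- (Rabs_pos_eq x) at 2 by auto. apply HC. }
    split; apply K.
  - rewrite (Derive_fun _ F); auto. apply HF; lra.
Qed.

(** * The pair of equations at one level *)

Section Solve.
Context (p : nat) (hp : (p = 2 \/ p = 3 \/ p = 4)%nat).

Lemma hp_ge2 : (2 <= p)%nat.
Proof. lia. Qed.
Let hp2 := hp_ge2.


Lemma ddQ_eq x : ddQ p x = Q p x - Q p x ^ p.
Proof. rewrite Q_pow by apply hp2. unfold ddQ. rewrite INRp_mm. field. Qed.

Lemma V_mult_Q x : V p x * Q p x = Q p x - INR p * Q p x ^ p.
Proof. rewrite Q_pow by apply hp2. unfold V. ring. Qed.

Lemma Loc_dQ : Loc (dQ p).
Proof. rewrite <- Derive_Q by apply hp2. apply Loc_Derive, Q_Loc, hp2. Qed.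

Lemma Loc_ddQ : Loc (ddQ p).
Proof. rewrite <- Derive_dQ by apply hp2. apply Loc_Derive, Loc_dQ. Qed.

Lemma Loc_1V : Loc (fun x => 1 - V p x).
Proof.
  apply (Loc_ext (fun x => INR p * Q p x ^ (p - 1))); [intros; rewrite V_Q by apply hp2; ring|].
  apply Loc_scal, Loc_Qpow; [apply hp2 | lia].
Qed.

(* A combination of [Q] and of the generator [2/(p-1) Q + x Q'] of the scaling of [Q_c]. *)
Definition Astar (x : R) : R := Q p x / (2 * mm p) + 3 / 2 * (x * dQ p x).
Definition Astar1 (x : R) : R := dQ p x / (2 * mm p) + 3 / 2 * dQ p x + 3 / 2 * (x * ddQ p x).
Definition shiftsrc (x : R) : R := 3 * Q p x - 2 * Q p x ^ p.

Lemma is_derive_Astar x : is_derive Astar x (Astar1 x).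
Proof.
  unfold Astar, Astar1. assert (H1 := is_derive_Q p hp2 x). assert (H2 := is_derive_dQ p hp2 x).
  assert (Hm := mm_pos p hp2).
  auto_derive; [repeat split; eexists; eassumption|].
  rewrite (Derive_eta _ _ _ H1), (Derive_eta _ _ _ H2). fold (dQ p x). field. lra.
Qed.

(** [L Q = - (p - 1) Q^p] and [L (x Q') = - 2 Q'' = - 2 Q + 2 Q^p]; as [2 mm = p - 1], the weights
    in [Astar] combine them into [- 3 Q + 2 Q^p]. *)
Lemma is_derive_Astar1 x : is_derive Astar1 x (V p x * Astar x + shiftsrc x).
Proof.
  unfold Astar, Astar1, shiftsrc. assert (H1 := is_derive_dQ p hp2 x). assert (H2 := is_derive_ddQ p hp2 x).
  assert (Hm := mm_pos p hp2).
  auto_derive; [repeat split; eexists; eassumption|].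
  rewrite (Derive_eta _ _ _ H1), (Derive_eta _ _ _ H2).
  replace (V p x * (Q p x / (2 * mm p) + 3 / 2 * (x * dQ p x)))
    with (V p x * Q p x / (2 * mm p) + 3 / 2 * (x * (V p x * dQ p x))) by (field; lra).
  rewrite V_mult_Q.
  rewrite ddQ_eq, INRp_mm. field. lra.
Qed.

Lemma Loc_Astar : Loc Astar.
Proof.
  unfold Astar. apply (Loc_ext (fun x => / (2 * mm p) * Q p x + 3 / 2 * (x * dQ p x))).
  - intros; unfold Rdiv; ring.
  - apply Loc_plus; apply Loc_scal; [apply Q_Loc, hp2|].
    apply Loc_mult_Tame_r; [apply Tame_id | apply Loc_dQ].
Qed.

(** The coefficient of [INR k * a] in the source of the second equation when [A] contains
    [a * Astar]; the second derivative of [Astar] is replaced through its equation. *)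
Definition Hstar (x : R) : R := 3 * (V p x * Astar x + shiftsrc x) + (1 - V p x) * Astar x - 3 * ddQ p x.

Lemma Loc_QHstar : Loc (fun x => Q p x * Hstar x).
Proof.
  apply Loc_mult_Tame; [apply Q_Loc, hp2|]. unfold Hstar.
  assert (TV := Tame_V p). assert (TAs := Loc_Tame _ Loc_Astar).
  assert (TS : Tame shiftsrc).
  { apply (Tame_ext (fun x => 3 * Q p x + -2 * Q p x ^ p)); [intros; unfold shiftsrc; ring|].
    apply Tame_plus; apply Tame_scal; [|apply Tame_pow]; apply Loc_Tame, Q_Loc, hp2. }
  apply (Tame_ext (fun x => 3 * (V p x * Astar x + shiftsrc x) + (1 - V p x) * Astar x + -3 * ddQ p x));
    [intros; ring|].
  apply Tame_plus; [apply Tame_plus|].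
  - apply Tame_scal, Tame_plus; auto. apply Tame_mult; auto.
  - apply Tame_mult; auto. apply Loc_Tame, Loc_1V.
  - apply Tame_scal, Loc_Tame, Loc_ddQ.
Qed.

Lemma Hstar_integral : exists I, 0 < I /\ tends (prim (fun x => Q p x * Hstar x)) I.
Proof.
  assert (Hm := mm_pos p hp2).
  (* Modulo total derivatives, [y Q' Q = - Q^2/2], [y Q' Q^p = - Q^(p+1)/(p+1)] and
     [Q^2 = (p+3)/(2(p+1)) Q^(p+1)]; collecting them gives [Q Hstar = kappa Q^(p+1) + Psi']. *)
  set (N := fun x => (INR p + 1) / 2 * (1 - T p x ^ 2) * (Q p x * Q p x)).
  set (s2 := 3 / (2 * mm p) - 9/4 - 3).
  set (kappa := (INR p - 3) / (2 * mm p) - 3/2 * ((INR p - 3) / (INR p + 1)) + 3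
                + s2 * ((INR p + 3) / (2 * (INR p + 1)))).
  set (Psi := fun x => 3 * (Q p x * Astar1 x + - 1 * (dQ p x * Astar x)) + 9/4 * (x * (Q p x * Q p x))
     + 3/2 * ((INR p - 3) / (INR p + 1)) * (x * N x) + s2 / 2 * (Q p x * dQ p x)).
  (* The values are 5/8, 3/16 and 7/120 for [p] equal to 2, 3 and 4; the same expression vanishes at
     the critical exponent 5. *)
  assert (Hk : 0 < kappa).
  { unfold kappa, s2, mm. destruct hp as [E|[E|E]]; rewrite E; simpl; lra. }
  assert (LQ := Q_Loc p hp2). assert (TQ := Loc_Tame _ LQ).
  assert (LN : Loc N).
  { apply (Loc_ext (fun x => Q p x ^ S p)); [|apply Loc_pow; auto].
    intros x; unfold N; rewrite <- tech_pow_Rmult, Q_pow by apply hp2; ring. }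
  assert (LA1 : Loc Astar1).
  { rewrite <- (Derive_fun _ _ is_derive_Astar). apply Loc_Derive, Loc_Astar. }
  assert (LPsi : Loc Psi).
  { unfold Psi. assert (H1 := Loc_dQ). assert (H2 := Loc_Astar).
    repeat apply Loc_plus; repeat apply Loc_scal.
    - apply Loc_plus; [|apply Loc_scal]; apply Loc_mult_Tame; auto using Loc_Tame.
    - apply Loc_mult_Tame_r; [apply Tame_id | apply Loc_mult_Tame; auto].
    - apply Loc_mult_Tame_r; [apply Tame_id | auto].
    - apply Loc_mult_Tame; auto using Loc_Tame. }
  assert (DPsi : forall x : R, is_derive Psi x (Q p x * Hstar x - kappa * N x)).
  { intros x. unfold Psi, N. assert (HT := is_derive_T p x). assert (H1 := is_derive_Q p hp2 x). assert (H2 := is_derive_dQ p hp2 x).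
    assert (H3 := is_derive_Astar x). assert (H4 := is_derive_Astar1 x).
    auto_derive; [repeat split; eexists; eassumption|].
    rewrite (Derive_eta _ _ _ HT), (Derive_eta _ _ _ H1), (Derive_eta _ _ _ H2), (Derive_eta _ _ _ H3), (Derive_eta _ _ _ H4).
    unfold Hstar. fold (dQ p x).
    assert (E1 := Q_pow p hp2 x).
    unfold shiftsrc. rewrite E1. unfold kappa, s2, Astar, Astar1, V, dQ, ddQ.
    rewrite INRp_mm. field. split; lra. }
  destruct (Loc_prim_tends N LN) as [IN HIN].
  assert (HNpos : forall x, 0 < N x).
  { intros x. assert (H1 := T_lt p x). assert (H2 := Q_pos p x). assert (H3 := INRp_ge p hp2).
    unfold N. repeat apply Rmult_lt_0_compat; lra. }
  assert (DN : forall x : R, is_derive (prim N) x (N x)) by (intros; apply is_derive_prim, Loc_Cont; auto).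
  exists (kappa * IN). split.
  - apply Rmult_lt_0_compat; auto. apply Rlt_le_trans with (prim N 1).
    + destruct (MVT_gen (prim N) 0 1 N) as [z [_ Hz]]; auto.
      * intros z _. apply derivable_continuous_pt, ex_derive_Reals_0. eexists; apply DN.
      * rewrite prim_0 in Hz. assert (H := HNpos z). lra.
    + apply (tends_const_ge _ _ _ 1 HIN). intros y Hy.
      apply (is_derive_incr (prim N) N 1); auto; [|lra]. intros; left; auto.
  - apply (tends_ext (fun y => kappa * prim N y + Psi y)).
    + intros y. rewrite (prim_unique (fun x => Q p x * Hstar x) (fun y => kappa * prim N y + Psi y)).
      * assert (E0 : dQ p 0 = 0) by (assert (E := dQ_odd p hp2 0); rewrite Ropp_0 in E; simpl in E; lra).
        rewrite prim_0. unfold Psi, Astar1. rewrite E0. unfold Rdiv. ring.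
      * intros x. replace (Q p x * Hstar x) with (kappa * N x + (Q p x * Hstar x - kappa * N x)) by ring.
        apply @is_derive_plus; [apply is_derive_scal; apply DN | apply DPsi].
      * apply Loc_Cont, Loc_QHstar.
    + replace (kappa * IN) with (kappa * IN + 0) by ring. apply tends_plus.
      * apply tends_scal; auto.
      * apply Loc_tends; auto.
Qed.

Lemma sol_plus u v f g a : sol p u f -> sol p v g -> sol p (fun x => u x + a * v x) (fun x => f x + a * g x).
Proof.
  intros [U1 U2] [V1 V2].
  assert (D : forall x : R, is_derive (fun x : R => u x + a * v x) x (Derive u x + a * Derive v x)).
  { intros x. apply @is_derive_plus; [|apply is_derive_scal]; apply Derive_correct; auto. }
  split; [intros x; eexists; apply D|]. rewrite (Derive_fun _ _ D). intros x.
  replace (V p x * (u x + a * v x) - (f x + a * g x)) with ((V p x * u x - f x) + a * (V p x * v x - g x)) by ring.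
  apply @is_derive_plus; [|apply is_derive_scal]; auto.
Qed.

Lemma sol_Astar : sol p Astar (fun x => - shiftsrc x).
Proof.
  split; [intros x; eexists; apply is_derive_Astar|].
  rewrite (Derive_fun _ _ is_derive_Astar). intros x.
  replace (V p x * Astar x - - shiftsrc x) with (V p x * Astar x + shiftsrc x) by ring. apply is_derive_Astar1.
Qed.

Lemma Astar_even : parity false Astar.
Proof. intros x; unfold Astar. rewrite Q_even, dQ_odd by apply hp2. simpl. field. assert (H := mm_pos p hp2); lra. Qed.

(** Here [1 - V] is [p Q^(p-1)]; the factor [INR k] comes from [(R^k)' = k R^k rho]. *)
Definition Hsrc (k : nat) (a : R) (A G : R -> R) (x : R) : R :=
  G x + INR k * (3 * Derive (Derive A) x + (1 - V p x) * A x - 3 * a * ddQ p x).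

(** Both equations are integrated once, and this is the only step that raises the degree, since
    inverting [L] preserves it. For [n = O] the source [F] is odd and localized, so its primitive
    can be taken localized and [A] remains so; the source of the second equation is even, and [B]
    gets no such claim. *)
Lemma solve_level (k n : nat) (F G : R -> R) : (1 <= k)%nat ->
  Pol n F -> parity true F -> Pol n G -> parity false G ->
  exists (a : R) (A B SF SH : R -> R),
    Pol (S n) A /\ parity false A /\ (n = O -> Loc A) /\ Pol (S n) B /\ parity true B /\
    (forall x : R, is_derive SF x (F x)) /\ sol p A (fun x => SF x - a * shiftsrc x) /\
    (forall x : R, is_derive SH x (Hsrc k a A G x)) /\ sol p (fun x => INR k * B x) SH.
Proof.
  intros Hk PF OF PG EG.
  assert (HkR : 0 < INR k) by (apply lt_0_INR; lia).
  assert (SFex : exists SF, Pol (S n) SF /\ (n = O -> Loc SF) /\ parity false SF /\ forall x : R, is_derive SF x (F x)).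
  { destruct n as [|n].
    - destruct (Loc_even_primitive F PF OF) as [SF [H1 [H2 H3]]]. exists SF; split; auto. apply Loc_Pol; auto.
    - exists (prim F). assert (Hc := Tame_Cont _ (Pol_Tame _ _ PF)).
      split; [apply Pol_prim; auto|]. split; [discriminate|].
      split; [apply (prim_parity true F); auto | intros; apply is_derive_prim; auto]. }
  destruct SFex as [SF [PSF [LSF [ESF DSF]]]].
  destruct (sol_exists p hp2 false SF) as [A0 [TA0 [EA0 SA0]]]; auto; [eapply Pol_Tame; eauto | discriminate |].
  assert (PA0 : Pol (S n) A0) by (apply (sol_Pol p hp2 _ _ SF); auto).
  assert (LA0 : n = O -> Loc A0) by (intros Hn; apply (sol_Loc p hp2 _ SF); auto).
  destruct Hstar_integral as [Is [HIs TIs]].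
  set (H0 := Hsrc k 0 A0 G).
  assert (PDD : forall A, Pol (S n) A -> Pol n (Derive (Derive A))).
  { intros A [HA1 HA2]. apply (Pol_mono (pred n)); [lia|]. apply Pol_Derive; auto. }
  assert (PH : forall a A, Pol (S n) A -> Pol n (Hsrc k a A G)).
  { intros a A PA. unfold Hsrc. apply Pol_plus; auto. apply Pol_scal, Pol_minus.
    - apply Pol_plus; [apply Pol_scal; auto|]. apply Loc_Pol, Loc_mult_Tame; [apply Loc_1V | eapply Pol_Tame; eauto].
    - apply Pol_scal, Loc_Pol, Loc_ddQ. }
  assert (LQ := Q_Loc p hp2).
  assert (LQH0 : Loc (fun x => Q p x * H0 x)) by (apply Loc_mult_Tame; auto; eapply Pol_Tame, PH; auto).
  destruct (Loc_prim_tends _ LQH0) as [I0 HI0].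
  (* This value makes the integral of [Q H] over the half-line vanish, that is, [SH] orthogonal to [Q']. *)
  set (a := - I0 / (INR k * Is)).
  set (A := fun x => A0 x + a * Astar x).
  assert (PA : Pol (S n) A) by (apply Pol_plus; auto; apply Pol_scal, Loc_Pol, Loc_Astar).
  assert (SA := sol_plus _ _ _ _ a SA0 sol_Astar). fold A in SA.
  assert (EA : parity false A) by (apply parity_plus; auto; apply parity_scal, Astar_even).
  assert (LA : n = O -> Loc A) by (intros Hn; apply Loc_plus; auto; apply Loc_scal, Loc_Astar).
  set (H := Hsrc k a A G).
  assert (HH : forall x, H x = H0 x + (a * INR k) * Hstar x).
  { intros x. unfold H, H0, Hsrc, Hstar.
    rewrite (is_derive_unique _ _ _ (proj2 SA x)), (is_derive_unique _ _ _ (proj2 SA0 x)).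
    unfold A. ring. }
  assert (PHH : Pol n H) by (apply PH; auto).
  assert (CH := Tame_Cont _ (Pol_Tame _ _ PHH)).
  assert (EH : parity false H).
  { unfold H, Hsrc. assert (TA := Pol_Tame _ _ PA). assert (TA' := Tame_Derive _ TA).
    apply parity_plus; auto. apply parity_scal, parity_minus; [apply parity_plus|].
    - apply parity_scal. apply (parity_Derive true); [intros; apply Tame_ex; auto|].
      apply (parity_Derive false); auto. intros; apply Tame_ex; auto.
    - apply (parity_mult false false); auto. apply parity_minus; [apply parity_const | apply V_even; apply hp2].
    - apply parity_scal, ddQ_even, hp2. }
  set (SH := prim H).
  assert (DSH : forall x : R, is_derive SH x (H x)) by (intros; apply is_derive_prim; auto).
  assert (PSH : Pol (S n) SH) by (apply Pol_prim; auto).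
  assert (TSH := Pol_Tame _ _ PSH).
  assert (OSH : parity true SH) by (apply (prim_parity false); auto).
  assert (LQS : Loc (fun x => Q p x * SH x)) by (apply Loc_mult_Tame; auto).
  assert (LQH : Loc (fun x => Q p x * H x)) by (apply Loc_mult_Tame; auto; eapply Pol_Tame; eauto).
  (* Integration by parts: [dQ * SH] is the derivative of [Q * SH] minus [Q * H], the boundary term
     tends to zero, and [a] was chosen to cancel the rest. *)
  assert (Cond : tends (prim (fun x => dQ p x * SH x)) 0).
  { apply (tends_ext (fun y => Q p y * SH y + -1 * prim (fun x => Q p x * H x) y)).
    - intros y. rewrite (prim_unique (fun x => dQ p x * SH x) (fun y => Q p y * SH y + -1 * prim (fun x => Q p x * H x) y)).
      + unfold SH. rewrite !prim_0. ring.
      + intros x. replace (dQ p x * SH x) with ((dQ p x * SH x + Q p x * H x) + -1 * (Q p x * H x)) by ring.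
        apply @is_derive_plus.
        * apply is_derive_mult_R; auto. apply is_derive_Q, hp2.
        * apply is_derive_scal. apply (is_derive_prim (fun x => Q p x * H x)), Loc_Cont; auto.
      + apply Cont_dQ_mult; [apply hp2|]. apply Tame_Cont; auto.
    - assert (T1 := Loc_tends _ LQS).
      assert (T2 : tends (prim (fun x => Q p x * H x)) (I0 + (a * INR k) * Is)).
      { apply (tends_ext (fun y => prim (fun x => Q p x * H0 x) y + (a * INR k) * prim (fun x => Q p x * Hstar x) y)).
        - intros y. rewrite <- prim_lin.
          + f_equal. apply functional_extensionality; intros x. rewrite HH; ring.
          + apply Loc_Cont; auto.
          + apply Loc_Cont, Loc_QHstar.
        - apply tends_plus; auto. apply tends_scal; auto. }
      assert (T3 := tends_plus _ _ _ _ T1 (tends_scal _ (-1) _ T2)).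
      replace (0 + -1 * (I0 + a * INR k * Is)) with 0 in T3 by (unfold a; field; split; lra).
      apply T3. }
  destruct (sol_exists p hp2 true SH) as [b [Tb [Ob Sb]]]; auto.
  assert (Pb : Pol (S n) b) by (apply (sol_Pol p hp2 _ _ SH); auto).
  exists a, A, (fun x => / INR k * b x), SF, SH.
  repeat (split; [solve [auto | apply Pol_scal; auto | apply parity_scal; auto]|]).
  split.
  { replace (fun x => SF x - a * shiftsrc x) with (fun x => SF x + a * - shiftsrc x); auto.
    apply functional_extensionality; intros; ring. }
  split; auto.
  replace (fun x => INR k * (/ INR k * b x)) with b; auto.
  apply functional_extensionality; intros; field; lra.
Qed.

End Solve.

Notation coefs := (nat -> nat -> R -> R).
Notation fam := (bool -> nat -> nat -> R -> R).

Lemma sum_zero f n : (forall i, (i <= n)%nat -> f i = 0) -> sum_f_R0 f n = 0.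
Proof. induction n; intros H; simpl; [auto|]. rewrite IHn, H by auto. ring. Qed.

Lemma sum_single f n j : (j <= n)%nat -> (forall i, (i <= n)%nat -> i <> j -> f i = 0) -> sum_f_R0 f n = f j.
Proof.
  revert j; induction n; intros j Hj H; simpl; [f_equal; lia|].
  destruct (Nat.eq_dec j (S n)) as [->|Hn].
  - rewrite sum_zero; [ring|]. intros; apply H; lia.
  - rewrite (H (S n)) by lia. rewrite (IHn j); [ring | lia | intros; apply H; lia].
Qed.

Lemma Pol_sum N (f : nat -> R -> R) n : (forall i, (i <= n)%nat -> Pol N (f i)) ->
  Pol N (fun y => sum_f_R0 (fun i => f i y) n).
Proof.
  induction n; intros H; simpl; [apply H; lia|].
  apply Pol_plus; [apply IHn; auto | apply H; lia].
Qed.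

Lemma parity_sum b (f : nat -> R -> R) n : (forall i, (i <= n)%nat -> parity b (f i)) ->
  parity b (fun y => sum_f_R0 (fun i => f i y) n).
Proof.
  induction n; intros H; simpl; [apply H; lia|].
  apply parity_plus; [apply IHn; auto | apply H; lia].
Qed.

Lemma Pol_mult_gen a b n f g : Pol a f -> Pol b g -> (a = O \/ b = O \/ (a + b <= S n)%nat) ->
  Pol n (fun x => f x * g x).
Proof.
  intros F G H. destruct a as [|a]; [apply Loc_Pol, Loc_mult_Tame; auto; eapply Pol_Tame; eauto|].
  destruct b as [|b]; [apply Loc_Pol, Loc_mult_Tame_r; auto; eapply Pol_Tame; eauto|].
  apply (Pol_mono (S (a + b))); [lia|]. apply Pol_mult; auto.
Qed.

(** * Formal expansions *)

Definition conv (a b : coefs) : coefs := fun k l y =>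
  sum_f_R0 (fun i => sum_f_R0 (fun j => a i j y * b (k - i)%nat (l - j)%nat y) l) k.
Definition shc (a : coefs) : coefs := fun k l y =>
  match l with O => 0 | S l' => a k l' y end.
Definition shx (q : nat) (a : coefs) : coefs := fun k l y =>
  if (k <? q)%nat then 0 else a (k - q)%nat l y.
Definition kw (a : coefs) : coefs := fun k l y => INR k * a k l y.

(* [f false k l] and [f true k l] are the coefficients of [c^l R^k] and [c^l R^k rho],
   where [R = Q_c] and [rho = R'/R]; thus [rho^2 = c - 2/(p+1) R^(p-1)], which gives [fmul],
   and [rho' = - (p-1)/(p+1) R^(p-1)], which gives the derivative [fD] with respect to [y_c]. *)
Definition fadd (f g : fam) : fam := fun e k l y => f e k l y + g e k l y.
Definition fsub (f g : fam) : fam := fun e k l y => f e k l y - g e k l y.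
Definition fshc (f : fam) : fam := fun e => shc (f e).
Definition fdy (f : fam) : fam := fun e k l => Derive (f e k l).
Definition bmul (beta : nat -> nat -> R) (f : fam) : fam := fun e => conv (fun k l _ => beta k l) (f e).
Definition fone : fam := fun e k l _ => match e, k, l with false, O, O => 1 | _, _, _ => 0 end.

Section Families.
Context (p : nat) (hp2 : (2 <= p)%nat).

Definition fmul (f g : fam) : fam := fun e k l y =>
  match e with
  | false => conv (f false) (g false) k l y + shc (conv (f true) (g true)) k l y
             - 2 / (INR p + 1) * shx (p - 1) (conv (f true) (g true)) k l y
  | true => conv (f false) (g true) k l y + conv (f true) (g false) k l y
  end.
Fixpoint fpow (f : fam) (n : nat) : fam :=
  match n with O => fone | S m => fmul f (fpow f m) end.
(** The even component comes from [(R^k rho)' = k c R^k - (2 k + p - 1) / (p + 1) R^(k + p - 1)];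
    the prefactor is inside [shx] because it involves [k] before the shift. *)
Definition fD (f : fam) : fam := fun e k l y =>
  match e with
  | false => shc (kw (f true)) k l y
             - shx (p - 1) (fun k l y => (2 * INR k + (INR p - 1)) / (INR p + 1) * f true k l y) k l y
  | true => kw (f false) k l y
  end.
Definition dx (beta : nat -> nat -> R) (f : fam) : fam :=
  fsub (fadd (fdy f) (fD f)) (bmul beta (fdy f)).
Definition dtc (beta : nat -> nat -> R) (f : fam) : fam := fsub (fD f) (bmul beta (fdy f)).

(* Here [d_t v = (1 - c) (dtc v)] and [d_x v = fdy v + dtc v], whence [d_t v - d_x v = - fdy v - c (dtc v)]. *)
Definition Sfam (beta : nat -> nat -> R) (v : fam) : fam :=
  fadd (fsub (dx beta (dx beta (dx beta v))) (fadd (fdy v) (fshc (dtc beta v)))) (dx beta (fpow v p)).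

(* In [deg m w] the index [m] counts factors: [cls 1] is the class of the approximate solution, products
   of [m] such expansions are in [cls m], and a residual in [cls p] can be integrated back into [cls 1]. *)
Definition wt (k l : nat) : nat := ((p - 1) * l + k)%nat.
Definition deg (m w : nat) : nat := ((w + (p - 1) - m) / (p - 1))%nat.
Definition ccls (m : nat) (a : coefs) : Prop := forall k l, Pol (deg m (wt k l)) (a k l).
Definition cls (m : nat) (f : fam) : Prop := forall e, ccls m (f e).

Lemma deg_mono m w w' : (w <= w')%nat -> (deg m w <= deg m w')%nat.
Proof. intros H; apply Nat.Div0.div_le_mono; lia. Qed.

Lemma deg_anti m m' w : (m <= m')%nat -> (deg m' w <= deg m w)%nat.
Proof. intros H; apply Nat.Div0.div_le_mono; lia. Qed.

(** When [m] factors of class 1 share a weight below [m], one of them has weight zero, hence is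
    localized. *)
Lemma deg_zero m w : (m <= p)%nat -> (w < m)%nat -> deg m w = O.
Proof. intros H1 H2; apply Nat.div_small. lia. Qed.

Lemma deg_succ m w : (m <= w)%nat -> deg m w = S ((w - m) / (p - 1)).
Proof.
  intros H. unfold deg. replace (w + (p - 1) - m)%nat with ((w - m) + 1 * (p - 1))%nat by lia.
  rewrite Nat.div_add by lia. lia.
Qed.

(** Below its threshold a factor is localized. Above both thresholds the degrees are the integer
    parts of [(w - m) / (p - 1)], which are superadditive; the successor is there because
    [Pol (S n)] means degree [n]. *)
Lemma deg_mult m1 m2 w1 w2 : (m1 + m2 <= p)%nat ->
  deg m1 w1 = O \/ deg m2 w2 = O \/ (deg m1 w1 + deg m2 w2 <= S (deg (m1 + m2) (w1 + w2)))%nat.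
Proof.
  intros H.
  destruct (Nat.le_gt_cases m1 w1) as [H1|H1]; [|left; apply deg_zero; lia].
  destruct (Nat.le_gt_cases m2 w2) as [H2|H2]; [|right; left; apply deg_zero; lia].
  right; right. rewrite !deg_succ by lia.
  assert (((w1 - m1) / (p - 1) + (w2 - m2) / (p - 1) <= (w1 + w2 - (m1 + m2)) / (p - 1))%nat); [|lia].
  apply Nat.div_le_lower_bound; [lia|].
  assert (K1 := Nat.Div0.mul_div_le (w1 - m1) (p - 1)).
  assert (K2 := Nat.Div0.mul_div_le (w2 - m2) (p - 1)). lia.
Qed.

Lemma deg_shift w : deg 1 w = deg p (w + (p - 1)).
Proof. unfold deg. f_equal. lia. Qed.

Lemma deg_pred w : (pred (deg 1 w) <= deg p w)%nat.
Proof.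
  destruct w as [|w].
  - rewrite (deg_zero 1 0) by lia. lia.
  - rewrite deg_succ by lia. simpl pred. unfold deg. apply Nat.Div0.div_le_mono. lia.
Qed.

Lemma deg_S w : (1 <= w)%nat -> deg 1 w = S (deg p w).
Proof. intros H. rewrite deg_succ by lia. unfold deg. f_equal. f_equal. lia. Qed.

Lemma ccls_conv m1 m2 a b : (m1 + m2 <= p)%nat -> ccls m1 a -> ccls m2 b -> ccls (m1 + m2) (conv a b).
Proof.
  intros H Ha Hb k l. apply Pol_sum; intros i Hi. apply Pol_sum; intros j Hj.
  eapply Pol_mult_gen; [apply Ha | apply Hb |].
  replace (wt k l) with (wt i j + wt (k - i) (l - j))%nat by (unfold wt; nia).
  apply deg_mult; auto.
Qed.

Lemma ccls_shc m a : ccls m a -> ccls m (shc a).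
Proof.
  intros H k [|l]; simpl; [apply Pol_zero|]. eapply Pol_mono; [|apply H].
  apply deg_mono; unfold wt; nia.
Qed.

(** A factor [c] adds [p - 1] to the weight, which is exactly the shift between [deg 1] and [deg p];
    the same holds for a factor [R^(p-1)]. *)
Lemma ccls_shc' a : ccls 1 a -> ccls p (shc a).
Proof.
  intros H k [|l]; simpl; [apply Pol_zero|].
  replace (deg p (wt k (S l))) with (deg 1 (wt k l)); [apply H|].
  rewrite deg_shift; f_equal; unfold wt; nia.
Qed.

Lemma ccls_shx m q a : ccls m a -> ccls m (shx q a).
Proof.
  intros H k l; unfold shx. destruct (Nat.ltb_spec k q); [apply Pol_zero|].
  eapply Pol_mono; [|apply H]. apply deg_mono; unfold wt; nia.
Qed.

Lemma ccls_shx' a : ccls 1 a -> ccls p (shx (p - 1) a).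
Proof.
  intros H k l; unfold shx. destruct (Nat.ltb_spec k (p - 1)); [apply Pol_zero|].
  replace (deg p (wt k l)) with (deg 1 (wt (k - (p - 1)) l)); [apply H|].
  rewrite deg_shift; f_equal; unfold wt; nia.
Qed.

Lemma ccls_scal m a (s : nat -> R) : ccls m a -> ccls m (fun k l y => s k * a k l y).
Proof. intros H k l; apply Pol_scal, H. Qed.
Lemma ccls_plus m a b : ccls m a -> ccls m b -> ccls m (fun k l y => a k l y + b k l y).
Proof. intros H H' k l; apply Pol_plus; auto. Qed.
Lemma ccls_minus m a b : ccls m a -> ccls m b -> ccls m (fun k l y => a k l y - b k l y).
Proof. intros H H' k l; apply Pol_minus; auto. Qed.

Lemma cls_fadd m f g : cls m f -> cls m g -> cls m (fadd f g).
Proof. intros F G e; apply ccls_plus; auto. Qed.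
Lemma cls_fsub m f g : cls m f -> cls m g -> cls m (fsub f g).
Proof. intros F G e; apply ccls_minus; auto. Qed.

Lemma cls_fmul m1 m2 f g : (m1 + m2 <= p)%nat -> cls m1 f -> cls m2 g -> cls (m1 + m2) (fmul f g).
Proof.
  intros H F G e. assert (K : forall e1 e2, ccls (m1 + m2) (conv (f e1) (g e2))) by (intros; apply ccls_conv; auto).
  destruct e; unfold fmul; cbv beta iota.
  - apply ccls_plus; auto.
  - apply ccls_minus; [apply ccls_plus; [auto | apply ccls_shc; auto]|].
    apply (ccls_scal _ _ (fun _ => _)), ccls_shx; auto.
Qed.

Lemma cls_fone : cls 0 fone.
Proof.
  intros e k l. destruct e, k, l; simpl; try apply Pol_zero.
  rewrite deg_succ by lia. apply Pol_const.
Qed.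

Lemma cls_fpow f n : (n <= p)%nat -> cls 1 f -> cls n (fpow f n).
Proof.
  intros Hn F; induction n; simpl; [apply cls_fone|].
  apply (cls_fmul 1 n); auto. apply IHn; lia.
Qed.

Lemma cls_fdy m f : cls m f -> cls m (fdy f).
Proof. intros F e k l. eapply Pol_mono; [|apply Pol_Derive, F]. lia. Qed.

Lemma cls_fdy' f : cls 1 f -> cls p (fdy f).
Proof. intros F e k l. eapply Pol_mono; [|apply Pol_Derive, F]. apply deg_pred. Qed.

Lemma cls_bmul m beta f : (m <= p)%nat -> cls m f -> cls m (bmul beta f).
Proof.
  intros Hm F e k l. apply Pol_sum; intros i Hi. apply Pol_sum; intros j Hj.
  apply Pol_scal. eapply Pol_mono; [|apply F]. apply deg_mono. unfold wt; nia.
Qed.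

Lemma cls_fD m f : cls m f -> cls m (fD f).
Proof.
  intros F [|]; unfold fD; cbv beta iota; [apply (ccls_scal _ _ INR); auto|].
  apply ccls_minus; [apply ccls_shc, (ccls_scal _ _ INR); auto|].
  apply ccls_shx, (ccls_scal _ _ (fun k => (2 * INR k + (INR p - 1)) / (INR p + 1))); auto.
Qed.

(** Two derivatives in [y_c] bring out [rho^2] or [rho'], hence a factor [c] or [R^(p-1)]; a single
    one can turn [R^k] into [k R^k rho] without any gain. *)
Lemma cls_fD2 f : cls 1 f -> cls p (fD (fD f)).
Proof.
  intros F. assert (K : forall e, cls 1 (fun _ => f e)) by (intros e e'; apply F).
  assert (K1 := cls_fD _ _ F true).
  intros [|]; unfold fD at 1; cbv beta iota.
  - apply (ccls_scal _ _ INR). unfold fD. apply ccls_minus.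
    + apply ccls_shc', (ccls_scal _ _ INR), F.
    + apply ccls_shx', (ccls_scal _ _ (fun k => (2 * INR k + (INR p - 1)) / (INR p + 1))), F.
  - apply ccls_minus.
    + apply ccls_shc', (ccls_scal _ _ INR), K1.
    + apply ccls_shx', (ccls_scal _ _ (fun k => (2 * INR k + (INR p - 1)) / (INR p + 1))), K1.
Qed.

Lemma fD_fsub f g : fD (fsub f g) = fsub (fD f) (fD g).
Proof.
  do 4 (apply functional_extensionality; intros ?). unfold fD, fsub, kw, shc, shx.
  destruct x; [ring|]. destruct x1; destruct (_ <? _)%nat; ring.
Qed.

Lemma fD_fadd f g : fD (fadd f g) = fadd (fD f) (fD g).
Proof.
  do 4 (apply functional_extensionality; intros ?). unfold fD, fadd, kw, shc, shx.
  destruct x; [ring|]. destruct x1; destruct (_ <? _)%nat; ring.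
Qed.

Lemma cls_dx m beta f : (m <= p)%nat -> cls m f -> cls m (dx beta f).
Proof.
  intros Hm F. apply cls_fsub; [apply cls_fadd; [apply cls_fdy | apply cls_fD] | apply cls_bmul, cls_fdy]; auto.
Qed.

Lemma cls_dx2 beta f : cls 1 f -> cls p (dx beta (dx beta f)).
Proof.
  intros F. assert (F1 := cls_dx 1 beta f ltac:(lia) F). assert (F2 := cls_fdy' _ F1).
  unfold dx at 1. apply cls_fsub; [apply cls_fadd; auto | apply cls_bmul; auto].
  unfold dx. rewrite fD_fsub, fD_fadd. assert (F3 := cls_fdy' _ F).
  apply cls_fsub; [apply cls_fadd; [apply cls_fD; auto | apply cls_fD2; auto] | apply cls_fD, cls_bmul; auto].
Qed.

(** A lone [dtc v] would only be in class 1. The linear transport terms contain it twice with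
    opposite signs, up to a factor [c], which gains the missing degree. *)
Lemma cls_Sfam beta v : cls 1 v -> cls p (Sfam beta v).
Proof.
  intros F. unfold Sfam. apply cls_fadd; [apply cls_fsub|].
  - apply cls_dx, cls_dx2; auto.
  - apply cls_fadd; [apply cls_fdy'; auto|]. intros e. apply ccls_shc'.
    apply cls_fsub; [apply cls_fD; auto | apply cls_bmul, cls_fdy; auto; lia].
  - apply cls_dx; auto. apply cls_fpow; auto.
Qed.

Lemma cls_ex m f : cls m f -> forall e k l x, ex_derive (f e k l) x.
Proof. intros F e k l x. eapply Tame_ex, Pol_Tame, F. Qed.

(** Since [rho] is odd, this is the parity of the whole expansion under the joint reflection of [y]
    and [y_c]. The approximate solution is even and its residual odd, which makes [A] even and [B]
    odd. *)
Definition par (s : bool) (f : fam) : Prop := forall e k l, parity (xorb s e) (f e k l).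

Lemma parity_conv b1 b2 a b : (forall k l, parity b1 (a k l)) -> (forall k l, parity b2 (b k l)) ->
  forall k l, parity (xorb b1 b2) (conv a b k l).
Proof. intros A B k l. apply parity_sum; intros. apply parity_sum; intros. apply parity_mult; auto. Qed.

Lemma parity_shc b a : (forall k l, parity b (a k l)) -> forall k l, parity b (shc a k l).
Proof. intros A k [|l]; [exact (parity_zero b) | exact (A k l)]. Qed.

Lemma parity_shx b q a : (forall k l, parity b (a k l)) -> forall k l, parity b (shx q a k l).
Proof. intros A k l; unfold shx; destruct (_ <? _)%nat; [exact (parity_zero b) | exact (A _ _)]. Qed.

Lemma par_fadd s f g : par s f -> par s g -> par s (fadd f g).
Proof. intros F G e k l; apply parity_plus; auto. Qed.
Lemma par_fsub s f g : par s f -> par s g -> par s (fsub f g).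
Proof. intros F G e k l; apply parity_minus; auto. Qed.

Lemma par_fmul s s' f g : par s f -> par s' g -> par (xorb s s') (fmul f g).
Proof.
  intros F G e.
  assert (K : forall e1 e2 k l, parity (xorb (xorb s e1) (xorb s' e2)) (conv (f e1) (g e2) k l))
    by (intros; apply parity_conv; auto).
  assert (Ktt := K true true). assert (Kff := K false false).
  assert (Ktf := K true false). assert (Kft := K false true).
  replace (xorb (xorb s true) (xorb s' true)) with (xorb s s') in Ktt by (destruct s, s'; auto).
  replace (xorb (xorb s false) (xorb s' false)) with (xorb s s') in Kff by (destruct s, s'; auto).
  replace (xorb (xorb s true) (xorb s' false)) with (xorb (xorb s s') true) in Ktf by (destruct s, s'; auto).
  replace (xorb (xorb s false) (xorb s' true)) with (xorb (xorb s s') true) in Kft by (destruct s, s'; auto).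
  intros k l. destruct e; unfold fmul; cbv beta iota.
  - apply parity_plus; auto.
  - rewrite xorb_false_r. apply parity_minus; [apply parity_plus; auto; apply parity_shc; auto|].
    apply parity_scal, parity_shx; auto.
Qed.

Lemma par_fone : par false fone.
Proof.
  intros [|] [|k] [|l]; first [exact (parity_zero _) | exact (parity_const 1)].
Qed.

Lemma par_fpow f n : par false f -> par false (fpow f n).
Proof. intros F; induction n; simpl; [apply par_fone|]. apply (par_fmul false false); auto. Qed.

Lemma par_fdy s f : (forall e k l x, ex_derive (f e k l) x) -> par s f -> par (negb s) (fdy f).
Proof.
  intros D F e k l. replace (xorb (negb s) e) with (negb (xorb s e)) by (destruct s, e; auto).
  apply parity_Derive; auto.
Qed.

Lemma par_bmul s beta f : par s f -> par s (bmul beta f).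
Proof.
  intros F e k l. apply (parity_conv false (xorb s e)); auto. intros; apply parity_const.
Qed.

Lemma par_fD s f : par s f -> par (negb s) (fD f).
Proof.
  intros F e k l. assert (Ft := F true). assert (Ff := F false).
  rewrite xorb_true_r in Ft. rewrite xorb_false_r in Ff.
  destruct e; unfold fD; cbv beta iota; rewrite ?xorb_true_r, ?negb_involutive, ?xorb_false_r.
  - apply parity_scal; auto.
  - apply parity_minus; [apply parity_shc | apply parity_shx]; intros; apply parity_scal; auto.
Qed.

Lemma par_dtc s beta f : (forall e k l x, ex_derive (f e k l) x) -> par s f -> par (negb s) (dtc beta f).
Proof. intros D F. apply par_fsub; [apply par_fD | apply par_bmul, par_fdy]; auto. Qed.

Lemma par_dx s beta f : (forall e k l x, ex_derive (f e k l) x) -> par s f -> par (negb s) (dx beta f).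
Proof.
  intros D F. apply par_fsub; [apply par_fadd; [apply par_fdy | apply par_fD] | apply par_bmul, par_fdy]; auto.
Qed.

Lemma par_Sfam beta v : cls 1 v -> par false v -> par true (Sfam beta v).
Proof.
  intros C F. unfold Sfam.
  assert (C1 := cls_dx 1 beta v ltac:(lia) C). assert (C2 := cls_dx 1 beta _ ltac:(lia) C1).
  assert (D := cls_ex _ _ C). assert (D1 := cls_ex _ _ C1). assert (D2 := cls_ex _ _ C2).
  apply par_fadd; [apply par_fsub|].
  - apply (par_dx false), (par_dx true), (par_dx false); auto.
  - apply par_fadd; [apply (par_fdy false); auto|].
    intros e. apply parity_shc. apply (par_dtc false); auto.
  - apply (par_dx false); [|apply par_fpow; auto].
    eapply cls_ex, cls_fpow; auto.
Qed.

(** All operations on expansions are causal: agreement on the box below [(k, l)] is preserved. Both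
    the recursion and the truncation rest on this. *)
Definition eqbox {A : Type} (k l : nat) (f g : nat -> nat -> A) : Prop :=
  forall i j, (i <= k)%nat -> (j <= l)%nat -> f i j = g i j.
Definition feqbox (k l : nat) (f g : fam) : Prop := forall e, eqbox k l (f e) (g e).

Lemma eqbox_conv k l (a a' b b' : coefs) : eqbox k l a a' -> eqbox k l b b' -> eqbox k l (conv a b) (conv a' b').
Proof.
  intros A B i j Hi Hj. apply functional_extensionality; intros y. unfold conv.
  apply sum_eq; intros i' Hi'. apply sum_eq; intros j' Hj'. rewrite A, B by lia. auto.
Qed.

Lemma eqbox_shc k l a a' : eqbox k l a a' -> eqbox k l (shc a) (shc a').
Proof.
  intros A i j Hi Hj. apply functional_extensionality; intros y. unfold shc. destruct j; auto. rewrite A by lia; auto.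
Qed.

Lemma eqbox_shx k l q a a' : eqbox k l a a' -> eqbox k l (shx q a) (shx q a').
Proof.
  intros A i j Hi Hj. apply functional_extensionality; intros y. unfold shx. destruct (_ <? _)%nat; auto.
  rewrite A by lia; auto.
Qed.

Lemma eqbox_scal k l (s : nat -> R) (a a' : coefs) : eqbox k l a a' ->
  eqbox k l (fun k l y => s k * a k l y) (fun k l y => s k * a' k l y).
Proof. intros A i j Hi Hj. rewrite A by lia. auto. Qed.

Lemma feqbox_fmul k l f f' g g' : feqbox k l f f' -> feqbox k l g g' -> feqbox k l (fmul f g) (fmul f' g').
Proof.
  intros F G e i j Hi Hj. apply functional_extensionality; intros y.
  assert (K : forall e1 e2, eqbox k l (conv (f e1) (g e2)) (conv (f' e1) (g' e2))) by (intros; apply eqbox_conv; auto).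
  destruct e; unfold fmul.
  - rewrite (K false true), (K true false); auto.
  - rewrite (K false false), (eqbox_shc _ _ _ _ (K true true)), (eqbox_shx _ _ _ _ _ (K true true)); auto.
Qed.

Lemma feqbox_fpow k l f f' n : feqbox k l f f' -> feqbox k l (fpow f n) (fpow f' n).
Proof. intros F; induction n; simpl; [intros e i j _ _; auto | apply feqbox_fmul; auto]. Qed.

Lemma feqbox_fdy k l f f' : feqbox k l f f' -> feqbox k l (fdy f) (fdy f').
Proof. intros F e i j Hi Hj. unfold fdy. rewrite (F e i j); auto. Qed.

Lemma feqbox_fadd k l f f' g g' : feqbox k l f f' -> feqbox k l g g' -> feqbox k l (fadd f g) (fadd f' g').
Proof. intros F G e i j Hi Hj. unfold fadd. rewrite (F e i j), (G e i j); auto. Qed.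
Lemma feqbox_fsub k l f f' g g' : feqbox k l f f' -> feqbox k l g g' -> feqbox k l (fsub f g) (fsub f' g').
Proof. intros F G e i j Hi Hj. unfold fsub. rewrite (F e i j), (G e i j); auto. Qed.

Lemma feqbox_bmul k l (b b' : nat -> nat -> R) f f' : eqbox k l b b' -> feqbox k l f f' ->
  feqbox k l (bmul b f) (bmul b' f').
Proof.
  intros B F e. apply eqbox_conv; auto. intros i j Hi Hj. rewrite B; auto.
Qed.

Lemma feqbox_fD k l f f' : feqbox k l f f' -> feqbox k l (fD f) (fD f').
Proof.
  intros F e i j Hi Hj. apply functional_extensionality; intros y. destruct e; unfold fD, kw.
  - rewrite (F false); auto.
  - f_equal.
    + rewrite (eqbox_shc k l _ _ (eqbox_scal k l INR _ _ (F true))); auto.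
    + rewrite (eqbox_shx k l _ _ _ (eqbox_scal k l (fun k => (2 * INR k + (INR p - 1)) / (INR p + 1)) _ _ (F true))); auto.
Qed.

Lemma feqbox_dx k l b b' f f' : eqbox k l b b' -> feqbox k l f f' -> feqbox k l (dx b f) (dx b' f').
Proof.
  intros B F. apply feqbox_fsub; [apply feqbox_fadd; [apply feqbox_fdy | apply feqbox_fD] | apply feqbox_bmul, feqbox_fdy]; auto.
Qed.

Lemma feqbox_Sfam k l b b' f f' : eqbox k l b b' -> feqbox k l f f' -> feqbox k l (Sfam b f) (Sfam b' f').
Proof.
  intros B F. unfold Sfam. apply feqbox_fadd; [apply feqbox_fsub|].
  - repeat apply feqbox_dx; auto.
  - apply feqbox_fadd; [apply feqbox_fdy; auto|]. intros e. apply eqbox_shc.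
    apply feqbox_fsub; [apply feqbox_fD | apply feqbox_bmul, feqbox_fdy]; auto.
  - apply feqbox_dx, feqbox_fpow; auto.
Qed.

End Families.

(** * Variation of a single coefficient *)

Lemma sum2_single (g : nat -> nat -> R) k l i0 j0 : (i0 <= k)%nat -> (j0 <= l)%nat ->
  (forall i j, (i <= k)%nat -> (j <= l)%nat -> (i, j) <> (i0, j0) -> g i j = 0) ->
  sum_f_R0 (fun i => sum_f_R0 (fun j => g i j) l) k = g i0 j0.
Proof.
  intros Hi Hj H. rewrite (sum_single _ k i0); auto.
  - apply sum_single; auto. intros j Hj' Hn. apply H; auto. congruence.
  - intros i Hi' Hn. apply sum_zero. intros j Hj'. apply H; auto. congruence.
Qed.

Lemma sum2_plus (g h : nat -> nat -> R) k l :
  sum_f_R0 (fun i => sum_f_R0 (fun j => g i j + h i j) l) k =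
  sum_f_R0 (fun i => sum_f_R0 (fun j => g i j) l) k + sum_f_R0 (fun i => sum_f_R0 (fun j => h i j) l) k.
Proof. rewrite <- plus_sum. apply sum_eq; intros; apply plus_sum. Qed.

(** In the box below [(k, l)] only the corner moves. For [k >= 1] a product of two increments falls
    outside the box, so the residual at the corner responds in an affine way. *)
Definition pertc (k l : nat) (a a' : coefs) (xi : R -> R) : Prop :=
  (forall i j, (i <= k)%nat -> (j <= l)%nat -> (i, j) <> (k, l) -> a' i j = a i j) /\
  (forall y, a' k l y = a k l y + xi y).
Definition pert (k l : nat) (f f' : fam) (xi : bool -> R -> R) : Prop := forall e, pertc k l (f e) (f' e) (xi e).

(** The part without [R] is a function of [y] alone, free of [c]. The linearization at the corner
    pairs an increment with this row, hence its coefficients depend on [Q] only. *)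
Definition row0 (f : fam) (phi : R -> R) : Prop := forall l y,
  f false O l y = match l with O => phi y | _ => 0 end /\ f true O l y = 0.

Section Row.
Context (p : nat) (hp2 : (2 <= p)%nat).

Lemma row0_fmul f g phi psi : row0 f phi -> row0 g psi -> row0 (fmul p f g) (fun y => phi y * psi y).
Proof.
  intros RF RG l' y.
  assert (KT : forall a b, (forall l y, a O l y = 0) \/ (forall l y, b O l y = 0) -> forall l y, conv a b O l y = 0).
  { intros a b H m z. unfold conv. simpl. apply sum_zero. intros i Hi. rewrite ?Nat.sub_0_r.
    destruct H as [H|H]; rewrite H; ring. }
  assert (FT := fun l y => proj2 (RF l y)). assert (GT := fun l y => proj2 (RG l y)).
  unfold fmul. split.
  - assert (E : shx (p - 1) (conv (f true) (g true)) O l' y = 0).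
    { unfold shx. destruct (Nat.ltb_spec 0 (p - 1)); auto; lia. }
    assert (E' : shc (conv (f true) (g true)) O l' y = 0) by (unfold shc; destruct l'; auto; apply KT; auto).
    rewrite E, E'. unfold conv. simpl. rewrite (sum_single _ _ O); [|lia|].
    + destruct (RF O y) as [-> _]. rewrite Nat.sub_0_r. destruct (RG l' y) as [-> _]. destruct l'; ring.
    + intros i Hi Hn. destruct (RF i y) as [-> _]. destruct i; [lia | ring].
  - rewrite !KT; auto. ring.
Qed.

Lemma row0_fone : row0 fone (fun _ => 1).
Proof. intros [|m] y; simpl; auto. Qed.

Lemma row0_fpow f phi n : row0 f phi -> row0 (fpow p f n) (fun y => phi y ^ n).
Proof. intros F; induction n; simpl; [apply row0_fone | apply row0_fmul; auto]. Qed.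

Lemma row0_plus f g phi psi : row0 f phi -> row0 g psi -> row0 (fadd f g) (fun y => phi y + psi y).
Proof.
  intros F G m y. destruct (F m y) as [F1 F2], (G m y) as [G1 G2]. unfold fadd. rewrite F1, F2, G1, G2.
  destruct m; split; ring.
Qed.

Lemma row0_minus f g phi psi : row0 f phi -> row0 g psi -> row0 (fsub f g) (fun y => phi y - psi y).
Proof.
  intros F G m y. destruct (F m y) as [F1 F2], (G m y) as [G1 G2]. unfold fsub. rewrite F1, F2, G1, G2.
  destruct m; split; ring.
Qed.

Lemma row0_fdy f phi dphi : (forall y : R, is_derive phi y (dphi y)) -> row0 f phi -> row0 (fdy f) dphi.
Proof.
  intros D F m y. unfold fdy. split.
  - destruct m.
    + rewrite (Derive_ext _ phi); [apply is_derive_unique, D | intros; apply (F O)].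
    + rewrite (Derive_ext _ (fun _ => 0)); [apply Derive_const | intros; apply (F (S m))].
  - rewrite (Derive_ext _ (fun _ => 0)); [apply Derive_const | intros; apply (F m)].
Qed.

Lemma row0_fD f phi : row0 f phi -> row0 (fD p f) (fun _ => 0).
Proof.
  intros F m y. unfold fD, kw, shc, shx. destruct (Nat.ltb_spec 0 (p - 1)); [|lia].
  simpl INR. destruct m; split; ring.
Qed.

Lemma row0_bmul beta f phi : (forall j, beta O j = 0) -> row0 f phi -> row0 (bmul beta f) (fun _ => 0).
Proof.
  intros B F m y. unfold bmul, conv. simpl.
  split; [replace (match m with O => 0 | S _ => 0 end) with 0 by (destruct m; auto)|];
  (apply sum_zero; intros; rewrite B; ring).
Qed.

Lemma row0_dx beta f phi dphi : (forall j, beta O j = 0) -> (forall y : R, is_derive phi y (dphi y)) ->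
  row0 f phi -> row0 (dx p beta f) dphi.
Proof.
  intros B D F. assert (FD := row0_fdy _ _ _ D F).
  assert (K := row0_minus _ _ _ _ (row0_plus _ _ _ _ FD (row0_fD _ _ F)) (row0_bmul _ _ _ B FD)).
  intros m y. destruct (K m y) as [K1 K2]. unfold dx. rewrite K1, K2. destruct m; split; ring.
Qed.

End Row.

Section Perturbation.
Context (p : nat) (hp2 : (2 <= p)%nat).
Context (k l : nat) (Hk : (1 <= k)%nat).


Lemma pertc_ext a a' xi xi' : (forall y, xi y = xi' y) -> pertc k l a a' xi -> pertc k l a a' xi'.
Proof. intros H [A1 A2]; split; auto. intros; rewrite A2, H; auto. Qed.

Lemma pertc_plus a a' b b' xi eta : pertc k l a a' xi -> pertc k l b b' eta ->
  pertc k l (fun k l y => a k l y + b k l y) (fun k l y => a' k l y + b' k l y) (fun y => xi y + eta y).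
Proof. intros [A1 A2] [B1 B2]; split; intros; [rewrite A1, B1 | rewrite A2, B2; ring]; auto. Qed.

Lemma pertc_scal a a' xi (s : nat -> R) : pertc k l a a' xi ->
  pertc k l (fun k l y => s k * a k l y) (fun k l y => s k * a' k l y) (fun y => s k * xi y).
Proof. intros [A1 A2]; split; intros; [rewrite A1 | rewrite A2; ring]; auto. Qed.

Lemma pertc_conv a a' b b' xi eta : pertc k l a a' xi -> pertc k l b b' eta ->
  pertc k l (conv a b) (conv a' b') (fun y => xi y * b O O y + a O O y * eta y).
Proof.
  intros [A1 A2] [B1 B2]; split.
  - intros i j Hi Hj Hn. apply functional_extensionality; intros y. unfold conv.
    apply sum_eq; intros i' Hi'. apply sum_eq; intros j' Hj'.
    rewrite A1, B1; auto; try lia; intros E; apply Hn; injection E; intros; f_equal; lia.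
  - intros y. unfold conv.
    (* The convolution changes at two pairs only, corner with origin and origin with corner; they
       are distinct because [k >= 1]. *)
    set (da := fun i j => if ((i =? k) && (j =? l))%bool then xi y * b O O y else 0).
    set (db := fun i j => if ((i =? 0) && (j =? 0))%bool then a O O y * eta y else 0).
    transitivity (sum_f_R0 (fun i => sum_f_R0 (fun j =>
       a i j y * b (k - i)%nat (l - j)%nat y + (da i j + db i j)) l) k).
    + apply sum_eq; intros i Hi. apply sum_eq; intros j Hj. unfold da, db.
      destruct (Nat.eqb_spec i k) as [Ei|Ei], (Nat.eqb_spec j l) as [Ej|Ej],
        (Nat.eqb_spec i 0) as [Ei0|Ei0], (Nat.eqb_spec j 0) as [Ej0|Ej0]; simpl; subst; try lia;
      rewrite ?Nat.sub_diag, ?Nat.sub_0_r, ?A2, ?B2;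
      rewrite ?A1, ?B1; auto; try lia; try (intros E; injection E; intros; lia); try ring.
    + rewrite !sum2_plus. f_equal.
      rewrite (sum2_single da k l k l), (sum2_single db k l 0 0); auto; try lia; unfold da, db.
      * rewrite !Nat.eqb_refl. reflexivity.
      * intros i j Hi Hj Hn. destruct (Nat.eqb_spec i 0), (Nat.eqb_spec j 0); simpl; auto. subst; congruence.
      * intros i j Hi Hj Hn. destruct (Nat.eqb_spec i k), (Nat.eqb_spec j l); simpl; auto. subst; congruence.
Qed.

(** The shift moves the modified corner out of the box, so a factor [c] hides the new unknowns from
    the equation of index [(k, l)]. *)
Lemma pertc_shc a a' xi : pertc k l a a' xi -> pertc k l (shc a) (shc a') (fun _ => 0).
Proof.
  intros [A1 A2]; split.
  - intros i j Hi Hj Hn. unfold shc. destruct j; auto. rewrite A1; auto; try lia. intros E; injection E; lia.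
  - intros y. unfold shc. destruct l; [ring|]. rewrite A1; auto; try lia; [ring|]. intros E; injection E; lia.
Qed.

Lemma pertc_shx a a' xi : pertc k l a a' xi -> pertc k l (shx (p - 1) a) (shx (p - 1) a') (fun _ => 0).
Proof.
  intros [A1 A2]; split.
  - intros i j Hi Hj Hn. unfold shx. destruct (Nat.ltb_spec i (p - 1)); auto.
    rewrite A1; auto; try lia. intros E; injection E; lia.
  - intros y. unfold shx. destruct (Nat.ltb_spec k (p - 1)); [ring|].
    rewrite A1; auto; try lia; [ring|]. intros E; injection E; lia.
Qed.

Lemma pert_fmul f f' g g' xi eta phi psi : row0 f phi -> row0 g psi -> pert k l f f' xi -> pert k l g g' eta ->
  pert k l (fmul p f g) (fmul p f' g') (fun e y => xi e y * psi y + phi y * eta e y).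
Proof.
  intros RF RG F G.
  assert (K := fun e1 e2 => pertc_conv _ _ _ _ _ _ (F e1) (G e2)).
  assert (F0 := fun y => RF O y). assert (G0 := fun y => RG O y).
  intros [|]; unfold fmul.
  - eapply pertc_ext; [|apply pertc_plus; [apply (K false true) | apply (K true false)]].
    intros y; cbv beta. destruct (F0 y) as [-> ->], (G0 y) as [-> ->]. ring.
  - apply (pertc_ext _ _ (fun y => (xi false y * psi y + phi y * eta false y + 0) + (- (2 / (INR p + 1))) * 0)).
    { intros; ring. }
    assert (KS := pertc_shx _ _ _ (K true true)).
    apply (pertc_scal _ _ _ (fun _ => - (2 / (INR p + 1)))) in KS.
    assert (KC := pertc_shc _ _ _ (K true true)).
    assert (K0 := pertc_plus _ _ _ _ _ _ (pertc_plus _ _ _ _ _ _ (K false false) KC) KS).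
    destruct K0 as [K1 K2]. split.
    + intros i j Hi Hj Hn. specialize (K1 i j Hi Hj Hn). apply functional_extensionality; intros y.
      assert (K3 := f_equal (fun h => h y) K1). cbv beta in K3. lra.
    + intros y. specialize (K2 y). cbv beta in K2. destruct (F0 y) as [E1 E2], (G0 y) as [E3 E4].
      rewrite E1, E3 in K2. lra.
Qed.

Lemma pert_fpow f f' xi phi n : row0 f phi -> pert k l f f' xi ->
  pert k l (fpow p f n) (fpow p f' n) (fun e y => INR n * phi y ^ (pred n) * xi e y).
Proof.
  intros R0 F; induction n as [|n IH].
  - intros e. split; auto. intros y. simpl fpow. rewrite Rmult_0_l, Rmult_0_l. ring.
  - assert (K := pert_fmul _ _ _ _ _ _ _ _ R0 (row0_fpow p hp2 _ _ n R0) F IH).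
    intros e. eapply pertc_ext; [|apply K]. intros y; cbv beta. rewrite S_INR. destruct n; simpl; ring.
Qed.

Lemma pert_fdy f f' xi dxi : (forall e (y : R), is_derive (xi e) y (dxi e y)) -> (forall e y, ex_derive (f e k l) y) ->
  pert k l f f' xi -> pert k l (fdy f) (fdy f') dxi.
Proof.
  intros D DF F e. destruct (F e) as [F1 F2]; split.
  - intros i j Hi Hj Hn. unfold fdy. rewrite F1; auto.
  - intros y. unfold fdy. apply is_derive_unique.
    apply (is_derive_ext (fun y => f e k l y + xi e y)); [intros; rewrite F2; auto|].
    apply @is_derive_plus; [apply Derive_correct; auto | auto].
Qed.

Lemma pert_fD f f' xi : pert k l f f' xi ->
  pert k l (fD p f) (fD p f') (fun e y => match e with false => 0 | true => INR k * xi false y end).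
Proof.
  intros F [|]; unfold fD.
  - apply (pertc_scal _ _ _ INR), F.
  - assert (K1 := pertc_shc _ _ _ (pertc_scal _ _ _ INR (F true))).
    assert (K2 := pertc_shx _ _ _ (pertc_scal _ _ _ (fun k => (2 * INR k + (INR p - 1)) / (INR p + 1)) (F true))).
    destruct (pertc_plus _ _ _ _ _ _ K1 (pertc_scal _ _ _ (fun _ => -1) K2)) as [K3 K4]. split.
    + intros i j Hi Hj Hn. specialize (K3 i j Hi Hj Hn). apply functional_extensionality; intros y.
      assert (K5 := f_equal (fun h => h y) K3). cbv beta in K5. unfold kw. lra.
    + intros y. specialize (K4 y). cbv beta in K4. unfold kw. lra.
Qed.

Context (beta beta' : nat -> nat -> R) (a : R)
  (B0 : forall j, beta O j = 0)
  (B1 : forall i j, (i <= k)%nat -> (j <= l)%nat -> (i, j) <> (k, l) -> beta' i j = beta i j)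
  (B2 : beta' k l = beta k l + a).

Lemma pert_bmul f f' xi phi : row0 f phi -> pert k l f f' xi ->
  pert k l (bmul beta f) (bmul beta' f') (fun e y => match e with false => a * phi y | true => 0 end).
Proof.
  intros R0 F e.
  assert (PB : pertc k l (fun k l _ => beta k l) (fun k l _ => beta' k l) (fun _ => a)).
  { split; intros; [rewrite B1 | rewrite B2]; auto. }
  eapply pertc_ext; [|apply (pertc_conv _ _ _ _ _ _ PB (F e))].
  intros y. cbv beta. rewrite B0. destruct (R0 O y) as [E1 E2]. destruct e; [rewrite E2 | rewrite E1]; ring.
Qed.

Lemma pert_sub f f' g g' xi eta : pert k l f f' xi -> pert k l g g' eta ->
  pert k l (fsub f g) (fsub f' g') (fun e y => xi e y - eta e y).
Proof.
  intros F G e. destruct (F e) as [F1 F2], (G e) as [G1 G2]. unfold fsub. split.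
  - intros i j Hi Hj Hn. rewrite F1, G1; auto.
  - intros y. rewrite F2, G2; ring.
Qed.

Lemma pert_add f f' g g' xi eta : pert k l f f' xi -> pert k l g g' eta ->
  pert k l (fadd f g) (fadd f' g') (fun e y => xi e y + eta e y).
Proof. intros F G e. apply pertc_plus; auto. Qed.

Lemma pert_dx f f' xi dxi phi dphi : (forall e (y : R), is_derive (xi e) y (dxi e y)) ->
  (forall y : R, is_derive phi y (dphi y)) -> (forall e y, ex_derive (f e k l) y) ->
  row0 f phi -> pert k l f f' xi ->
  pert k l (dx p beta f) (dx p beta' f')
    (fun e y => match e with false => dxi false y - a * dphi y | true => dxi true y + INR k * xi false y end).
Proof.
  intros Dxi Dphi Df R0 F.
  assert (FD := pert_fdy _ _ _ _ Dxi Df F).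
  assert (K := pert_sub _ _ _ _ _ _ (pert_add _ _ _ _ _ _ FD (pert_fD _ _ _ F))
     (pert_bmul _ _ _ _ (row0_fdy _ _ _ Dphi R0) FD)).
  intros e. eapply pertc_ext; [|apply (K e)]. intros y; destruct e; ring.
Qed.

(* The bracket is [- (L A)' - a (3 Q - 2 Q^p)'], resp. [- (L b)' + k (3 A'' + p Q^(p-1) A - 3 a Q'')],
   since [Q'' = Q - Q^p]; the unknown is [b = k B] because [(R^k)' = k R^k rho]. *)
Lemma pert_Sfam f f' (A b A1 A2 A3 b1 b2 b3 : R -> R) :
  (forall y : R, is_derive A y (A1 y)) -> (forall y : R, is_derive A1 y (A2 y)) -> (forall y : R, is_derive A2 y (A3 y)) ->
  (forall y : R, is_derive b y (b1 y)) -> (forall y : R, is_derive b1 y (b2 y)) -> (forall y : R, is_derive b2 y (b3 y)) ->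
  cls p 1 f -> row0 f (Q p) -> pert k l f f' (fun e => match e with false => A | true => b end) ->
  forall e y, Sfam p beta' f' e k l y = Sfam p beta f e k l y +
    match e with
    | false => A3 y - A1 y + Derive (fun y => INR p * Q p y ^ (p - 1) * A y) y
               - 3 * a * (V p y * dQ p y) - a * (INR p * Q p y ^ (p - 1) * dQ p y)
    | true => b3 y - b1 y + Derive (fun y => INR p * Q p y ^ (p - 1) * b y) y
               + INR k * (3 * A2 y + INR p * Q p y ^ (p - 1) * A y - 3 * a * ddQ p y)
    end.
Proof.
  intros DA DA1 DA2 Db Db1 Db2 CF R0 F.
  assert (DQ : forall y : R, is_derive (Q p) y (dQ p y)) by exact (is_derive_Q p hp2). set (D1 := is_derive_dQ p hp2). set (D2 := is_derive_ddQ p hp2).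
  assert (C1 := cls_dx p hp2 1 beta f ltac:(lia) CF). assert (C2 := cls_dx p hp2 1 beta _ ltac:(lia) C1).
  assert (DF := cls_ex p _ _ CF). assert (DF1 := cls_ex p _ _ C1). assert (DF2 := cls_ex p _ _ C2).
  set (dl := fun (u : R -> R) c (v : R -> R) (y : R) => u y + c * v y).
  assert (Ddl : forall u u' c v v', (forall y : R, is_derive u y (u' y)) -> (forall y : R, is_derive v y (v' y)) ->
     forall y : R, is_derive (dl u c v) y (dl u' c v' y)).
  { intros u u' c v v' Du Dv y. unfold dl. apply @is_derive_plus; [|apply is_derive_scal]; auto. }
  assert (R1 := row0_dx p hp2 beta f _ _ B0 DQ R0).
  assert (R2 := row0_dx p hp2 beta _ _ _ B0 D1 R1).
  (* Each [dx] differentiates the increments in [y], subtracts [a] times the next derivative of [Q]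
     from the even one, and sends [INR k] times the even one to the [rho] component. After three
     rounds the accumulated factors are 3. *)
  assert (P1 : pert k l (dx p beta f) (dx p beta' f') (fun e => match e with false => dl A1 (- a) (dQ p) | true => dl b1 (INR k) A end)).
  { intros e. eapply pertc_ext; [|apply (pert_dx f f' (fun e => match e with false => A | true => b end) (fun e => match e with false => A1 | true => b1 end) (Q p) (dQ p)); auto].
    - intros y; destruct e; unfold dl; ring.
    - intros [|]; auto. }
  assert (P2 : pert k l (dx p beta (dx p beta f)) (dx p beta' (dx p beta' f'))
     (fun e => match e with false => dl A2 (-2 * a) (ddQ p) | true => dl b2 (2 * INR k) (dl A1 (- a / 2) (dQ p)) end)).
  { intros e. eapply pertc_ext; [|apply (pert_dx _ _ (fun e => match e with false => dl A1 (- a) (dQ p) | true => dl b1 (INR k) A end)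
       (fun e => match e with false => dl A2 (- a) (ddQ p) | true => dl b2 (INR k) A1 end)
       (dQ p) (ddQ p)); [| exact D1 | intros; apply DF1 | exact R1 | exact P1]].
    - intros y; destruct e; unfold dl; field.
    - intros [|]; apply Ddl; auto. }
  assert (P3 := pert_dx _ _
       (fun e => match e with false => dl A2 (-2 * a) (ddQ p) | true => dl b2 (2 * INR k) (dl A1 (- a / 2) (dQ p)) end)
       (fun e => match e with false => dl A3 (-2 * a) (fun y => V p y * dQ p y)
       | true => dl b3 (2 * INR k) (dl A2 (- a / 2) (ddQ p)) end) (ddQ p) (fun y => V p y * dQ p y)
       ltac:(intros [|]; repeat apply Ddl; auto) D2 (fun e y => DF2 e k l y) R2 P2).
  assert (exW : forall u u' : R -> R, (forall y : R, is_derive u y (u' y)) ->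
     forall y : R, is_derive (fun y => INR p * Q p y ^ (p - 1) * u y) y (Derive (fun y => INR p * Q p y ^ (p - 1) * u y) y)).
  { intros u u' Du y. apply Derive_correct. specialize (Du y). assert (H := DQ y).
    auto_derive. repeat split; eexists; eassumption. }
  assert (PW := pert_fpow f f' _ _ p R0 F). assert (RW := row0_fpow p hp2 f _ p R0).
  assert (DQp : forall y : R, is_derive (fun y => Q p y ^ p) y (INR p * Q p y ^ (p - 1) * dQ p y)).
  { intros y. assert (H := DQ y). auto_derive; [eexists; eassumption|].
    rewrite (Derive_eta _ _ _ H). replace (pred p) with (p - 1)%nat by lia. ring. }
  assert (P4 : pert k l (dx p beta (fpow p f p)) (dx p beta' (fpow p f' p)) (fun e y =>
     match e with false => Derive (fun y => INR p * Q p y ^ (p - 1) * A y) y - a * (INR p * Q p y ^ (p - 1) * dQ p y)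
      | true => Derive (fun y => INR p * Q p y ^ (p - 1) * b y) y + INR k * (INR p * Q p y ^ (p - 1) * A y) end)).
  { assert (Hpr : pred p = (p - 1)%nat) by lia.
    assert (Hc : cls p p (fpow p f p)) by (apply cls_fpow; auto).
    intros e. eapply pertc_ext; [|apply (pert_dx _ _ (fun e y => INR p * Q p y ^ (pred p) * match e with false => A | true => b end y) (fun e => match e with
        false => Derive (fun y => INR p * Q p y ^ (p - 1) * A y)
      | true => Derive (fun y => INR p * Q p y ^ (p - 1) * b y) end) _ _
       ltac:(rewrite Hpr; intros [|]; [apply (exW b b1) | apply (exW A A1)]; auto) DQp
       (fun e y => cls_ex p _ _ Hc e k l y) RW PW)].
    intros y; destruct e; rewrite ?Hpr; reflexivity. }
  assert (FD : pert k l (fdy f) (fdy f') (fun e => match e with false => A1 | true => b1 end)).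
  { apply (pert_fdy f f' (fun e => match e with false => A | true => b end)); auto. intros [|]; auto. }
  (* Only the existence of an increment matters here: the factor [c] moves it out of the box. *)
  assert (PT : exists eta, pert k l (dtc p beta f) (dtc p beta' f') eta).
  { eexists. apply pert_sub; [apply pert_fD, F | eapply pert_bmul; [|apply FD]].
    apply (row0_fdy _ (Q p) (dQ p)); auto. }
  destruct PT as [eta PT].
  assert (PS : pert k l (fshc (dtc p beta f)) (fshc (dtc p beta' f')) (fun _ _ => 0)).
  { intros e. eapply pertc_shc, PT. }
  assert (PF := pert_add _ _ _ _ _ _ (pert_sub _ _ _ _ _ _ P3 (pert_add _ _ _ _ _ _ FD PS)) P4).
  intros e y. destruct (PF e) as [_ PF2]. unfold Sfam. rewrite PF2. destruct e; unfold dl; field.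
Qed.

End Perturbation.

Notation entry := (R * ((R -> R) * (R -> R)))%type.
Notation table := (nat -> nat -> entry).

(** * Recursive construction of the coefficients *)

Section Table.
Context (p : nat) (hp : (p = 2 \/ p = 3 \/ p = 4)%nat).
Let hp2 : (2 <= p)%nat := hp_ge2 p hp.

(** Coefficients of [alpha']; row 0 is empty because the sum defining [alpha] starts at [k = 1]. *)
Definition betaT (T : table) (k l : nat) : R := match k with O => 0 | S _ => fst (T k l) end.
Definition wfam (T : table) : fam := fun e k l y =>
  match k with
  | O => 0
  | S _ => match e with false => fst (snd (T k l)) y | true => INR k * snd (snd (T k l)) y end
  end.
(* The solitons: [Q] at index (0,0), and [R] at index (1,0). *)
Definition basefam : fam := fun e k l y =>
  match e, k, l with false, O, O => Q p y | false, S O, O => 1 | _, _, _ => 0 end.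
Definition vfam (T : table) : fam := fadd basefam (wfam T).
(** The third clause keeps [A] localized as long as the residual it cancels is; at index (1,0) this
    gives the sharp power of [c] in the second estimate. *)
Definition good (k l : nat) (x : entry) : Prop :=
  Pol (deg p 1 (wt p k l)) (fst (snd x)) /\ parity false (fst (snd x)) /\
  (deg p p (wt p k l) = O -> Loc (fst (snd x))) /\
  Pol (deg p 1 (wt p k l)) (snd (snd x)) /\ parity true (snd (snd x)).
Definition goodT (T : table) : Prop := forall k l, (1 <= k)%nat -> good k l (T k l).
Definition zero_entry : entry := (0, ((fun _ => 0), (fun _ => 0))).
Definition upd (T : table) (k l : nat) (x : entry) : table :=
  fun i j => if ((i =? k) && (j =? l))%bool then x else T i j.
Definition ST (T : table) : fam := Sfam p (betaT T) (vfam T).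

Lemma good_zero k l : good k l zero_entry.
Proof.
  repeat split; simpl; try apply Pol_zero; try apply parity_zero. intros; apply Loc_zero.
Qed.

Lemma cls_wfam T : goodT T -> cls p 1 (wfam T).
Proof.
  intros H e k l. destruct k; [apply Pol_zero|].
  destruct (H (S k) l) as [H1 [_ [_ [H2 _]]]]; [lia|].
  destruct e; unfold wfam; [apply Pol_scal|]; auto.
Qed.

Lemma cls_basefam : cls p 1 basefam.
Proof.
  intros [|] k l; unfold basefam; [apply Pol_zero|].
  destruct k as [|[|k]], l; try apply Pol_zero.
  - apply Loc_Pol, Q_Loc; auto.
  - rewrite (deg_S p hp2) by (unfold wt; lia). apply Pol_const.
Qed.

Lemma cls_vfam T : goodT T -> cls p 1 (vfam T).
Proof. intros H; apply cls_fadd; [apply cls_basefam | apply cls_wfam; auto]. Qed.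

Lemma par_wfam T : goodT T -> par false (wfam T).
Proof.
  intros H e k l. destruct k; [apply parity_zero|].
  destruct (H (S k) l) as [_ [H1 [_ [_ H2]]]]; [lia|].
  destruct e; unfold wfam; simpl xorb; [apply parity_scal|]; auto.
Qed.

Lemma par_vfam T : goodT T -> par false (vfam T).
Proof.
  intros H; apply par_fadd; [|apply par_wfam; auto].
  intros [|] k l; unfold basefam; [apply parity_zero|].
  destruct k as [|[|k]], l; try apply parity_zero; [|apply parity_const].
  intros y; rewrite Q_even by auto; simpl; ring.
Qed.

Lemma row0_vfam T : row0 (vfam T) (Q p).
Proof. intros m y. unfold vfam, fadd, basefam, wfam. destruct m; split; ring. Qed.

Lemma feqbox_vfam k l T T' : eqbox k l T T' -> feqbox k l (vfam T) (vfam T').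
Proof. intros H e i j Hi Hj. unfold vfam, fadd, wfam. rewrite (H i j); auto. Qed.

Lemma eqbox_betaT k l T T' : eqbox k l T T' -> eqbox k l (betaT T) (betaT T').
Proof. intros H i j Hi Hj. unfold betaT. rewrite (H i j); auto. Qed.

Lemma feqbox_ST k l T T' : eqbox k l T T' -> feqbox k l (ST T) (ST T').
Proof.
  intros H. unfold ST.
  exact (feqbox_Sfam p hp2 k l _ _ _ _ (eqbox_betaT _ _ _ _ H) (feqbox_vfam _ _ _ _ H)).
Qed.

Lemma upd_eq T k l x : upd T k l x k l = x.
Proof. unfold upd. rewrite !Nat.eqb_refl. auto. Qed.

Lemma upd_neq T k l x i j : (i, j) <> (k, l) -> upd T k l x i j = T i j.
Proof.
  intros H. unfold upd. destruct (Nat.eqb_spec i k), (Nat.eqb_spec j l); simpl; auto. subst; congruence.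
Qed.

Lemma goodT_upd T k l x : goodT T -> good k l x -> goodT (upd T k l x).
Proof.
  intros HT Hx i j Hi. unfold upd.
  destruct (Nat.eqb_spec i k), (Nat.eqb_spec j l); simpl; auto. subst; auto.
Qed.

Definition spec (T : table) (k l : nat) (x : entry) : Prop :=
  good k l x /\ forall e y, ST (upd T k l x) e k l y = 0.

(** The residual computed with a zero entry at [(k, l)] provides the sources [F] and [G]; the entry
    solving the two equations then cancels it, by the affine response at the corner. *)
Lemma spec_exists T k l : (1 <= k)%nat -> goodT T -> exists x, spec T k l x.
Proof.
  intros Hk HT. set (T0 := upd T k l zero_entry).
  assert (HT0 : goodT T0) by (apply goodT_upd; auto; apply good_zero).
  assert (C := cls_Sfam p hp2 (betaT T0) _ (cls_vfam _ HT0)).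
  assert (Pr := par_Sfam p hp2 (betaT T0) _ (cls_vfam _ HT0) (par_vfam _ HT0)).
  destruct (solve_level p hp k (deg p p (wt p k l)) (ST T0 false k l) (ST T0 true k l) Hk
    (C false k l) (Pr false k l) (C true k l) (Pr true k l))
    as (a & A & B & SF & SH & PA & EA & LA & PB & OB & DSF & [SA1 SA2] & DSH & [SB1 SB2]).
  assert (Hw : (1 <= wt p k l)%nat) by (unfold wt; lia).
  rewrite <- (deg_S p hp2) in PA, PB by auto.
  exists (a, (A, B)). split; [repeat split; auto|].
  set (T1 := upd T k l (a, (A, B))).
  assert (Hneq : forall i j, (i, j) <> (k, l) -> T1 i j = T0 i j).
  { intros; unfold T1, T0; rewrite !upd_neq; auto. }
  assert (E0 : T0 k l = zero_entry) by apply upd_eq. assert (E1 : T1 k l = (a, (A, B))) by apply upd_eq.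
  set (b := fun x => INR k * B x) in *.
  assert (PP : pert k l (vfam T0) (vfam T1) (fun e => match e with false => A | true => b end)).
  { intros e; split.
    - intros i j Hi Hj Hn. unfold vfam, fadd, wfam. rewrite Hneq by auto. reflexivity.
    - intros y. unfold vfam, fadd, wfam. rewrite E0, E1. destruct k; [lia|].
      unfold zero_entry, b; destruct e; simpl fst; simpl snd; ring. }
  assert (TA := Pol_Tame _ _ PA). assert (Tb := Pol_Tame _ _ (Pol_scal _ (INR k) _ PB)). fold b in Tb.
  assert (DD : forall u, Tame u -> forall y : R, is_derive u y (Derive u y)).
  { intros u Hu y. apply Derive_correct, Tame_ex; auto. }
  assert (K := pert_Sfam p hp2 k l Hk (betaT T0) (betaT T1) a).
  assert (K' : forall e y, ST T1 e k l y = ST T0 e k l y +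
    match e with
    | false => Derive (Derive (Derive A)) y - Derive A y + Derive (fun y => INR p * Q p y ^ (p - 1) * A y) y
               - 3 * a * (V p y * dQ p y) - a * (INR p * Q p y ^ (p - 1) * dQ p y)
    | true => Derive (Derive (Derive b)) y - Derive b y + Derive (fun y => INR p * Q p y ^ (p - 1) * b y) y
               + INR k * (3 * Derive (Derive A) y + INR p * Q p y ^ (p - 1) * A y - 3 * a * ddQ p y)
    end).
  { unfold ST. apply K with (A1 := Derive A) (A2 := Derive (Derive A)) (b1 := Derive b) (b2 := Derive (Derive b));
      try (apply DD; repeat apply Tame_Derive; assumption).
    - intros; reflexivity.
    - intros i j Hi Hj Hn. unfold betaT. rewrite Hneq by auto. reflexivity.
    - unfold betaT. rewrite E0, E1. destruct k; [lia|]. unfold zero_entry; simpl fst. ring.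
    - apply cls_vfam; auto.
    - apply row0_vfam.
    - apply PP. }
  assert (VQ := V_Q p hp2).
  assert (TW : Tame (fun y => INR p * Q p y ^ (p - 1))).
  { apply Tame_scal, Tame_pow, Loc_Tame, Q_Loc; auto. }
  (* The derivative of [u'' - u + p Q^(p-1) u = - f]. *)
  assert (Comb : forall (u : R -> R) (f : R -> R), Tame u -> (forall x : R, is_derive (Derive u) x (V p x * u x - f x)) ->
    forall g : R -> R, (forall x : R, is_derive f x (g x)) -> forall y : R,
    Derive (Derive (Derive u)) y - Derive u y + Derive (fun y => INR p * Q p y ^ (p - 1) * u y) y = - g y).
  { intros u f Tu Su g Df y.
    assert (D1 := DD _ (Tame_Derive _ (Tame_Derive _ Tu)) y). assert (D2 := DD _ Tu y).
    assert (D3 := DD _ (Tame_mult _ _ TW Tu) y).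
    assert (D4 : is_derive (fun y => -1 * f y) y (- g y)).
    { replace (- g y) with (-1 * g y) by ring. apply is_derive_scal, Df. }
    symmetry. rewrite <- (is_derive_unique _ _ _ D4). apply is_derive_unique.
    apply (is_derive_ext (fun y => Derive (Derive u) y - u y + INR p * Q p y ^ (p - 1) * u y)).
    - intros t. rewrite (is_derive_unique _ _ _ (Su t)), VQ. lra.
    - apply @is_derive_plus; auto. apply @is_derive_minus; auto. }
  assert (Dsh : forall x : R, is_derive (fun x => SF x - a * shiftsrc p x) x
     (ST T0 false k l x - a * (3 * dQ p x - 2 * (INR p * Q p x ^ (p - 1) * dQ p x)))).
  { intros x. apply @is_derive_minus; [apply DSF|]. apply is_derive_scal. unfold shiftsrc.
    assert (HQ := is_derive_Q p hp2 x). auto_derive; [repeat split; eexists; eassumption|].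
    rewrite (Derive_eta _ _ _ HQ). unfold dQ. replace (pred p) with (p - 1)%nat by lia. ring. }
  intros e y. rewrite K'. destruct e.
  - rewrite (Comb b SH Tb SB2 _ DSH). unfold Hsrc. rewrite VQ. ring.
  - rewrite (Comb A _ TA SA2 _ Dsh), VQ. ring.
Qed.

Definition choice (T : table) (k l : nat) : entry := epsilon (inhabits zero_entry) (spec T k l).

(** Stage [S n] fills the diagonal [k + l = n]. The other indices of the box below [(k, l)] lie on
    earlier diagonals, so all entries of a diagonal can be chosen at once from the previous
    stage. *)
Fixpoint stage (n : nat) : table :=
  match n with
  | O => fun _ _ => zero_entry
  | S n => fun k l => if ((k + l =? n) && (1 <=? k))%bool then choice (stage n) k l else stage n k l
  end.

Lemma stage_S n k l : stage (S n) k l =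
  if ((k + l =? n) && (1 <=? k))%bool then choice (stage n) k l else stage n k l.
Proof. reflexivity. Qed.

Lemma stage_good n : goodT (stage n).
Proof.
  induction n; intros k l Hk; [apply good_zero|]. rewrite stage_S.
  destruct (Nat.eqb_spec (k + l) n), (Nat.leb_spec 1 k); cbv [andb]; auto.
  apply (epsilon_spec (inhabits zero_entry) (spec (stage n) k l)), spec_exists; auto.
Qed.

Lemma stage_stable n m i j : (n <= m)%nat -> (i + j < n)%nat -> stage m i j = stage n i j.
Proof.
  induction 1; intros; auto. rewrite stage_S. destruct (Nat.eqb_spec (i + j) m); simpl; auto. lia.
Qed.

Lemma stage_ST n k l : (1 <= k)%nat -> (k + l < n)%nat -> forall e y, ST (stage n) e k l y = 0.
Proof.
  intros Hk Hn e y.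
  assert (E : feqbox k l (ST (stage n)) (ST (stage (S (k + l))))).
  { apply feqbox_ST. intros i j Hi Hj. apply stage_stable; lia. }
  rewrite (E e k l) by auto.
  destruct (epsilon_spec (inhabits zero_entry) (spec (stage (k + l)) k l)) as [_ H].
  { apply spec_exists; auto. apply stage_good. }
  (* In the box below [(k, l)] the corner is the only index of its diagonal, so filling the diagonal
     and updating the corner agree there. *)
  assert (E2 : feqbox k l (ST (stage (S (k + l)))) (ST (upd (stage (k + l)) k l (choice (stage (k + l)) k l)))).
  { apply feqbox_ST. intros i j Hi Hj. rewrite stage_S. unfold upd.
    destruct (Nat.eqb_spec i k), (Nat.eqb_spec j l), (Nat.eqb_spec (i + j) (k + l)), (Nat.leb_spec 1 i); cbv [andb]; subst; auto; lia. }
  rewrite (E2 e k l) by auto. apply H.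
Qed.

Definition limit_table : table := fun k l => stage (S (k + l)) k l.

Lemma limit_good : goodT limit_table.
Proof. intros k l Hk. apply stage_good; auto. Qed.

Lemma limit_ST k l : (1 <= k)%nat -> forall e y, ST limit_table e k l y = 0.
Proof.
  intros Hk e y.
  assert (E : feqbox k l (ST limit_table) (ST (stage (S (k + l))))).
  { apply feqbox_ST. intros i j Hi Hj. unfold limit_table. symmetry. apply stage_stable; lia. }
  rewrite (E e k l) by auto. apply stage_ST; auto.
Qed.

(** The entries are those of one table fixed before [k0] and [l0]; by causality the residual of the
    truncation still vanishes inside the box. *)
Definition trunc (k0 l0 : nat) (T : table) : table :=
  fun k l => if ((k <=? k0) && (l <=? l0))%bool then T k l else zero_entry.

Lemma goodT_trunc k0 l0 T : goodT T -> goodT (trunc k0 l0 T).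
Proof. intros H k l Hk. unfold trunc. destruct (_ && _)%bool; auto using good_zero. Qed.

Lemma trunc_ST k0 l0 k l : (1 <= k)%nat -> (k <= k0)%nat -> (l <= l0)%nat ->
  forall e y, ST (trunc k0 l0 limit_table) e k l y = 0.
Proof.
  intros Hk Hk0 Hl0 e y.
  assert (E : feqbox k l (ST (trunc k0 l0 limit_table)) (ST limit_table)).
  { apply feqbox_ST. intros i j Hi Hj. unfold trunc.
    destruct (Nat.leb_spec i k0), (Nat.leb_spec j l0); simpl; auto; lia. }
  rewrite (E e k l) by auto. apply limit_ST; auto.
Qed.

(** Row 0 is the residual of the large soliton alone, [Q''' - Q' + (Q^p)' = 0]. *)
Lemma ST_row0 T : row0 (ST T) (fun _ => 0).
Proof.
  assert (R0 := row0_vfam T). assert (B : forall j, betaT T O j = 0) by reflexivity.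
  assert (DQ := is_derive_Q p hp2 : forall y : R, is_derive (Q p) y (dQ p y)).
  assert (D1 := is_derive_dQ p hp2). assert (D2 := is_derive_ddQ p hp2).
  assert (DQp : forall y : R, is_derive (fun y => Q p y ^ p) y (INR p * Q p y ^ (p - 1) * dQ p y)).
  { intros y. assert (H := DQ y). auto_derive; [eexists; eassumption|].
    rewrite (Derive_eta _ _ _ H). replace (pred p) with (p - 1)%nat by lia. ring. }
  assert (R3 := row0_dx p hp2 _ _ _ _ B D2 (row0_dx p hp2 _ _ _ _ B D1 (row0_dx p hp2 _ _ _ _ B DQ R0))).
  assert (R4 := row0_dx p hp2 _ _ _ _ B DQp (row0_fpow p hp2 _ _ p R0)).
  assert (FD := row0_fdy _ _ _ DQ R0).
  assert (RT := row0_minus _ _ _ _ (row0_fD p hp2 _ _ R0) (row0_bmul _ _ _ B FD)).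
  assert (RS : row0 (fshc (dtc p (betaT T) (vfam T))) (fun _ => 0)).
  { intros m y. unfold fshc, shc. destruct m; [auto|]. destruct (RT m y) as [E1 E2].
    unfold dtc. rewrite E1, E2. destruct m; split; ring. }
  assert (K := row0_plus _ _ _ _ (row0_minus _ _ _ _ R3 (row0_plus _ _ _ _ FD RS)) R4).
  intros m y. destruct (K m y) as [K1 K2]. unfold ST, Sfam. rewrite K1, K2. split; auto.
  destruct m; auto. rewrite V_Q by auto. ring.
Qed.

End Table.

(** * Evaluation of formal expansions *)

Definition fin (N : nat) (u : nat -> nat -> R) : Prop := forall k l, (N < k)%nat \/ (N < l)%nat -> u k l = 0.
Definition ev2 (N : nat) (u : nat -> nat -> R) (x z : R) : R :=
  sum_f_R0 (fun k => sum_f_R0 (fun l => u k l * z ^ l) N * x ^ k) N.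
(* Only used on expansions with finite support, where the sequence is eventually constant. *)
Definition ev (u : nat -> nat -> R) (x z : R) : R := real (Lim_seq (fun N => ev2 N u x z)).

Lemma sum_extend f n N : (n <= N)%nat -> (forall i, (n < i)%nat -> f i = 0) -> sum_f_R0 f N = sum_f_R0 f n.
Proof. induction 1; intros H1; auto. simpl. rewrite IHle, H1 by (auto; lia). ring. Qed.

Lemma fin_mono N M u : (N <= M)%nat -> fin N u -> fin M u.
Proof. intros H F k l Hkl. apply F. lia. Qed.

Lemma ev2_extend N M u x z : fin N u -> (N <= M)%nat -> ev2 M u x z = ev2 N u x z.
Proof.
  intros F H. unfold ev2. rewrite (sum_extend _ N M); auto.
  - apply sum_eq; intros k Hk. f_equal. apply sum_extend; auto. intros l Hl. rewrite F by lia. ring.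
  - intros k Hk. rewrite sum_zero; [ring|]. intros l Hl. rewrite F by lia. ring.
Qed.

Lemma ev_eq N u x z : fin N u -> ev u x z = ev2 N u x z.
Proof.
  intros F. unfold ev. rewrite (Lim_seq_ext_loc _ (fun _ => ev2 N u x z)).
  - rewrite Lim_seq_const. reflexivity.
  - exists N. intros M HM. apply ev2_extend; auto.
Qed.

Lemma fin_plus N u v : fin N u -> fin N v -> fin N (fun k l => u k l + v k l).
Proof. intros U W k l H. rewrite U, W by auto. ring. Qed.
Lemma fin_scal N (s : nat -> R) u : fin N u -> fin N (fun k l => s k * u k l).
Proof. intros U k l H. rewrite U by auto. ring. Qed.

Lemma ev2_plus N u v x z : ev2 N (fun k l => u k l + v k l) x z = ev2 N u x z + ev2 N v x z.
Proof.
  unfold ev2. rewrite <- plus_sum. apply sum_eq; intros k Hk. rewrite <- Rmult_plus_distr_r. f_equal.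
  rewrite <- plus_sum. apply sum_eq; intros l Hl. ring.
Qed.

Lemma ev2_scal N a u x z : ev2 N (fun k l => a * u k l) x z = a * ev2 N u x z.
Proof.
  unfold ev2. rewrite scal_sum. apply sum_eq; intros k Hk.
  replace (sum_f_R0 (fun l => a * u k l * z ^ l) N) with (a * sum_f_R0 (fun l => u k l * z ^ l) N); [ring|].
  rewrite scal_sum. apply sum_eq; intros l Hl. ring.
Qed.

Lemma ev_plus N u v x z : fin N u -> fin N v -> ev (fun k l => u k l + v k l) x z = ev u x z + ev v x z.
Proof.
  intros U W. rewrite (ev_eq N) by (apply fin_plus; auto). rewrite !(ev_eq N) by auto. apply ev2_plus.
Qed.

Lemma ev_scal N a u x z : fin N u -> ev (fun k l => a * u k l) x z = a * ev u x z.
Proof.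
  intros U. rewrite (ev_eq N) by (apply (fin_scal N (fun _ => a)); auto). rewrite !(ev_eq N) by auto. apply ev2_scal.
Qed.

(** In the remainder of the Cauchy product the two indices add up to more than [M], hence to more
    than [2 * N], so one of the factors vanishes. *)
Lemma cauchy_fin (a b : nat -> R) N M : (forall i, (N < i)%nat -> a i = 0) -> (forall i, (N < i)%nat -> b i = 0) ->
  (2 * N < M)%nat -> sum_f_R0 (fun n => sum_f_R0 (fun i => a i * b (n - i)%nat) n) M = sum_f_R0 a M * sum_f_R0 b M.
Proof.
  intros A B H. rewrite cauchy_finite by lia.
  rewrite (sum_zero (fun k => sum_f_R0 (fun l => a (S (l + k)) * b (M - l)%nat) (pred (M - k)))); [ring|].
  intros k Hk. apply sum_zero. intros l Hl.
  destruct (Nat.le_gt_cases (M - l) N) as [H1|H1]; [rewrite A by lia | rewrite B by lia]; ring.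
Qed.

Lemma sum_swap (f : nat -> nat -> R) n m :
  sum_f_R0 (fun i => sum_f_R0 (fun j => f i j) m) n = sum_f_R0 (fun j => sum_f_R0 (fun i => f i j) n) m.
Proof.
  induction n; simpl; auto. rewrite IHn, <- plus_sum. auto.
Qed.

Definition convR (u v : nat -> nat -> R) (k l : nat) : R :=
  sum_f_R0 (fun i => sum_f_R0 (fun j => u i j * v (k - i)%nat (l - j)%nat) l) k.

Lemma fin_conv N u v : fin N u -> fin N v -> fin (2 * N) (convR u v).
Proof.
  intros U W k l H. apply sum_zero; intros i Hi. apply sum_zero; intros j Hj.
  destruct (Nat.le_gt_cases i N), (Nat.le_gt_cases j N), (Nat.le_gt_cases (k - i) N), (Nat.le_gt_cases (l - j) N);
    first [rewrite U by lia; ring | rewrite W by lia; ring | lia].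
Qed.

Lemma ev_conv N u v x z : fin N u -> fin N v -> ev (convR u v) x z = ev u x z * ev v x z.
Proof.
  intros U W. set (M := S (2 * N)).
  rewrite (ev_eq M (convR u v)) by (apply (fin_mono (2 * N)); [lia | apply fin_conv; auto]).
  rewrite !(ev_eq M) by (apply (fin_mono N); auto; unfold M; lia).
  unfold ev2.
  set (A := fun i => sum_f_R0 (fun l => u i l * z ^ l) M). set (B := fun i => sum_f_R0 (fun l => v i l * z ^ l) M).
  change (sum_f_R0 (fun k => sum_f_R0 (fun l => convR u v k l * z ^ l) M * x ^ k) M =
    sum_f_R0 (fun k => A k * x ^ k) M * sum_f_R0 (fun k => B k * x ^ k) M).
  rewrite <- (cauchy_fin (fun k => A k * x ^ k) (fun k => B k * x ^ k) N M); [| | | unfold M; lia].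
  - apply sum_eq; intros k Hk.
    transitivity (sum_f_R0 (fun i => A i * B (k - i)%nat) k * x ^ k).
    + f_equal. rewrite (sum_eq _ (fun l => sum_f_R0 (fun i => sum_f_R0 (fun j => (u i j * z ^ j) * (v (k - i)%nat (l - j)%nat * z ^ (l - j))) l) k)).
      * rewrite sum_swap. apply sum_eq; intros i Hi. unfold A, B.
        apply (cauchy_fin (fun j => u i j * z ^ j) (fun j => v (k - i)%nat j * z ^ j) N M); [| | unfold M; lia];
          intros j Hj; [rewrite U by lia | rewrite W by lia]; ring.
      * intros l Hl. unfold convR. rewrite Rmult_comm, scal_sum. apply sum_eq; intros i Hi.
        rewrite Rmult_comm, scal_sum. apply sum_eq; intros j Hj.
        replace (z ^ l) with (z ^ j * z ^ (l - j)) by (rewrite <- pow_add; f_equal; lia). ring.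
    + rewrite Rmult_comm, scal_sum. apply sum_eq; intros i Hi.
      replace (x ^ k) with (x ^ i * x ^ (k - i)) by (rewrite <- pow_add; f_equal; lia). ring.
  - intros i Hi. unfold A. rewrite sum_zero; [ring|]. intros l Hl. rewrite U by lia. ring.
  - intros i Hi. unfold B. rewrite sum_zero; [ring|]. intros l Hl. rewrite W by lia. ring.
Qed.

Definition shcR (u : nat -> nat -> R) (k l : nat) : R := match l with O => 0 | S l' => u k l' end.
Definition shxR (q : nat) (u : nat -> nat -> R) (k l : nat) : R := if (k <? q)%nat then 0 else u (k - q)%nat l.

Lemma fin_shc N u : fin N u -> fin (S N) (shcR u).
Proof. intros U k [|l] H; simpl; auto. apply U. lia. Qed.
Lemma fin_shx N q u : fin N u -> fin (N + q) (shxR q u).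
Proof. intros U k l H; unfold shxR. destruct (Nat.ltb_spec k q); auto. apply U. lia. Qed.

Lemma ev_shc N u x z : fin N u -> ev (shcR u) x z = z * ev u x z.
Proof.
  intros U. rewrite (ev_eq (S N)) by (apply fin_shc; auto).
  rewrite (ev_eq (S N) u) by (apply (fin_mono N); auto).
  unfold ev2. rewrite scal_sum. apply sum_eq; intros k Hk.
  rewrite decomp_sum by lia. simpl pred. simpl shcR at 1.
  rewrite (sum_extend (fun l => u k l * z ^ l) N (S N)); [| lia | intros l Hl; rewrite U by lia; ring].
  replace (sum_f_R0 (fun i => shcR u k (S i) * z ^ S i) N) with (z * sum_f_R0 (fun l => u k l * z ^ l) N); [ring|].
  rewrite scal_sum. apply sum_eq; intros l Hl. simpl. ring.
Qed.

Lemma sum_shift (g : nat -> R) q N :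
  sum_f_R0 (fun k => if (k <? q)%nat then 0 else g (k - q)%nat) (N + q) = sum_f_R0 g N.
Proof.
  induction N.
  - simpl. rewrite (sum_single _ _ q); [| lia |].
    + rewrite Nat.ltb_irrefl, Nat.sub_diag. auto.
    + intros i Hi Hn. destruct (Nat.ltb_spec i q); auto. lia.
  - change (S N + q)%nat with (S (N + q)). rewrite !tech5, IHN. f_equal.
    destruct (Nat.ltb_spec (S (N + q)) q); [lia|]. f_equal. lia.
Qed.

Lemma ev_shx N q u x z : fin N u -> ev (shxR q u) x z = x ^ q * ev u x z.
Proof.
  intros U. rewrite (ev_eq (N + q)) by (apply fin_shx; auto).
  rewrite (ev_eq N) by auto. unfold ev2. rewrite scal_sum.
  rewrite <- (sum_shift _ q N). apply sum_eq; intros k Hk. unfold shxR.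
  destruct (Nat.ltb_spec k q) as [H|H].
  - rewrite sum_zero; [ring|]. intros; ring.
  - rewrite (sum_extend _ N (N + q)); [| lia | intros l Hl; rewrite U by lia; ring].
    replace (x ^ k) with (x ^ (k - q) * x ^ q) by (rewrite <- pow_add; f_equal; lia). ring.
Qed.

Lemma is_derive_sum (f : nat -> R -> R) (f' : nat -> R) n x :
  (forall i, (i <= n)%nat -> is_derive (f i) x (f' i)) ->
  is_derive (fun x => sum_f_R0 (fun i => f i x) n) x (sum_f_R0 f' n).
Proof.
  induction n; intros H; simpl; [apply H; auto|].
  apply @is_derive_plus; [apply IHn; intros; apply H; lia | apply H; auto].
Qed.

Lemma is_derive_plus_R (f g : R -> R) (x df dg : R) :
  is_derive f x df -> is_derive g x dg -> is_derive (fun x => f x + g x) x (df + dg).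
Proof. intros F G; apply @is_derive_plus; auto. Qed.

Lemma ev2_derive N (a : coefs) (Rf yf : R -> R) x c dy rs :
  (forall k l y, ex_derive (a k l) y) -> is_derive yf x dy -> is_derive Rf x (rs * Rf x) ->
  is_derive (fun x => ev2 N (fun k l => a k l (yf x)) (Rf x) c) x
    (dy * ev2 N (fun k l => Derive (a k l) (yf x)) (Rf x) c + rs * ev2 N (fun k l => INR k * a k l (yf x)) (Rf x) c).
Proof.
  intros Da Dy DR. unfold ev2. rewrite !scal_sum, <- plus_sum.
  apply is_derive_sum. intros k Hk.
  assert (D1 : is_derive (fun x => sum_f_R0 (fun l => a k l (yf x) * c ^ l) N) x
    (sum_f_R0 (fun l => (dy * Derive (a k l) (yf x)) * c ^ l) N)).
  { apply (is_derive_sum (fun l x => a k l (yf x) * c ^ l)). intros l Hl.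
    assert (D := is_derive_comp (a k l) yf x _ _ (Derive_correct _ _ (Da k l (yf x))) Dy).
    apply (is_derive_ext (fun x => c ^ l * a k l (yf x))); [intros; apply Rmult_comm|].
    replace (dy * Derive (a k l) (yf x) * c ^ l) with (c ^ l * (dy * Derive (a k l) (yf x))) by ring.
    apply is_derive_scal. apply D. }
  assert (D2 : is_derive (fun x => Rf x ^ k) x (INR k * (rs * Rf x ^ k))).
  { auto_derive; [eexists; eassumption|]. rewrite (Derive_eta _ _ _ DR). destruct k; simpl pred; [simpl; ring|].
    rewrite <- tech_pow_Rmult. ring. }
  assert (D3 := is_derive_mult_R _ _ _ _ _ D1 D2). cbv beta in D3.
  match goal with |- is_derive _ _ ?b => match type of D3 with is_derive _ _ ?b' => replace b with b'; [exact D3|] end end.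
  rewrite (sum_eq (fun l => dy * Derive (a k l) (yf x) * c ^ l) (fun l => (Derive (a k l) (yf x) * c ^ l) * dy)) by (intros; ring).
  rewrite <- scal_sum.
  rewrite (sum_eq (fun l => INR k * a k l (yf x) * c ^ l) (fun l => (a k l (yf x) * c ^ l) * INR k)) by (intros; ring).
  rewrite <- scal_sum. ring.
Qed.

(** * Evaluation at the small soliton *)

Section Small.
Context (p : nat) (hp2 : (2 <= p)%nat) (c : R) (hc : 0 < c < 1).

Definition rho (s : R) : R := - (sqrt c * T p (sqrt c * s)).

Lemma is_derive_Qc s : is_derive (Qc p c) s (rho s * Qc p c s).
Proof.
  unfold Qc, rho. assert (H := is_derive_Q p hp2 (sqrt c * s)).
  auto_derive; [eexists; eassumption|]. rewrite (Derive_eta _ _ _ H). ring.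
Qed.

Lemma Rpower_pred : Rpower c (1 / (INR p - 1)) ^ (p - 1) = c.
Proof.
  assert (H := INRp_ge p hp2). rewrite <- Rpower_pow by apply exp_pos.
  rewrite Rpower_mult, minus_INR by lia. change (INR 1) with 1.
  replace (1 / (INR p - 1) * (INR p - 1)) with 1 by (field; lra). apply Rpower_1; lra.
Qed.

Lemma Qc_pow s : Qc p c s ^ (p - 1) = c * ((INR p + 1) / 2 * (1 - T p (sqrt c * s) ^ 2)).
Proof. unfold Qc. rewrite Rpow_mult_distr, Rpower_pred, Q_pow_pred by auto. ring. Qed.

Lemma is_derive_rho s : is_derive rho s (- ((INR p - 1) / (INR p + 1) * Qc p c s ^ (p - 1))).
Proof.
  assert (Hp := INRp_ge p hp2). rewrite Qc_pow. unfold rho. assert (H := is_derive_T p (sqrt c * s)).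
  auto_derive; [eexists; eassumption|]. rewrite (Derive_eta _ _ _ H).
  unfold mm. rewrite <- (sqrt_sqrt c) at 4 by lra. field. lra.
Qed.

Lemma rho_sq s : rho s * rho s = c - 2 / (INR p + 1) * Qc p c s ^ (p - 1).
Proof.
  assert (Hp := INRp_ge p hp2). rewrite Qc_pow. unfold rho.
  replace (- (sqrt c * T p (sqrt c * s)) * - (sqrt c * T p (sqrt c * s)))
    with ((sqrt c * sqrt c) * T p (sqrt c * s) ^ 2) by ring.
  rewrite sqrt_sqrt by lra. field. lra.
Qed.

Definition finF (N : nat) (f : fam) : Prop := forall e y, fin N (fun k l => f e k l y).
Definition Ev (f : fam) (x r y : R) : R :=
  ev (fun k l => f false k l y) x c + r * ev (fun k l => f true k l y) x c.

Lemma finF_mono N M f : (N <= M)%nat -> finF N f -> finF M f.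
Proof. intros H F e y. eapply fin_mono; eauto. Qed.
Lemma finF_fadd N f g : finF N f -> finF N g -> finF N (fadd f g).
Proof. intros F G e y. apply fin_plus; auto. Qed.
Lemma fin_minus N u v : fin N u -> fin N v -> fin N (fun k l => u k l - v k l).
Proof. intros U W k l H. rewrite U, W by auto. ring. Qed.
Lemma finF_fsub N f g : finF N f -> finF N g -> finF N (fsub f g).
Proof. intros F G e y. apply fin_minus; auto. Qed.
Lemma finF_fdy N f : finF N f -> finF N (fdy f).
Proof.
  intros F e y k l H. unfold fdy. rewrite (Derive_ext _ (fun _ => 0)); [apply Derive_const|].
  intros t. apply (F e t k l H).
Qed.
Lemma finF_fone : finF 0 fone.
Proof. intros [|] y [|k] [|l] H; simpl; auto; lia. Qed.
Lemma finF_fmul N f g : finF N f -> finF N g -> finF (2 * N + p) (fmul p f g).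
Proof.
  intros F G e y.
  assert (K : forall e1 e2, fin (2 * N) (fun k l => conv (f e1) (g e2) k l y)).
  { intros e1 e2. apply (fin_conv N (fun k l => f e1 k l y) (fun k l => g e2 k l y)); auto. }
  assert (K' : forall e1 e2, fin (2 * N + p) (fun k l => conv (f e1) (g e2) k l y)).
  { intros; apply (fin_mono (2 * N)); [lia | auto]. }
  destruct e; unfold fmul; [apply fin_plus; auto|].
  apply fin_minus; [apply fin_plus; auto|].
  - apply (fin_mono (S (2 * N))); [lia|]. exact (fin_shc (2 * N) _ (K true true)).
  - apply (fin_scal _ (fun _ => 2 / (INR p + 1))). apply (fin_mono (2 * N + (p - 1))); [lia|].
    exact (fin_shx (2 * N) (p - 1) _ (K true true)).
Qed.
Lemma finF_fD N f : finF N f -> finF (N + p) (fD p f).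
Proof.
  intros F e y. destruct e; unfold fD.
  - apply (fin_mono N); [lia|]. apply (fin_scal _ INR), F.
  - apply fin_minus.
    + apply (fin_mono (S N)); [lia|]. apply (fin_shc N (fun k l => INR k * f true k l y)), fin_scal, F.
    + apply (fin_mono (N + (p - 1))); [lia|].
      apply (fin_shx N (p - 1) (fun k l => (2 * INR k + (INR p - 1)) / (INR p + 1) * f true k l y)).
      apply (fin_scal N (fun k => (2 * INR k + (INR p - 1)) / (INR p + 1))), F.
Qed.
Lemma finF_bmul N beta f : fin N beta -> finF N f -> finF (2 * N) (bmul beta f).
Proof. intros B F e y. apply (fin_conv N beta (fun k l => f e k l y)); auto. Qed.
Lemma finF_dx N beta f : fin N beta -> finF N f -> finF (2 * N + p) (dx p beta f).
Proof.
  intros B F. apply finF_fsub; [apply finF_fadd|].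
  - apply (finF_mono N); [lia|]. apply finF_fdy; auto.
  - apply (finF_mono (N + p)); [lia|]. apply finF_fD; auto.
  - apply (finF_mono (2 * N)); [lia|]. apply finF_bmul; auto. apply finF_fdy; auto.
Qed.
Lemma finF_dtc N beta f : fin N beta -> finF N f -> finF (2 * N + p) (dtc p beta f).
Proof.
  intros B F. apply finF_fsub.
  - apply (finF_mono (N + p)); [lia|]. apply finF_fD; auto.
  - apply (finF_mono (2 * N)); [lia|]. apply finF_bmul; auto. apply finF_fdy; auto.
Qed.
Lemma finF_fshc N f : finF N f -> finF (S N) (fshc f).
Proof. intros F e y. apply (fin_shc N (fun k l => f e k l y)), F. Qed.
Lemma finF_fpow N f n : finF N f -> exists M, finF M (fpow p f n).
Proof.
  intros F; induction n as [|n [M IH]]; simpl; [exists O; apply finF_fone|].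
  exists (2 * (N + M) + p)%nat. apply finF_fmul; [apply (finF_mono N) | apply (finF_mono M)]; auto; lia.
Qed.

Lemma Ev_fadd N f g x r y : finF N f -> finF N g -> Ev (fadd f g) x r y = Ev f x r y + Ev g x r y.
Proof.
  intros F G. unfold Ev, fadd.
  rewrite !(ev_plus N _ _ x c (F _ y) (G _ y)). ring.
Qed.

Lemma ev_minus N u v x z : fin N u -> fin N v -> ev (fun k l => u k l - v k l) x z = ev u x z - ev v x z.
Proof.
  intros U W. transitivity (ev (fun k l => u k l + -1 * v k l) x z).
  - f_equal. apply functional_extensionality; intros k. apply functional_extensionality; intros l. ring.
  - rewrite (ev_plus N), (ev_scal N); auto; [ring|]. apply (fin_scal N (fun _ => -1)); auto.
Qed.

Lemma Ev_fsub N f g x r y : finF N f -> finF N g -> Ev (fsub f g) x r y = Ev f x r y - Ev g x r y.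
Proof.
  intros F G. unfold Ev, fsub.
  rewrite !(ev_minus N _ _ x c (F _ y) (G _ y)). ring.
Qed.

Lemma Ev_fshc N f x r y : finF N f -> Ev (fshc f) x r y = c * Ev f x r y.
Proof.
  intros F. unfold Ev, fshc.
  change (fun k l => shc (f false) k l y) with (shcR (fun k l => f false k l y)).
  change (fun k l => shc (f true) k l y) with (shcR (fun k l => f true k l y)).
  rewrite !(ev_shc N) by apply F. ring.
Qed.

Lemma Ev_fone x r y : Ev fone x r y = 1.
Proof. unfold Ev. rewrite !(ev_eq 0) by apply finF_fone. unfold ev2. simpl. ring. Qed.

Lemma Ev_fmul N f g x r y : r * r = c - 2 / (INR p + 1) * x ^ (p - 1) -> finF N f -> finF N g ->
  Ev (fmul p f g) x r y = Ev f x r y * Ev g x r y.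
Proof.
  intros Hr F G. unfold Ev, fmul.
  assert (K : forall e1 e2, fin (2 * N) (fun k l => conv (f e1) (g e2) k l y)).
  { intros e1 e2. apply (fin_conv N (fun k l => f e1 k l y) (fun k l => g e2 k l y)); auto. }
  assert (EC : forall e1 e2, ev (fun k l => conv (f e1) (g e2) k l y) x c =
      ev (fun k l => f e1 k l y) x c * ev (fun k l => g e2 k l y) x c).
  { intros e1 e2. apply (ev_conv N (fun k l => f e1 k l y) (fun k l => g e2 k l y)); auto. }
  set (M := (2 * N + p)%nat).
  assert (KM : forall e1 e2, fin M (fun k l => conv (f e1) (g e2) k l y)).
  { intros; apply (fin_mono (2 * N)); [unfold M; lia | auto]. }
  assert (K1 : fin M (fun k l => shc (conv (f true) (g true)) k l y)).
  { apply (fin_mono (S (2 * N))); [unfold M; lia|]. exact (fin_shc (2 * N) _ (K true true)). }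
  assert (K2 : fin M (fun k l => shx (p - 1) (conv (f true) (g true)) k l y)).
  { apply (fin_mono (2 * N + (p - 1))); [unfold M; lia|]. exact (fin_shx (2 * N) (p - 1) _ (K true true)). }
  rewrite (ev_minus M); [|apply fin_plus; auto | apply (fin_scal M (fun _ => 2 / (INR p + 1))); auto].
  rewrite (ev_plus M), (ev_plus M), (ev_scal M) by auto.
  change (fun k l => shc (conv (f true) (g true)) k l y) with (shcR (fun k l => conv (f true) (g true) k l y)).
  change (fun k l => shx (p - 1) (conv (f true) (g true)) k l y) with (shxR (p - 1) (fun k l => conv (f true) (g true) k l y)).
  rewrite (ev_shc (2 * N)), (ev_shx (2 * N)) by auto. rewrite !EC.
  set (a := ev (fun k l => f false k l y) x c). set (b := ev (fun k l => f true k l y) x c).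
  set (a' := ev (fun k l => g false k l y) x c). set (b' := ev (fun k l => g true k l y) x c).
  transitivity (a * a' + (r * r) * (b * b') + r * (a * b' + b * a')); [rewrite Hr|]; ring.
Qed.

Lemma Ev_fpow N f n x r y : r * r = c - 2 / (INR p + 1) * x ^ (p - 1) -> finF N f ->
  Ev (fpow p f n) x r y = Ev f x r y ^ n.
Proof.
  intros Hr F; induction n; simpl; [apply Ev_fone|].
  destruct (finF_fpow N f n F) as [M FM].
  rewrite (Ev_fmul (N + M)); auto; [rewrite IHn; auto | apply (finF_mono N) | apply (finF_mono M)]; auto; lia.
Qed.

Lemma Ev_bmul N beta f x r y : fin N beta -> finF N f -> Ev (bmul beta f) x r y = ev beta x c * Ev f x r y.
Proof.
  intros B F. unfold Ev, bmul.
  assert (EC : forall e, ev (fun k l => conv (fun k l _ => beta k l) (f e) k l y) x c =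
      ev beta x c * ev (fun k l => f e k l y) x c).
  { intros e. apply (ev_conv N beta (fun k l => f e k l y)); auto. }
  rewrite !EC. ring.
Qed.

Lemma Ev_fD N f x r y : finF N f -> Ev (fD p f) x r y =
  c * ev (fun k l => INR k * f true k l y) x c
  - x ^ (p - 1) * (2 / (INR p + 1) * ev (fun k l => INR k * f true k l y) x c
                  + (INR p - 1) / (INR p + 1) * ev (fun k l => f true k l y) x c)
  + r * ev (fun k l => INR k * f false k l y) x c.
Proof.
  intros F. unfold Ev, fD. assert (Hp := INRp_ge p hp2).
  set (u := fun k l => INR k * f true k l y).
  set (v := fun k l => (2 * INR k + (INR p - 1)) / (INR p + 1) * f true k l y).
  assert (U : fin N u) by (apply (fin_scal N INR), F).
  assert (W : fin N v) by (apply (fin_scal N (fun k => (2 * INR k + (INR p - 1)) / (INR p + 1))), F).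
  transitivity (ev (fun k l => shcR u k l - shxR (p - 1) v k l) x c + r * ev (fun k l => INR k * f false k l y) x c);
    [reflexivity|].
  rewrite (ev_minus (N + p)); [| apply (fin_mono (S N)); [lia | apply fin_shc; auto]
    | apply (fin_mono (N + (p - 1))); [lia | apply fin_shx; auto]].
  rewrite (ev_shc N), (ev_shx N) by auto.
  replace (ev v x c) with (2 / (INR p + 1) * ev u x c + (INR p - 1) / (INR p + 1) * ev (fun k l => f true k l y) x c); [ring|].
  rewrite <- (ev_scal N) by auto. rewrite <- (ev_scal N) by apply F. rewrite <- (ev_plus N).
  - f_equal. apply functional_extensionality; intros k. apply functional_extensionality; intros l.
    unfold u, v. field. lra.
  - apply (fin_scal N (fun _ => _)); auto.
  - apply (fin_scal N (fun _ => _)), F.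
Qed.

(** Chain rule with arbitrary inner functions, so that it serves for both [d_x] and [d_t]. The
    [rho^2] that appears when [R^k rho] is differentiated is eliminated, which brings back the
    two-component form. *)
Lemma Ev_derive N f (sf yf : R -> R) x ds dy : finF N f -> (forall e k l y, ex_derive (f e k l) y) ->
  is_derive sf x ds -> is_derive yf x dy ->
  is_derive (fun x => Ev f (Qc p c (sf x)) (rho (sf x)) (yf x)) x
    (dy * Ev (fdy f) (Qc p c (sf x)) (rho (sf x)) (yf x) + ds * Ev (fD p f) (Qc p c (sf x)) (rho (sf x)) (yf x)).
Proof.
  intros F D Ds Dy.
  assert (DR : is_derive (fun x => Qc p c (sf x)) x ((rho (sf x) * ds) * Qc p c (sf x))).
  { assert (K := is_derive_comp (Qc p c) sf x _ _ (is_derive_Qc (sf x)) Ds).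
    replace (rho (sf x) * ds * Qc p c (sf x)) with (ds * (rho (sf x) * Qc p c (sf x))) by ring. exact K. }
  assert (Dr := is_derive_comp rho sf x _ _ (is_derive_rho (sf x)) Ds).
  assert (De : forall e, is_derive (fun x => ev (fun k l => f e k l (yf x)) (Qc p c (sf x)) c) x
    (dy * ev (fun k l => fdy f e k l (yf x)) (Qc p c (sf x)) c
     + (rho (sf x) * ds) * ev (fun k l => INR k * f e k l (yf x)) (Qc p c (sf x)) c)).
  { intros e. apply (is_derive_ext (fun x => ev2 N (fun k l => f e k l (yf x)) (Qc p c (sf x)) c)).
    - intros t. symmetry. apply ev_eq, F.
    - rewrite (ev_eq N (fun k l => fdy f e k l (yf x))) by (apply finF_fdy; auto).
      rewrite (ev_eq N (fun k l => INR k * f e k l (yf x))) by (apply (fin_scal N INR), F).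
      apply (ev2_derive N (f e) (fun x => Qc p c (sf x)) yf); auto. }
  rewrite (Ev_fD N f) by auto. unfold Ev.
  assert (K := is_derive_mult_R _ _ _ _ _ Dr (De true)). cbv beta in K.
  assert (K2 := is_derive_plus_R _ _ _ _ _ (De false) K). clear K.
  assert (Hr := rho_sq (sf x)).
  set (r := rho (sf x)) in *. set (X := Qc p c (sf x)) in *.
  set (e1 := ev (fun k l => INR k * f true k l (yf x)) X c) in *.
  set (e0 := ev (fun k l => INR k * f false k l (yf x)) X c) in *.
  set (g1 := ev (fun k l => fdy f true k l (yf x)) X c) in *.
  set (g0 := ev (fun k l => fdy f false k l (yf x)) X c) in *.
  set (f1 := ev (fun k l => f true k l (yf x)) X c) in *.
  match type of K2 with is_derive _ _ ?b =>
    assert (E : b = dy * (g0 + r * g1) + ds * (r * e0 + (r * r) * e1 - X ^ (p - 1) * ((INR p - 1) / (INR p + 1) * f1))) end.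
  { change (@scal _ R_NormedModule) with Rmult. cbv beta. ring. }
  rewrite E, Hr in K2.
  replace (dy * (g0 + r * g1) + ds * (c * e1 - X ^ (p - 1) * (2 / (INR p + 1) * e1 + (INR p - 1) / (INR p + 1) * f1) + r * e0))
    with (dy * (g0 + r * g1) + ds * (r * e0 + (c - 2 / (INR p + 1) * X ^ (p - 1)) * e1
      - X ^ (p - 1) * ((INR p - 1) / (INR p + 1) * f1))) by ring.
  exact K2.
Qed.

End Small.

Lemma sum_n_m_sum (f : nat -> R) n : sum_n_m f 0 n = sum_f_R0 f n.
Proof. apply (sum_n_Reals f n). Qed.

Lemma sum_n_m_sum1 (f : nat -> R) n : sum_n_m f 1 n = sum_f_R0 (fun k => if (1 <=? k)%nat then f k else 0) n.
Proof.
  induction n; simpl.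
  - rewrite sum_n_m_zero by lia. reflexivity.
  - rewrite sum_n_Sm by lia. rewrite IHn. reflexivity.
Qed.

Definition inbox (k0 l0 k l : nat) : bool := ((1 <=? k) && ((k <=? k0) && (l <=? l0)))%bool.

Lemma inbox_spec k0 l0 k l : inbox k0 l0 k l = true <-> (1 <= k <= k0 /\ l <= l0)%nat.
Proof.
  unfold inbox. rewrite !andb_true_iff, !Nat.leb_le. lia.
Qed.

Lemma sigma0_sum k0 l0 F N : (k0 <= N)%nat -> (l0 <= N)%nat ->
  sigma0 k0 l0 F = sum_f_R0 (fun k => sum_f_R0 (fun l => if inbox k0 l0 k l then F k l else 0) N) N.
Proof.
  intros Hk Hl. unfold sigma0. rewrite sum_n_m_sum1.
  rewrite (sum_extend _ k0 N); auto.
  - apply sum_eq; intros k Hk'. rewrite (sum_extend _ l0 N); auto.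
    + destruct (Nat.leb_spec 1 k).
      * rewrite sum_n_m_sum. apply sum_eq; intros l Hl'.
        replace (inbox k0 l0 k l) with true; auto. symmetry; apply inbox_spec; lia.
      * rewrite sum_zero; auto. intros l Hl'. destruct (inbox k0 l0 k l) eqn:E; auto. apply inbox_spec in E; lia.
    + intros l Hl'. destruct (inbox k0 l0 k l) eqn:E; auto. apply inbox_spec in E; lia.
  - intros k Hk'. apply sum_zero. intros l Hl'. destruct (inbox k0 l0 k l) eqn:E; auto. apply inbox_spec in E; lia.
Qed.

Lemma is_derive_inbox (b : bool) (f : R -> R) (x df : R) : is_derive f x df ->
  is_derive (fun x => if b then f x else 0) x (if b then df else 0).
Proof. destruct b; auto. intros _. apply @is_derive_const. Qed.

(** * The ansatz as an evaluated expansion *)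

Section Ansatz.
Context (p : nat) (hp : (p = 2 \/ p = 3 \/ p = 4)%nat) (Tb : table) (k0 l0 : nat).
Let hp2 : (2 <= p)%nat := hp_ge2 p hp.
Let Tt : table := trunc k0 l0 Tb.
Let N : nat := S (k0 + l0).
Definition ashift (k l : nat) : R := fst (Tb k l).
Definition Acoef (k l : nat) : R -> R := fst (snd (Tb k l)).
Definition Bcoef (k l : nat) : R -> R := snd (snd (Tb k l)).

Lemma trunc_inbox k l : (1 <= k)%nat -> trunc k0 l0 Tb k l = if inbox k0 l0 k l then Tb k l else zero_entry.
Proof. intros H. unfold trunc, inbox. destruct (Nat.leb_spec 1 k); auto. lia. Qed.

Lemma fin_betaT : fin N (betaT Tt).
Proof.
  intros [|k] l H; simpl; auto. unfold Tt. rewrite trunc_inbox by lia.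
  destruct (inbox k0 l0 (S k) l) eqn:E; auto. apply inbox_spec in E. unfold N in H; lia.
Qed.

Lemma finF_wfam : finF N (wfam Tt).
Proof.
  intros e y [|k] l H; simpl; auto. unfold Tt. rewrite trunc_inbox by lia.
  destruct (inbox k0 l0 (S k) l) eqn:E; [apply inbox_spec in E; unfold N in H; lia|].
  destruct e; simpl; auto. ring.
Qed.

Lemma finF_basefam M : (1 <= M)%nat -> finF M (basefam p).
Proof. intros HM [|] y [|[|k]] [|l] H; simpl; auto; lia. Qed.

Lemma finF_vfam : finF N (vfam p Tt).
Proof. apply finF_fadd; [apply finF_basefam; unfold N; lia | apply finF_wfam]. Qed.

Lemma finF_ST : exists M, finF M (ST p Tt).
Proof.
  assert (Fb := fin_betaT). assert (Fv := finF_vfam).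
  assert (Dx : forall f, (exists M, finF M f) -> exists M, finF M (dx p (betaT Tt) f)).
  { intros f [M F]. exists (2 * (N + M) + p)%nat. apply finF_dx; auto.
    - apply (fin_mono N); auto; lia.
    - apply (finF_mono M); auto; lia. }
  assert (Add : forall f g, (exists M, finF M f) -> (exists M, finF M g) -> exists M, finF M (fadd f g)).
  { intros f g [M F] [M' F']. exists (M + M')%nat. apply finF_fadd; [apply (finF_mono M) | apply (finF_mono M')]; auto; lia. }
  unfold ST, Sfam. apply Add.
  - destruct (Dx _ (Dx _ (Dx _ (ex_intro _ N Fv)))) as [M F].
    destruct (Add (fdy (vfam p Tt)) (fshc (dtc p (betaT Tt) (vfam p Tt)))) as [M' F'].
    + exists N. apply finF_fdy; auto.
    + eexists. apply finF_fshc, finF_dtc; eauto.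
    + exists (M + M')%nat. apply finF_fsub; [apply (finF_mono M) | apply (finF_mono M')]; auto; lia.
  - apply Dx. eapply finF_fpow; eauto.
Qed.

Section FixedC.
Context (c : R) (hc : 0 < c < 1).

Lemma is_derive_alpha (s : R) : is_derive (alpha p c ashift k0 l0) s (ev (betaT Tt) (Qc p c s) c).
Proof.
  apply (is_derive_ext (fun s => sum_f_R0 (fun k => sum_f_R0 (fun l => if inbox k0 l0 k l then
     ashift k l * c ^ l * prim (fun s' => Qc p c s' ^ k) s else 0) N) N)).
  { intros t. unfold alpha. rewrite (sigma0_sum _ _ _ N) by (unfold N; lia). reflexivity. }
  rewrite (ev_eq N) by apply fin_betaT. unfold ev2.
  apply (is_derive_sum (fun k s => sum_f_R0 (fun l => if inbox k0 l0 k l then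
     ashift k l * c ^ l * prim (fun s' => Qc p c s' ^ k) s else 0) N)).
  intros k Hk.
  replace (sum_f_R0 (fun l => betaT Tt k l * c ^ l) N * Qc p c s ^ k)
    with (sum_f_R0 (fun l => if inbox k0 l0 k l then ashift k l * c ^ l * Qc p c s ^ k else 0) N).
  - apply (is_derive_sum (fun l s => if inbox k0 l0 k l then
     ashift k l * c ^ l * prim (fun s' => Qc p c s' ^ k) s else 0)).
    intros l Hl. apply is_derive_inbox, is_derive_scal, (is_derive_prim (fun s' => Qc p c s' ^ k)).
    intros x. apply ex_derive_continuous_R. assert (H := is_derive_Qc p hp2 c x).
    auto_derive. eexists; eassumption.
  - rewrite Rmult_comm, scal_sum. apply sum_eq; intros l Hl.
    destruct (inbox k0 l0 k l) eqn:E; destruct k as [|k].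
    + apply inbox_spec in E; lia.
    + simpl betaT. unfold Tt. rewrite trunc_inbox, E by lia. unfold ashift. ring.
    + simpl betaT. ring.
    + simpl betaT. unfold Tt. rewrite trunc_inbox, E by lia. simpl fst. ring.
Qed.

Lemma Ev_basefam x r y : Ev c (basefam p) x r y = Q p y + x.
Proof.
  unfold Ev. rewrite !(ev_eq 1) by (apply finF_basefam; auto). unfold ev2. simpl. ring.
Qed.

Lemma Derive_Qc_pow k s : Derive (fun s => Qc p c s ^ k) s = INR k * (rho p c s * Qc p c s ^ k).
Proof.
  apply is_derive_unique. assert (H := is_derive_Qc p hp2 c s).
  auto_derive; [eexists; eassumption|]. rewrite (Derive_eta _ _ _ H).
  destruct k; simpl pred; [simpl; ring|]. rewrite <- tech_pow_Rmult. ring.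
Qed.

Lemma Ev_wfam s y : Ev c (wfam Tt) (Qc p c s) (rho p c s) y =
  sigma0 k0 l0 (fun k l => c ^ l * (Qc p c s ^ k * Acoef k l y + Derive (fun s => Qc p c s ^ k) s * Bcoef k l y)).
Proof.
  rewrite (sigma0_sum _ _ _ N) by (unfold N; lia).
  unfold Ev. rewrite !(ev_eq N) by apply finF_wfam. rewrite <- ev2_scal, <- ev2_plus. unfold ev2.
  apply sum_eq; intros k Hk. rewrite Rmult_comm, scal_sum. apply sum_eq; intros l Hl.
  rewrite Derive_Qc_pow.
  destruct (inbox k0 l0 k l) eqn:E; destruct k as [|k].
  - apply inbox_spec in E; lia.
  - unfold wfam, Tt. rewrite trunc_inbox, E by lia. unfold Acoef, Bcoef. ring.
  - unfold wfam. ring.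
  - unfold wfam, Tt. rewrite trunc_inbox, E by lia. unfold zero_entry. simpl fst. simpl snd. ring.
Qed.

Definition evalxt (f : fam) (t x : R) : R :=
  Ev c f (Qc p c (ycoord c t x)) (rho p c (ycoord c t x)) (ycoord' p c ashift k0 l0 t x).

Lemma vapp_comp t x : vapp p c ashift Acoef Bcoef k0 l0 t x = evalxt (vfam p Tt) t x.
Proof.
  unfold evalxt, vfam. rewrite (Ev_fadd c N); [| apply finF_basefam; unfold N; lia | apply finF_wfam].
  rewrite Ev_basefam, Ev_wfam. reflexivity.
Qed.

Lemma w_comp t x : vapp p c ashift Acoef Bcoef k0 l0 t x - Q p (ycoord' p c ashift k0 l0 t x) - Qc p c (ycoord c t x)
  = evalxt (wfam Tt) t x.
Proof.
  rewrite vapp_comp. unfold evalxt, vfam. rewrite (Ev_fadd c N); [| apply finF_basefam; unfold N; lia | apply finF_wfam].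
  rewrite Ev_basefam. ring.
Qed.

Definition diffF (f : fam) : Prop := forall e k l y, ex_derive (f e k l) y.

Lemma is_derive_ycoord' t (x : R) :
  is_derive (fun x => ycoord' p c ashift k0 l0 t x) x (1 - ev (betaT Tt) (Qc p c (ycoord c t x)) c).
Proof.
  unfold ycoord'. apply @is_derive_minus; [apply @is_derive_id|].
  replace (ev (betaT Tt) (Qc p c (ycoord c t x)) c) with (1 * ev (betaT Tt) (Qc p c (ycoord c t x)) c) by ring.
  apply (is_derive_comp (alpha p c ashift k0 l0) (fun x => ycoord c t x)); [apply is_derive_alpha|].
  unfold ycoord; auto_derive; auto; ring.
Qed.

Lemma comp_dx M f t (x : R) : finF M f -> diffF f ->
  is_derive (fun x => evalxt f t x) x (evalxt (dx p (betaT Tt) f) t x).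
Proof.
  intros F D. set (K := (M + N)%nat).
  assert (FK : finF K f) by (apply (finF_mono M); auto; unfold K; lia).
  assert (BK : fin K (betaT Tt)) by (apply (fin_mono N); [unfold K; lia | apply fin_betaT]).
  set (b := ev (betaT Tt) (Qc p c (ycoord c t x)) c).
  assert (Ds : is_derive (fun x => ycoord c t x) x 1) by (unfold ycoord; auto_derive; auto; ring).
  assert (Dy := is_derive_ycoord' t x). fold b in Dy.
  assert (H := Ev_derive p hp2 c hc K f _ _ x _ _ FK D Ds Dy).
  unfold evalxt, dx.
  assert (Fdy := finF_fdy K f FK). assert (FD := finF_fD p hp2 K f FK). assert (FB := finF_bmul K _ _ BK Fdy).
  rewrite (Ev_fsub c (2 * K + p)); [| apply finF_fadd; [apply (finF_mono K); auto; lia | apply (finF_mono (K + p)); auto; lia]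
     | apply (finF_mono (2 * K)); auto; lia].
  rewrite (Ev_fadd c (K + p)); [| apply (finF_mono K); auto; lia | auto].
  rewrite (Ev_bmul c K) by auto. fold b.
  match goal with |- is_derive _ _ ?e => match type of H with is_derive _ _ ?e' => replace e with e' end end; [exact H|].
  ring.
Qed.

Lemma comp_dt M f t (x : R) : finF M f -> diffF f ->
  is_derive (fun t => evalxt f t x) t ((1 - c) * evalxt (dtc p (betaT Tt) f) t x).
Proof.
  intros F D. set (K := (M + N)%nat).
  assert (FK : finF K f) by (apply (finF_mono M); auto; unfold K; lia).
  assert (BK : fin K (betaT Tt)) by (apply (fin_mono N); [unfold K; lia | apply fin_betaT]).
  set (b := ev (betaT Tt) (Qc p c (ycoord c t x)) c).
  assert (Ds : is_derive (fun t => ycoord c t x) t (1 - c)) by (unfold ycoord; auto_derive; auto; ring).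
  assert (Dy : is_derive (fun t => ycoord' p c ashift k0 l0 t x) t (- ((1 - c) * b))).
  { unfold ycoord'. replace (- ((1 - c) * b)) with (0 - (1 - c) * b) by ring.
    apply @is_derive_minus; [apply @is_derive_const|].
    apply (is_derive_comp (alpha p c ashift k0 l0) (fun t => ycoord c t x)); [apply is_derive_alpha | exact Ds]. }
  assert (H := Ev_derive p hp2 c hc K f _ _ t _ _ FK D Ds Dy).
  unfold evalxt, dtc.
  assert (Fdy := finF_fdy K f FK). assert (FD := finF_fD p hp2 K f FK). assert (FB := finF_bmul K _ _ BK Fdy).
  rewrite (Ev_fsub c (2 * K + p)); [| apply (finF_mono (K + p)); auto; lia | apply (finF_mono (2 * K)); auto; lia].
  rewrite (Ev_bmul c K) by auto. fold b.
  match goal with |- is_derive _ _ ?e => match type of H with is_derive _ _ ?e' => replace e with e' end end; [exact H|].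
  ring.
Qed.

Lemma Serr_comp t x : goodT p Tb -> Serr p c ashift Acoef Bcoef k0 l0 t x = evalxt (ST p Tt) t x.
Proof.
  intros HG. assert (HT : goodT p Tt) by (apply goodT_trunc; auto).
  set (v := vfam p Tt). set (be := betaT Tt).
  assert (Cv : cls p 1 v) by (apply cls_vfam; auto).
  assert (C1 := cls_dx p hp2 1 be v ltac:(lia) Cv). assert (C2 := cls_dx p hp2 1 be _ ltac:(lia) C1).
  assert (Cp : cls p p (fpow p v p)) by (apply cls_fpow; auto).
  assert (Dv : diffF v) by exact (cls_ex p _ _ Cv). assert (D1 : diffF (dx p be v)) by exact (cls_ex p _ _ C1).
  assert (D2 : diffF (dx p be (dx p be v))) by exact (cls_ex p _ _ C2).
  assert (Dp : diffF (fpow p v p)) by exact (cls_ex p _ _ Cp).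
  assert (Fv : finF N v) by apply finF_vfam.
  assert (Fb : fin N be) by apply fin_betaT.
  assert (Fbm : forall M, (N <= M)%nat -> fin M be) by (intros; eapply fin_mono; eauto).
  assert (F1 := finF_dx p hp2 N be v Fb Fv). set (N1 := (2 * N + p)%nat) in *.
  assert (F2 := finF_dx p hp2 N1 be _ (Fbm N1 ltac:(unfold N1; lia)) F1). set (N2 := (2 * N1 + p)%nat) in *.
  assert (F3 := finF_dx p hp2 N2 be _ (Fbm N2 ltac:(unfold N2, N1; lia)) F2). set (N3 := (2 * N2 + p)%nat) in *.
  destruct (finF_fpow p hp2 N v p Fv) as [Np Fp].
  assert (Fp' := finF_dx p hp2 (N + Np) be _ (Fbm (N + Np)%nat ltac:(lia)) (finF_mono Np (N + Np) _ ltac:(lia) Fp)).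
  assert (Ft := finF_dtc p hp2 N be v Fb Fv). fold N1 in Ft.
  unfold Serr.
  assert (E1 : Derive (fun t' => vapp p c ashift Acoef Bcoef k0 l0 t' x) t = (1 - c) * evalxt (dtc p be v) t x).
  { apply is_derive_unique. apply (is_derive_ext (fun t => evalxt v t x)); [intros; symmetry; apply vapp_comp|].
    apply (comp_dt N); auto. }
  assert (Ed : forall x', Derive_n (fun x'' => vapp p c ashift Acoef Bcoef k0 l0 t x'') 2 x' = evalxt (dx p be (dx p be v)) t x').
  { intros x'. rewrite (Derive_n_ext _ (fun x => evalxt v t x)) by (intros; apply vapp_comp). simpl.
    rewrite (Derive_ext _ (fun x => evalxt (dx p be v) t x)).
    - apply is_derive_unique, (comp_dx N1); auto.
    - intros z. apply is_derive_unique. apply (comp_dx N v); auto. }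
  rewrite E1.
  assert (E2 : Derive (fun x' => Derive_n (fun x'' => vapp p c ashift Acoef Bcoef k0 l0 t x'') 2 x'
      - vapp p c ashift Acoef Bcoef k0 l0 t x' + vapp p c ashift Acoef Bcoef k0 l0 t x' ^ p) x
    = evalxt (dx p be (dx p be (dx p be v))) t x - evalxt (dx p be v) t x + evalxt (dx p be (fpow p v p)) t x).
  { apply is_derive_unique.
    apply (is_derive_ext (fun x => evalxt (dx p be (dx p be v)) t x - evalxt v t x + evalxt (fpow p v p) t x)).
    - intros z. rewrite Ed, vapp_comp. f_equal. unfold evalxt. apply (Ev_fpow p hp2 c N); auto. apply rho_sq; auto.
    - apply is_derive_plus_R; [apply @is_derive_minus|].
      + apply (comp_dx N2); auto.
      + apply (comp_dx N); auto.
      + apply (comp_dx Np); auto. }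
  rewrite E2.
  assert (E3 : evalxt (dx p be v) t x = evalxt (fdy v) t x + evalxt (dtc p be v) t x).
  { unfold evalxt. rewrite <- (Ev_fadd c N1); auto; [| apply (finF_mono N); [unfold N1; lia | apply finF_fdy; auto]].
    f_equal. do 4 (apply functional_extensionality; intros ?). unfold dx, dtc, fadd, fsub. ring. }
  unfold ST, Sfam. fold v be.
  set (M := (N + N1 + N2 + N3 + Np + 2 * (N + Np) + p)%nat).
  assert (G : forall n f, (n <= M)%nat -> finF n f -> finF M f) by (intros; eapply finF_mono; eauto).
  assert (H3 : finF M (dx p be (dx p be (dx p be v)))) by (apply (G N3); auto; unfold M; lia).
  assert (H4 : finF M (dx p be (fpow p v p))) by (apply (G (2 * (N + Np) + p)%nat); auto; unfold M; lia).
  assert (H5 : finF M (fdy v)) by (apply (G N); [unfold M; lia | apply finF_fdy; auto]).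
  assert (H6 : finF M (fshc (dtc p be v))) by (apply (G (S N1)); [unfold M, N1; lia | apply finF_fshc; auto]).
  assert (H7 : finF M (fadd (fdy v) (fshc (dtc p be v)))) by (apply finF_fadd; auto).
  unfold evalxt. rewrite (Ev_fadd c M) by (auto; apply finF_fsub; auto).
  rewrite (Ev_fsub c M), (Ev_fadd c M), (Ev_fshc c N1) by auto.
  unfold evalxt in E3. rewrite E3. ring.
Qed.

Fixpoint dxn (n : nat) (f : fam) : fam :=
  match n with O => f | S m => dx p (betaT Tt) (dxn m f) end.

Lemma dxn_cls m n f : (m <= p)%nat -> cls p m f -> cls p m (dxn n f).
Proof. intros Hm C; induction n; simpl; auto. apply cls_dx; auto. Qed.

Lemma dxn_fin M n f : finF M f -> exists M', finF M' (dxn n f).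
Proof.
  intros F; induction n as [|n [K IH]]; simpl; [exists M; auto|].
  exists (2 * (N + K) + p)%nat. apply finF_dx; auto; [eapply fin_mono; [|apply fin_betaT]; lia|].
  eapply finF_mono; [|apply IH]; lia.
Qed.

Lemma comp_dxn m M f t n x : (m <= p)%nat -> cls p m f -> finF M f ->
  Derive_n (fun x => evalxt f t x) n x = evalxt (dxn n f) t x.
Proof.
  intros Hm C F. revert x; induction n; intros x; [reflexivity|].
  change (Derive (Derive_n (fun x => evalxt f t x) n) x = evalxt (dx p (betaT Tt) (dxn n f)) t x).
  rewrite (Derive_ext _ (fun x => evalxt (dxn n f) t x)) by auto.
  destruct (dxn_fin M n f F) as [M' F']. apply is_derive_unique, (comp_dx M'); auto.
  intros e k l y. eapply cls_ex. apply (dxn_cls m); eauto.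
Qed.

End FixedC.
End Ansatz.

(** * Square integrability *)

(** The limits are the infimum and the supremum of [G], and the bound on increments passes to
    them. *)
Lemma mono_limits (G : R -> R) M : (forall x y, x <= y -> G x <= G y) -> (forall x y, x <= y -> G y - G x <= M) ->
  exists l1 l2, l2 - l1 <= M /\
    (forall eps, 0 < eps -> exists x0, forall x, x < x0 -> l1 <= G x <= l1 + eps) /\
    (forall eps, 0 < eps -> exists x0, forall x, x0 < x -> l2 - eps <= G x <= l2).
Proof.
  intros Hm HM.
  destruct (completeness (fun z => exists x, z = G x)) as [l2 [U1 U2]].
  { exists (G 0 + M). intros z [x ->]. destruct (Rle_dec 0 x).
    - assert (K := HM 0 x r). lra.
    - assert (K := Hm x 0 ltac:(lra)). assert (K' := HM 0 0 ltac:(lra)). lra. }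
  { exists (G 0), 0; auto. }
  destruct (completeness (fun z => exists x, z = - G x)) as [l1 [L1 L2]].
  { exists (- G 0 + M). intros z [x ->]. destruct (Rle_dec x 0).
    - assert (K := HM x 0 r). lra.
    - assert (K := Hm 0 x ltac:(lra)). assert (K' := HM 0 0 ltac:(lra)). lra. }
  { exists (- G 0), 0; auto. }
  assert (Sup : forall eps, 0 < eps -> exists x0, l2 - eps < G x0).
  { intros eps He. apply NNPP. intros Hn. assert (l2 <= l2 - eps); [|lra].
    apply U2. intros z [x ->]. apply Rnot_lt_le. intros Hx. apply Hn. exists x; auto. }
  assert (Inf : forall eps, 0 < eps -> exists x0, l1 - eps < - G x0).
  { intros eps He. apply NNPP. intros Hn. assert (l1 <= l1 - eps); [|lra].
    apply L2. intros z [x ->]. apply Rnot_lt_le. intros Hx. apply Hn. exists x; auto. }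
  exists (- l1), l2. split; [|split].
  - apply le_epsilon. intros eps He. destruct (Sup (eps/2)) as [x Hx]; [lra|]. destruct (Inf (eps/2)) as [y Hy]; [lra|].
    destruct (Rle_dec y x) as [H|H].
    + assert (K := HM y x H). lra.
    + assert (K := Hm x y ltac:(lra)). assert (K' := HM 0 0 ltac:(lra)). lra.
  - intros eps He. destruct (Inf eps He) as [x0 Hx0]. exists x0. intros x Hx.
    assert (- G x <= l1) by (apply L1; exists x; auto). assert (K := Hm x x0 ltac:(lra)). lra.
  - intros eps He. destruct (Sup eps He) as [x0 Hx0]. exists x0. intros x Hx.
    assert (G x <= l2) by (apply U1; exists x; auto). assert (K := Hm x0 x ltac:(lra)). lra.
Qed.

Lemma is_derive_incr_all (f f' : R -> R) : (forall x : R, is_derive f x (f' x)) ->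
  (forall x, 0 <= f' x) -> forall x y, x <= y -> f x <= f y.
Proof. intros H H0 x y Hxy. apply (is_derive_incr f f' x); auto; lra. Qed.

(** The primitive of [g^2] is monotone and its increments are dominated by those of [H], so it
    converges at both ends. The majorants used below have explicit primitives built from [atan]. *)
Lemma L2_criterion (g h H : R -> R) M : Cont g -> (forall x : R, is_derive H x (h x)) ->
  (forall x, g x ^ 2 <= h x) -> (forall a b, a <= b -> H b - H a <= M) ->
  is_L2 g /\ L2norm g ^ 2 <= M.
Proof.
  intros Cg DH Hgh HM.
  set (f := fun x => g x ^ 2).
  assert (Cf : Cont f).
  { intros x. unfold f. apply (continuous_ext (fun x => g x * g x)); [intros z; change (g z * g z = g z ^ 2); ring|].
    apply (continuous_mult g g); auto. }
  set (G := prim f).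
  assert (DG : forall x : R, is_derive G x (f x)) by (intros; apply is_derive_prim; auto).
  assert (Gm : forall x y, x <= y -> G x <= G y).
  { apply (is_derive_incr_all G f); auto. intros; apply pow2_ge_0. }
  assert (GM : forall x y, x <= y -> G y - G x <= M).
  { intros x y Hxy. assert (K := HM x y Hxy).
    assert (H x - G x <= H y - G y); [|lra].
    apply (is_derive_incr_all (fun x => H x - G x) (fun x => h x - f x)); auto.
    - intros z. apply @is_derive_minus; auto.
    - intros z. assert (K2 := Hgh z). unfold f. lra. }
  destruct (mono_limits G M Gm GM) as [l1 [l2 [Hl [HL1 HL2]]]].
  assert (IG : is_RInt_gen f (Rbar_locally m_infty) (Rbar_locally p_infty) (l2 - l1)).
  { intros P [eps HP]. destruct (HL1 (eps / 3)) as [x1 H1]; [assert (K := cond_pos eps); lra|].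
    destruct (HL2 (eps / 3)) as [x2 H2]; [assert (K := cond_pos eps); lra|].
    apply (Filter_prod _ _ _ (fun x => x < x1) (fun x => x2 < x)).
    - exists x1; auto.
    - exists x2; auto.
    - intros a b Ha Hb. exists (G b - G a). split.
      + simpl. apply (is_RInt_derive G f); intros; [apply DG | apply Cf].
      + apply HP. specialize (H1 a Ha). specialize (H2 b Hb). assert (K := cond_pos eps).
        change (Rabs (G b - G a - (l2 - l1)) < eps). apply Rabs_lt_between. lra. }
  split; [exists (l2 - l1); exact IG|].
  unfold L2norm. change (fun x => g x ^ 2) with f.
  rewrite (is_RInt_gen_unique _ _ IG).
  rewrite pow2_sqrt; auto.
  apply le_epsilon. intros e He. destruct (HL1 (e/2)) as [x1 H1]; [lra|]. destruct (HL2 (e/2)) as [x2 H2]; [lra|].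
  set (a := Rmin x1 x2 - 1). set (b := Rmax x1 x2 + 1).
  assert (K1 := Rmin_l x1 x2). assert (K2 := Rmax_r x1 x2).
  assert (K4 := Rmin_r x1 x2).
  assert (Hab : a <= b) by (unfold a, b; lra).
  assert (K5 := Gm a b Hab). specialize (H1 a ltac:(unfold a; lra)). specialize (H2 b ltac:(unfold b; lra)). lra.
Qed.

(** Both [H - f] and [H + f] are nondecreasing. *)
Lemma dominated_increment (f f' H h : R -> R) : (forall x : R, is_derive f x (f' x)) -> (forall x : R, is_derive H x (h x)) ->
  (forall x, Rabs (f' x) <= h x) -> forall x, Rabs (f x - f 0) <= Rabs (H x - H 0).
Proof.
  intros Df DH Hd x.
  assert (M1 : forall x y, x <= y -> H x - f x <= H y - f y).
  { apply (is_derive_incr_all (fun x => H x - f x) (fun x => h x - f' x)); [intros; apply @is_derive_minus; auto|].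
    intros z. specialize (Hd z). apply Rabs_le_between in Hd. lra. }
  assert (M2 : forall x y, x <= y -> H x + f x <= H y + f y).
  { apply (is_derive_incr_all (fun x => H x + f x) (fun x => h x + f' x)); [intros; apply @is_derive_plus; auto|].
    intros z. specialize (Hd z). apply Rabs_le_between in Hd. lra. }
  destruct (Rle_dec 0 x) as [Hx|Hx].
  - assert (K1 := M1 0 x Hx). assert (K2 := M2 0 x Hx).
    rewrite (Rabs_pos_eq (H x - H 0)) by lra. apply Rabs_le; lra.
  - assert (K1 := M1 x 0 ltac:(lra)). assert (K2 := M2 x 0 ltac:(lra)).
    rewrite (Rabs_left1 (H x - H 0)) by lra. apply Rabs_le; lra.
Qed.

Lemma atan_le2 x : Rabs (atan x) <= 2.
Proof. assert (H := atan_bound x). assert (K := PI_4). apply Rabs_le. lra. Qed.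

Lemma is_derive_atan_lin a b x : is_derive (fun x => atan (a * x + b)) x (a * / (1 + (a * x + b) ^ 2)).
Proof.
  assert (D := is_derive_atan (a * x + b)). rewrite Rsqr_pow2 in D.
  apply (is_derive_comp atan (fun x => a * x + b)); auto. auto_derive; auto; ring.
Qed.

(** * Polynomial and exponential bounds *)

(** With [N = S n], [1 + z <= N (1 + z/N) <= N exp (z/N)], raised to the power [N]. *)
Lemma poly_exp_bound n : exists C, 0 < C /\ forall z, 0 <= z -> (1 + z) ^ n <= C * exp z.
Proof.
  destruct n as [|n].
  - exists 1. split; [lra|]. intros z Hz. assert (H := exp_ineq1_le z). simpl; lra.
  - set (N := INR (S n)). assert (HN : 1 <= N) by (unfold N; rewrite S_INR; assert (H := pos_INR n); lra).
    exists (N ^ S n). split; [apply pow_lt; lra|]. intros z Hz.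
    assert (E : exp z = exp (z / N) ^ S n).
    { rewrite <- Rpower_pow by apply exp_pos. unfold Rpower. rewrite ln_exp. f_equal. fold N. field; lra. }
    rewrite E, <- Rpow_mult_distr. apply pow_incr. split; [lra|].
    assert (H := exp_ineq1_le (z / N)). apply Rle_trans with (N * (1 + z / N)).
    + replace (N * (1 + z / N)) with (N + z) by (field; lra). lra.
    + apply Rmult_le_compat_l; lra.
Qed.

(** The weight [/ (1 + y ^ 2)] replaces the exponential because its primitive [atan] is explicit and
    bounded. *)
Lemma Loc_bound f : Loc f -> exists C, 0 < C /\ forall y, Rabs (f y) <= C * / (1 + y ^ 2).
Proof.
  intros Hf. destruct (expbd_pos _ _ (Ecl_bd _ _ (Hf (-1/2) ltac:(lra)))) as [C [HC HB]].
  destruct (poly_exp_bound 2) as [D [HD HP]].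
  exists (C * (4 * D)). split; [nra|]. intros y. eapply Rle_trans; [apply HB|].
  rewrite Rmult_assoc. apply Rmult_le_compat_l; [lra|].
  assert (Hy := Rabs_pos y). specialize (HP (Rabs y / 2) ltac:(lra)).
  replace (-1/2 * Rabs y) with (- (Rabs y / 2)) by field. rewrite exp_Ropp.
  assert (E0 := exp_pos (Rabs y / 2)). assert (P0 := pow2_ge_0 y).
  assert (E1 : 1 + y ^ 2 <= 4 * (1 + Rabs y / 2) ^ 2) by (rewrite <- (pow2_abs y); nra).
  apply (Rmult_le_reg_r (exp (Rabs y / 2) * (1 + y ^ 2))); [nra|].
  replace (/ exp (Rabs y / 2) * (exp (Rabs y / 2) * (1 + y ^ 2))) with (1 + y ^ 2) by (field; lra).
  replace (4 * D * / (1 + y ^ 2) * (exp (Rabs y / 2) * (1 + y ^ 2))) with (4 * (D * exp (Rabs y / 2))) by (field; lra).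
  lra.
Qed.

(** A localized derivative gives a bounded function, by comparison with [atan]; each further
    integration adds one degree. Hence the classes 0 and 1 share the exponent 0, which is why [pred]
    appears. *)
Lemma Pol_bound n f : Pol n f -> exists C, 0 < C /\ forall y, Rabs (f y) <= C * (1 + Rabs y) ^ pred n.
Proof.
  revert f; induction n as [|n IH]; intros f Hf.
  - destruct (Loc_bound f Hf) as [C [HC HB]]. exists C; split; auto. intros y. eapply Rle_trans; [apply HB|].
    apply Rmult_le_compat_l; [lra|]. change ((1 + Rabs y) ^ pred 0) with 1.
    rewrite <- Rinv_1. apply Rinv_le_contravar; [lra|]. assert (H := pow2_ge_0 y). lra.
  - destruct Hf as [Df Hf].
    assert (Dfd : forall x : R, is_derive f x (Derive f x)) by (intros; apply Derive_correct; auto).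
    destruct n as [|n].
    + destruct (Loc_bound _ Hf) as [C [HC HB]].
      exists (Rabs (f 0) + 4 * C). assert (H0 := Rabs_pos (f 0)). split; [lra|]. intros y. simpl. rewrite Rmult_1_r.
      assert (K := dominated_increment f _ (fun x => C * atan (1 * x + 0)) (fun x => C * (1 * / (1 + (1 * x + 0) ^ 2))) Dfd).
      assert (K2 : Rabs (f y - f 0) <= Rabs (C * atan (1 * y + 0) - C * atan (1 * 0 + 0))).
      { apply K; [intros; apply is_derive_scal, is_derive_atan_lin|].
        intros x. eapply Rle_trans; [apply HB|]. replace (1 * x + 0) with x by ring. lra. }
      rewrite <- Rmult_minus_distr_l, Rabs_mult, (Rabs_pos_eq C) in K2 by lra.
      assert (A1 := atan_le2 (1 * y + 0)). assert (A2 := atan_le2 (1 * 0 + 0)).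
      assert (Rabs (atan (1 * y + 0) - atan (1 * 0 + 0)) <= 4).
      { eapply Rle_trans; [apply Rabs_triang|]. rewrite Rabs_Ropp. lra. }
      replace (f y) with ((f y - f 0) + f 0) by ring. eapply Rle_trans; [apply Rabs_triang|]. nra.
    + destruct (IH _ Hf) as [C [HC HB]]. simpl pred in *.
      exists (Rabs (f 0) + C). assert (H0 := Rabs_pos (f 0)). split; [lra|]. intros y.
      destruct (MVT_gen f 0 y (Derive f)) as [x [Hx Hm]].
      * intros; apply Dfd.
      * intros z _. apply derivable_continuous_pt, ex_derive_Reals_0, Df.
      * assert (Hxy : Rabs x <= Rabs y).
        { unfold Rmin, Rmax in Hx. destruct (Rle_dec 0 y).
          - rewrite !Rabs_pos_eq by lra. lra.
          - rewrite !Rabs_left1 by lra. lra. }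
        assert (Hy := Rabs_pos y). assert (Hx0 := Rabs_pos x).
        assert (P1 : 1 <= (1 + Rabs y) ^ S n) by (apply pow_R1_Rle; lra).
        assert (P2 : (1 + Rabs x) ^ n <= (1 + Rabs y) ^ n) by (apply pow_incr; lra).
        assert (P3 : 0 < (1 + Rabs x) ^ n) by (apply pow_lt; lra).
        replace (f y) with ((f y - f 0) + f 0) by ring. eapply Rle_trans; [apply Rabs_triang|].
        rewrite Hm, Rminus_0_r, Rabs_mult.
        assert (Rabs (Derive f x) * Rabs y <= C * (1 + Rabs y) ^ S n).
        { apply Rle_trans with ((C * (1 + Rabs y) ^ n) * (1 + Rabs y)); [|simpl; lra].
          apply Rmult_le_compat; auto using Rabs_pos; [|lra].
          eapply Rle_trans; [apply HB|]. apply Rmult_le_compat_l; lra. }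
        rewrite Rmult_plus_distr_r. apply Rle_trans with (C * (1 + Rabs y) ^ S n + Rabs (f 0) * 1); [lra|].
        assert (Rabs (f 0) * 1 <= Rabs (f 0) * (1 + Rabs y) ^ S n) by (apply Rmult_le_compat_l; auto). lra.
Qed.

Lemma sum_bound_ex {X : Type} (D : X -> Prop) (g : X -> R) (f : nat -> X -> R) n :
  (forall x, D x -> 0 <= g x) ->
  (forall i, (i <= n)%nat -> exists K, 0 <= K /\ forall x, D x -> Rabs (f i x) <= K * g x) ->
  exists K, 0 <= K /\ forall x, D x -> Rabs (sum_f_R0 (fun i => f i x) n) <= K * g x.
Proof.
  intros Hg; induction n; intros H; simpl; [apply (H O); auto|].
  destruct IHn as [K1 [P1 H1]]; [intros; apply H; lia|]. destruct (H (S n)) as [K2 [P2 H2]]; auto.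
  exists (K1 + K2). split; [lra|]. intros x Hx. eapply Rle_trans; [apply Rabs_triang|].
  specialize (H1 x Hx). specialize (H2 x Hx). lra.
Qed.

Lemma Rpower_le_exp c a b : 0 < c < 1 -> a <= b -> Rpower c b <= Rpower c a.
Proof.
  intros Hc Hab. unfold Rpower. apply exp_le.
  assert (ln c < 0) by (rewrite <- ln_1; apply ln_increasing; lra). nra.
Qed.

Lemma Rpower_le_1 c a : 0 < c < 1 -> 0 <= a -> Rpower c a <= 1.
Proof. intros Hc Ha. rewrite <- (Rpower_O c) by lra. apply Rpower_le_exp; auto. Qed.

Lemma Rpower_ge_1 c a : 0 < c < 1 -> a <= 0 -> 1 <= Rpower c a.
Proof. intros Hc Ha. rewrite <- (Rpower_O c) by lra. apply Rpower_le_exp; auto. Qed.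

Lemma Rpower_nat_mul c a n : Rpower c a ^ n = Rpower c (a * INR n).
Proof. rewrite <- Rpower_pow by apply exp_pos. apply Rpower_mult. Qed.

Lemma ev2_expand N u x z : ev2 N u x z = sum_f_R0 (fun k => sum_f_R0 (fun l => u k l * z ^ l * x ^ k) N) N.
Proof.
  unfold ev2. apply sum_eq; intros k Hk. rewrite Rmult_comm, scal_sum. reflexivity.
Qed.

Lemma Rpower_half c : 0 < c -> Rpower c (1/2) = sqrt c.
Proof. intros Hc. rewrite <- Rpower_sqrt by auto. f_equal. field. Qed.

Lemma inv_sqrt_Rpower c : 0 < c -> / sqrt c = Rpower c (- (1/2)).
Proof. intros Hc. rewrite <- Rpower_half by auto. symmetry; apply Rpower_Ropp. Qed.

Lemma L2norm_pos g : 0 <= L2norm g.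
Proof. apply sqrt_pos. Qed.

Lemma sq_le_reg a b : 0 <= b -> a ^ 2 <= b ^ 2 -> a <= b.
Proof. intros Hb H. destruct (Rle_dec a b); auto. nra. Qed.

Lemma pow_le_self a k : 0 <= a <= 1 -> (1 <= k)%nat -> a ^ k <= a.
Proof.
  intros Ha Hk. destruct k; [lia|]. simpl.
  assert (a ^ k <= 1) by (rewrite <- (pow1 k); apply pow_incr; lra).
  assert (0 <= a ^ k) by (apply pow_le; lra). nra.
Qed.

Lemma inv_sq_le z : / (1 + Rabs z) * / (1 + Rabs z) <= / (1 + z ^ 2).
Proof.
  assert (H := Rabs_pos z). rewrite <- Rinv_mult. rewrite <- (pow2_abs z).
  apply Rinv_le_contravar; nra.
Qed.

(** In the variable [z = sqrt c * y_c] the integral of [A^2 / (1 + z^2)] gains a factor [/ sqrt c];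
    its square root is the loss [c^(-1/4)]. The increments of [atan] are bounded by 4. *)
Lemma L2_of_bound c t g A : 0 < c < 1 -> Cont g ->
  (forall x, Rabs (g x) <= A * / (1 + Rabs (sqrt c * ycoord c t x))) ->
  is_L2 g /\ L2norm g <= 2 * A * Rpower c (- (1/4)).
Proof.
  intros Hc Cg Hb. assert (Hs : 0 < sqrt c) by (apply sqrt_lt_R0; lra).
  assert (HA : 0 <= A).
  { specialize (Hb 0). assert (H := Rabs_pos (g 0)). set (z := sqrt c * ycoord c t 0) in *.
    assert (Hz := Rabs_pos z). assert (0 < / (1 + Rabs z)) by (apply Rinv_0_lt_compat; lra). nra. }
  set (b := sqrt c * ((1 - c) * t)).
  assert (Ez : forall x, sqrt c * ycoord c t x = sqrt c * x + b) by (intros; unfold ycoord, b; ring).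
  destruct (L2_criterion g (fun x => (A ^ 2 / sqrt c) * (sqrt c * / (1 + (sqrt c * x + b) ^ 2)))
     (fun x => (A ^ 2 / sqrt c) * atan (sqrt c * x + b)) (4 * (A ^ 2 / sqrt c))) as [H1 H2]; auto.
  - intros x. apply is_derive_scal, is_derive_atan_lin.
  - intros x. rewrite <- Ez. set (z := sqrt c * ycoord c t x) in *. specialize (Hb x). fold z in Hb.
    replace (A ^ 2 / sqrt c * (sqrt c * / (1 + z ^ 2))) with (A ^ 2 * / (1 + z ^ 2)).
    2:{ assert (Hz := pow2_ge_0 z). field. split; lra. }
    rewrite <- (pow2_abs (g x)). assert (H0 := Rabs_pos (g x)). assert (K := inv_sq_le z).
    apply Rle_trans with (A ^ 2 * (/ (1 + Rabs z) * / (1 + Rabs z))); [|apply Rmult_le_compat_l; auto; apply pow2_ge_0].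
    replace (A ^ 2 * (/ (1 + Rabs z) * / (1 + Rabs z))) with ((A * / (1 + Rabs z)) ^ 2) by ring.
    apply pow_incr; auto.
  - intros x y _. rewrite <- Rmult_minus_distr_l, Rmult_comm.
    assert (0 <= A ^ 2 / sqrt c) by (apply Rdiv_le_0_compat; auto; apply pow2_ge_0).
    apply Rmult_le_compat_r; auto.
    assert (K1 := atan_le2 (sqrt c * x + b)). assert (K2 := atan_le2 (sqrt c * y + b)).
    apply Rabs_le_between in K1. apply Rabs_le_between in K2. lra.
  - split; auto. apply sq_le_reg.
    + apply Rmult_le_pos; [lra | left; apply exp_pos].
    + rewrite Rpow_mult_distr, Rpower_nat_mul. replace (- (1/4) * INR 2) with (- (1/2)) by (simpl; field).
      rewrite <- inv_sqrt_Rpower by lra. replace ((2 * A) ^ 2 * / sqrt c) with (4 * (A ^ 2 / sqrt c)) by (field; lra). auto.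
Qed.

(** * Estimates in terms of c *)

Section Estimates.
Context (p : nat) (hp : (p = 2 \/ p = 3 \/ p = 4)%nat) (Tb : table) (HTb : goodT p Tb) (k0 l0 : nat).
Let hp2 : (2 <= p)%nat := hp_ge2 p hp.
Let Tt : table := trunc k0 l0 Tb.
Let N : nat := S (k0 + l0).
Notation zc c t x := (sqrt c * ycoord c t x).
Notation yy c t x := (ycoord' p c (ashift Tb) k0 l0 t x).
Notation comp := (evalxt p Tb k0 l0).
Notation kappa c := (Rpower c (1 / (INR p - 1))).

Lemma q_cases : INR p - 1 = 1 \/ INR p - 1 = 2 \/ INR p - 1 = 3.
Proof.
  clear hp2. destruct hp as [E|[E|E]]; [left | right; left | right; right]; rewrite E; simpl; lra.
Qed.

(** One factor [Q_c] is enough to absorb, at its own scale, the powers of [z] left by the growth of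
    the coefficients. *)
Lemma Q_pow_decay k d : (1 <= k)%nat -> exists C, 0 < C /\ forall z, Q p z ^ k * (1 + Rabs z) ^ d <= C * / (1 + Rabs z).
Proof.
  intros Hk. destruct (Q_bounds p hp2) as [c1 [c2 [H1 [H2 H]]]].
  destruct (poly_exp_bound (S d)) as [C [HC HP]].
  exists (c2 ^ k * C). split; [apply Rmult_lt_0_compat; auto; apply pow_lt; auto|].
  intros z. assert (Hz := Rabs_pos z). specialize (H z). specialize (HP (Rabs z) Hz).
  assert (HQ := Q_pos p z). set (e := exp (- Rabs z)) in *.
  assert (He : 0 < e <= 1).
  { unfold e; split; [apply exp_pos|]. rewrite <- exp_0. apply exp_le; lra. }
  assert (Ee : e * exp (Rabs z) = 1) by (unfold e; rewrite <- exp_plus, Rplus_opp_l; apply exp_0).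
  assert (K1 : Q p z ^ k <= c2 ^ k * e).
  { apply Rle_trans with ((c2 * e) ^ k); [apply pow_incr; lra|]. rewrite Rpow_mult_distr.
    apply Rmult_le_compat_l; [apply pow_le; lra|].
    apply pow_le_self; auto; lra. }
  apply (Rmult_le_reg_r (1 + Rabs z)); [lra|].
  rewrite (Rmult_assoc (c2 ^ k * C)), Rinv_l, Rmult_1_r by lra.
  replace (Q p z ^ k * (1 + Rabs z) ^ d * (1 + Rabs z)) with (Q p z ^ k * (1 + Rabs z) ^ S d) by (simpl; ring).
  assert (P0 : 0 < (1 + Rabs z) ^ S d) by (apply pow_lt; lra).
  apply Rle_trans with (c2 ^ k * e * (C * exp (Rabs z))).
  - apply Rmult_le_compat; [left; apply pow_lt; auto | lra | auto | auto].
  - replace (c2 ^ k * e * (C * exp (Rabs z))) with (c2 ^ k * C * (e * exp (Rabs z))) by ring. rewrite Ee. lra.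
Qed.

Lemma kappa_le1 c : 0 < c < 1 -> 0 < kappa c <= 1.
Proof.
  intros Hc. split; [apply exp_pos|]. apply Rpower_le_1; auto.
  destruct q_cases as [E|[E|E]]; rewrite E; lra.
Qed.

Lemma Qc_pow_kappa c s k : (1 <= k)%nat -> 0 < c < 1 -> Qc p c s ^ k <= kappa c * Q p (sqrt c * s) ^ k.
Proof.
  intros Hk Hc. unfold Qc. rewrite Rpow_mult_distr. assert (K := kappa_le1 c Hc).
  apply Rmult_le_compat_r; [apply pow_le; left; apply Q_pos|].
  apply pow_le_self; auto; lra.
Qed.

(** Every term of [alpha'] contains a power of [Q_c], hence a factor [kappa c] and decay in
    [sqrt c * s]. The weight is again a derivative of [atan], ready for integration. *)
Lemma beta_bound : exists K, 0 < K /\ forall c s, 0 < c < 1 ->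
  Rabs (ev (betaT Tt) (Qc p c s) c) <= K * (kappa c * / (1 + (sqrt c * s) ^ 2)).
Proof.
  destruct (sum_bound_ex (X := R * R) (fun X => 0 < fst X < 1)
     (fun X => kappa (fst X) * / (1 + (sqrt (fst X) * snd X) ^ 2))
     (fun k X => sum_f_R0 (fun l => betaT Tt k l * (fst X) ^ l * Qc p (fst X) (snd X) ^ k) N) N) as [K [HK HB]].
  - intros [c s] Hc; simpl in *. apply Rmult_le_pos; [left; apply exp_pos|]. left; apply Rinv_0_lt_compat.
    assert (H := pow2_ge_0 (sqrt c * s)). simpl in H; lra.
  - intros k Hk. apply sum_bound_ex.
    + intros [c s] Hc; simpl in *. apply Rmult_le_pos; [left; apply exp_pos|]. left; apply Rinv_0_lt_compat.
      assert (H := pow2_ge_0 (sqrt c * s)). simpl in H; lra.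
    + intros l Hl. destruct k as [|k].
      * exists 0. split; [lra|]. intros X HX. simpl betaT. rewrite !Rmult_0_l, Rabs_R0. lra.
      * destruct (Q_pow_decay (S k) 1 ltac:(lia)) as [C [HC HQ]].
        exists (Rabs (betaT Tt (S k) l) * C). split; [apply Rmult_le_pos; [apply Rabs_pos | lra]|].
        intros [c s] Hc; cbv [fst snd] in *. rewrite !Rabs_mult, !Rmult_assoc.
        apply Rmult_le_compat_l; [apply Rabs_pos|].
        assert (P1 : 0 < Qc p c s ^ S k) by (apply pow_lt, Rmult_lt_0_compat; [apply exp_pos | apply Q_pos]).
        assert (P2 : 0 < c ^ l <= 1) by (split; [apply pow_lt; lra | rewrite <- (pow1 l); apply pow_incr; lra]).
        rewrite (Rabs_pos_eq (c ^ l)), (Rabs_pos_eq (Qc p c s ^ S k)) by lra.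
        apply Rle_trans with (1 * Qc p c s ^ S k); [apply Rmult_le_compat_r; lra|]. rewrite Rmult_1_l.
        eapply Rle_trans; [apply Qc_pow_kappa; auto; lia|].
        rewrite (Rmult_comm C), Rmult_assoc. apply Rmult_le_compat_l; [left; apply exp_pos|].
        set (z := sqrt c * s). specialize (HQ z). rewrite pow_1 in HQ. assert (Hz := Rabs_pos z).
        apply Rle_trans with (C * (/ (1 + Rabs z) * / (1 + Rabs z))).
        -- apply (Rmult_le_reg_r (1 + Rabs z)); [lra|]. eapply Rle_trans; [apply HQ|].
           apply Req_le. field. lra.
        -- rewrite (Rmult_comm _ C). apply Rmult_le_compat_l; [lra | apply inv_sq_le].
  - exists (K + 1). split; [lra|]. intros c s Hc. rewrite (ev_eq N) by exact (fin_betaT p hp Tb k0 l0). rewrite ev2_expand.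
    eapply Rle_trans; [apply (HB (c, s)); auto|]. cbv [fst snd]. apply Rmult_le_compat_r; [|lra].
    apply Rmult_le_pos; [left; apply exp_pos|]. left; apply Rinv_0_lt_compat.
    assert (H := pow2_ge_0 (sqrt c * s)). lra.
Qed.

Lemma alpha_0 c : alpha p c (ashift Tb) k0 l0 0 = 0.
Proof.
  unfold alpha. rewrite (sigma0_sum _ _ _ N) by (unfold N; lia).
  apply sum_zero; intros k Hk. apply sum_zero; intros l Hl. destruct (inbox k0 l0 k l); auto.
  change (RInt (fun s' => Qc p c s' ^ k) 0 0) with (prim (fun s' => Qc p c s' ^ k) 0). rewrite prim_0. ring.
Qed.

(** Integrating the bound on [alpha'] leaves the width [/ sqrt c] of the small soliton. The factor
    [kappa c] is given away, since [/ sqrt c] is already below [Tc c]. *)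
Lemma alpha_bound : exists K, 0 < K /\ forall c s, 0 < c < 1 ->
  Rabs (alpha p c (ashift Tb) k0 l0 s) <= K * / sqrt c.
Proof.
  destruct beta_bound as [K [HK HB]]. exists (4 * K). split; [lra|]. intros c s Hc.
  assert (Hs : 0 < sqrt c) by (apply sqrt_lt_R0; lra). assert (Hk := kappa_le1 c Hc).
  assert (H := dominated_increment (alpha p c (ashift Tb) k0 l0) (fun s => ev (betaT Tt) (Qc p c s) c)
    (fun s => (K / sqrt c) * atan (sqrt c * s + 0)) (fun s => (K / sqrt c) * (sqrt c * / (1 + (sqrt c * s + 0) ^ 2)))).
  assert (H' : Rabs (alpha p c (ashift Tb) k0 l0 s - alpha p c (ashift Tb) k0 l0 0) <=
     Rabs (K / sqrt c * atan (sqrt c * s + 0) - K / sqrt c * atan (sqrt c * 0 + 0))).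
  { apply H.
    - intros x; apply (is_derive_alpha p hp).
    - intros x. apply is_derive_scal, is_derive_atan_lin.
    - intros x. eapply Rle_trans; [apply HB; auto|]. rewrite Rplus_0_r.
      assert (Hz := pow2_ge_0 (sqrt c * x)).
      replace (K / sqrt c * (sqrt c * / (1 + (sqrt c * x) ^ 2))) with (K * (1 * / (1 + (sqrt c * x) ^ 2))) by (field; split; lra).
      apply Rmult_le_compat_l; [lra|]. apply Rmult_le_compat_r; [left; apply Rinv_0_lt_compat; lra | lra]. }
  rewrite alpha_0, Rminus_0_r in H'. eapply Rle_trans; [apply H'|].
  rewrite <- Rmult_minus_distr_l, Rabs_mult.
  assert (Hp : 0 < / sqrt c) by (apply Rinv_0_lt_compat; auto).
  rewrite (Rabs_pos_eq (K / sqrt c)) by (unfold Rdiv; nra).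
  assert (A1 := atan_le2 (sqrt c * s + 0)). assert (A2 := atan_le2 (sqrt c * 0 + 0)).
  assert (Rabs (atan (sqrt c * s + 0) - atan (sqrt c * 0 + 0)) <= 4).
  { eapply Rle_trans; [apply Rabs_triang|]. rewrite Rabs_Ropp. lra. }
  replace (4 * K * / sqrt c) with (K / sqrt c * 4) by (unfold Rdiv; ring).
  apply Rmult_le_compat_l; auto. unfold Rdiv; nra.
Qed.

Lemma Tc_ge1 c : 0 < c < 1 -> 1 <= Tc c.
Proof. intros Hc. apply Rpower_ge_1; auto; lra. Qed.

Lemma inv_sqrt_le_Tc c : 0 < c < 1 -> / sqrt c <= Tc c.
Proof. intros Hc. rewrite inv_sqrt_Rpower by lra. apply Rpower_le_exp; auto; lra. Qed.

(** [y = y_c - (1 - c) t - alpha], with [y_c = z / sqrt c]. The term [Rabs t] is kept apart because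
    the qualitative statement concerns all times. *)
Lemma y_bound : exists K, 0 < K /\ forall c t x, 0 < c < 1 ->
  1 + Rabs (yy c t x) <= K * (Tc c + Rabs t) * (1 + Rabs (zc c t x)).
Proof.
  destruct alpha_bound as [K [HK HB]]. exists (K + 1). split; [lra|]. intros c t x Hc.
  assert (Hs : 0 < sqrt c) by (apply sqrt_lt_R0; lra).
  assert (T1 := Tc_ge1 c Hc). assert (T2 := inv_sqrt_le_Tc c Hc). assert (Ht := Rabs_pos t).
  set (s := ycoord c t x). specialize (HB c s Hc).
  assert (E : yy c t x = s + - ((1 - c) * t) + - alpha p c (ashift Tb) k0 l0 s).
  { unfold ycoord'. fold s. unfold s at 2, ycoord. ring. }
  assert (Ez : Rabs s = Rabs (sqrt c * s) * / sqrt c).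
  { rewrite Rabs_mult, (Rabs_pos_eq (sqrt c)) by lra. field. lra. }
  assert (Hz := Rabs_pos (sqrt c * s)). assert (Hi : 0 < / sqrt c) by (apply Rinv_0_lt_compat; auto).
  assert (B1 : Rabs (yy c t x) <= Rabs s + Rabs t + K * / sqrt c).
  { rewrite E. eapply Rle_trans; [apply Rabs_triang|]. rewrite Rabs_Ropp. apply Rplus_le_compat; auto.
    eapply Rle_trans; [apply Rabs_triang|]. rewrite Rabs_Ropp, Rabs_mult, (Rabs_pos_eq (1 - c)) by lra. nra. }
  rewrite Ez in B1. fold s. set (Z := Rabs (sqrt c * s)) in *.
  assert (Z * / sqrt c <= Z * Tc c) by (apply Rmult_le_compat_l; auto).
  assert (K * / sqrt c <= K * Tc c) by (apply Rmult_le_compat_l; lra).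
  assert (0 <= K * Tc c * Z) by (repeat apply Rmult_le_pos; lra).
  assert (0 <= Rabs t * Z) by (apply Rmult_le_pos; lra).
  assert (0 <= K * Rabs t * Z) by (repeat apply Rmult_le_pos; lra).
  assert (0 <= K * Rabs t) by (apply Rmult_le_pos; lra).
  nra.
Qed.

(** Power of [c] gained from a factor [rho], which is at most [sqrt c]. *)
Definition half (e : bool) : R := if e then 1/2 else 0.
Definition rpow (e : bool) (r : R) : R := if e then r else 1.

Lemma rho_bound c s e : 0 < c < 1 -> Rabs (rpow e (rho p c s)) <= Rpower c (half e).
Proof.
  intros Hc. destruct e; simpl.
  - rewrite Rpower_half by lra. unfold rho. rewrite Rabs_Ropp, Rabs_mult.
    assert (H := T_abs p (sqrt c * s)). assert (K := sqrt_pos c). rewrite (Rabs_pos_eq (sqrt c)) by auto. nra.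
  - rewrite Rpower_O by lra. rewrite Rabs_R1; lra.
Qed.

Lemma term_bound e k l n f : (1 <= k)%nat -> Pol n f -> exists K, 0 <= K /\ forall c t x, 0 < c < 1 ->
  Rabs (f (yy c t x) * c ^ l * Qc p c (ycoord c t x) ^ k * rpow e (rho p c (ycoord c t x))) <=
  K * (Rpower c (INR l + INR k / (INR p - 1) + half e) * (Tc c + Rabs t) ^ pred n * / (1 + Rabs (zc c t x))).
Proof.
  intros Hk Hf. destruct (Pol_bound n f Hf) as [C [HC HB]]. destruct y_bound as [Ky [HKy Hy]].
  set (d := pred n) in *. destruct (Q_pow_decay k d Hk) as [D [HD HQ]].
  exists (C * Ky ^ d * D). assert (Kp : 0 < Ky ^ d) by (apply pow_lt; auto). split; [repeat apply Rmult_le_pos; lra|].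
  intros c t x Hc. set (s := ycoord c t x) in *. set (y := yy c t x) in *. set (z := sqrt c * s) in *.
  specialize (Hy c t x Hc). fold y s z in Hy. specialize (HB y). specialize (HQ z).
  assert (T1 := Tc_ge1 c Hc). assert (Ht := Rabs_pos t). assert (Hz := Rabs_pos z).
  assert (Hr := rho_bound c s e Hc).
  assert (P1 : 0 < c ^ l) by (apply pow_lt; lra).
  assert (P2 : 0 < Qc p c s ^ k) by (apply pow_lt, Rmult_lt_0_compat; [apply exp_pos | apply Q_pos]).
  rewrite !Rabs_mult, (Rabs_pos_eq (c ^ l)), (Rabs_pos_eq (Qc p c s ^ k)) by lra.
  set (B := (Tc c + Rabs t) ^ d). assert (PB : 0 < B) by (apply pow_lt; lra).
  assert (HF : Rabs (f y) <= C * Ky ^ d * B * (1 + Rabs z) ^ d).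
  { eapply Rle_trans; [apply HB|]. rewrite !Rmult_assoc. apply Rmult_le_compat_l; [lra|].
    unfold B. rewrite <- !Rpow_mult_distr. apply pow_incr. split; [assert (H := Rabs_pos y); lra|].
    rewrite <- Rmult_assoc. exact Hy. }
  assert (EQ : Qc p c s ^ k = Rpower c (INR k / (INR p - 1)) * Q p z ^ k).
  { unfold Qc. rewrite Rpow_mult_distr, Rpower_nat_mul. f_equal. f_equal.
    field. destruct q_cases as [E|[E|E]]; rewrite E; lra. }
  rewrite EQ, <- (Rpower_pow l c), !Rpower_plus by lra.
  assert (P3 : 0 < Q p z ^ k) by (apply pow_lt, Q_pos).
  set (r1 := Rpower c (INR l)). set (r2 := Rpower c (INR k / (INR p - 1))). set (r3 := Rpower c (half e)) in *.
  assert (R1 : 0 < r1) by apply exp_pos. assert (R2 : 0 < r2) by apply exp_pos. assert (R3 : 0 < r3) by apply exp_pos.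
  apply Rle_trans with ((C * Ky ^ d * B * (1 + Rabs z) ^ d) * (r1 * (r2 * Q p z ^ k)) * r3).
  - rewrite (Rmult_assoc (Rabs (f y))). apply Rmult_le_compat; auto using Rabs_pos.
    + apply Rmult_le_pos; [apply Rabs_pos|]. repeat apply Rmult_le_pos; lra.
    + apply Rmult_le_compat_r; auto. repeat apply Rmult_le_pos; lra.
  - replace ((C * Ky ^ d * B * (1 + Rabs z) ^ d) * (r1 * (r2 * Q p z ^ k)) * r3)
      with ((C * Ky ^ d * B * r1 * r2 * r3) * (Q p z ^ k * (1 + Rabs z) ^ d)) by ring.
    replace (C * Ky ^ d * D * (r1 * r2 * r3 * B * / (1 + Rabs z)))
      with ((C * Ky ^ d * B * r1 * r2 * r3) * (D * / (1 + Rabs z))) by ring.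
    apply Rmult_le_compat_l; auto. repeat apply Rmult_le_pos; lra.
Qed.

Lemma Ev_expand M f c x r y : finF M f -> Ev c f x r y =
  sum_f_R0 (fun k => sum_f_R0 (fun l => f false k l y * c ^ l * x ^ k * rpow false r) M) M +
  sum_f_R0 (fun k => sum_f_R0 (fun l => f true k l y * c ^ l * x ^ k * rpow true r) M) M.
Proof.
  intros F. unfold Ev. rewrite !(ev_eq M) by apply F. rewrite !ev2_expand. f_equal.
  - apply sum_eq; intros k Hk. apply sum_eq; intros l Hl. simpl. ring.
  - rewrite scal_sum. apply sum_eq; intros k Hk. rewrite (Rmult_comm _ r), scal_sum. apply sum_eq; intros l Hl. simpl. ring.
Qed.

(** The domain [D] and the gauge [g] are free: the uniform estimates take times up to [Tc c], the
    qualitative one a single pair [(c, t)]. *)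
Lemma class_bound (D : R * R * R -> Prop) (g : R * R * R -> R) M f : finF M f ->
  (forall X, D X -> 0 < fst (fst X) < 1) -> (forall X, D X -> 0 <= g X) ->
  (forall e k l, (forall y, f e k l y = 0) \/ exists n, Pol n (f e k l) /\ (1 <= k)%nat /\
     exists K, 0 <= K /\ forall c t x, D (c, t, x) ->
     Rpower c (INR l + INR k / (INR p - 1) + half e) * (Tc c + Rabs t) ^ pred n * / (1 + Rabs (zc c t x)) <= K * g (c, t, x)) ->
  exists K, 0 <= K /\ forall c t x, D (c, t, x) -> Rabs (comp c f t x) <= K * g (c, t, x).
Proof.
  intros F HD Hg H.
  assert (S : forall e, exists K, 0 <= K /\ forall X, D X -> Rabs (sum_f_R0 (fun k => sum_f_R0 (fun l =>
     f e k l (yy (fst (fst X)) (snd (fst X)) (snd X)) * fst (fst X) ^ l * Qc p (fst (fst X)) (ycoord (fst (fst X)) (snd (fst X)) (snd X)) ^ k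
       * rpow e (rho p (fst (fst X)) (ycoord (fst (fst X)) (snd (fst X)) (snd X)))) M) M) <= K * g X).
  { intros e. apply (sum_bound_ex D g (fun k X => sum_f_R0 (fun l =>
     f e k l (yy (fst (fst X)) (snd (fst X)) (snd X)) * fst (fst X) ^ l * Qc p (fst (fst X)) (ycoord (fst (fst X)) (snd (fst X)) (snd X)) ^ k
       * rpow e (rho p (fst (fst X)) (ycoord (fst (fst X)) (snd (fst X)) (snd X)))) M)); auto.
    intros k Hk. apply (sum_bound_ex D g (fun l X =>
     f e k l (yy (fst (fst X)) (snd (fst X)) (snd X)) * fst (fst X) ^ l * Qc p (fst (fst X)) (ycoord (fst (fst X)) (snd (fst X)) (snd X)) ^ k
       * rpow e (rho p (fst (fst X)) (ycoord (fst (fst X)) (snd (fst X)) (snd X))))); auto.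
    intros l Hl. destruct (H e k l) as [H0|[n [Hn [Hk1 [K [HK HB]]]]]].
    - exists 0. split; [lra|]. intros X HX. rewrite H0, !Rmult_0_l, Rabs_R0. lra.
    - destruct (term_bound e k l n _ Hk1 Hn) as [K' [HK' HB']]. exists (K' * K). split; [apply Rmult_le_pos; auto|].
      intros [[c t] x] HX. cbv [fst snd]. specialize (HB' c t x (HD _ HX)). specialize (HB c t x HX).
      eapply Rle_trans; [apply HB'|]. rewrite (Rmult_assoc K' K). apply Rmult_le_compat_l; auto. }
  destruct (S false) as [K1 [P1 H1]]. destruct (S true) as [K2 [P2 H2]].
  exists (K1 + K2). split; [lra|]. intros c t x HX. unfold evalxt. rewrite (Ev_expand M) by auto.
  eapply Rle_trans; [apply Rabs_triang|]. specialize (H1 _ HX). specialize (H2 _ HX). cbv [fst snd] in H1, H2. lra.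
Qed.

Definition Dom (X : R * R * R) : Prop := 0 < fst (fst X) < 1 /\ Rabs (snd (fst X)) <= Tc (fst (fst X)).

(** Each degree in [y] costs [Tc c + Rabs t <= 2 * Tc c]; 51/100 is the exponent [1/2 + 1/100] of
    [Tc]. *)
Lemma class_bound_theta theta M f m : finF M f -> cls p m f ->
  (forall e k l, (forall y, f e k l y = 0) \/ ((1 <= k)%nat /\
     theta <= INR l + INR k / (INR p - 1) + half e - (51/100) * INR (pred (deg p m (wt p k l))))) ->
  exists K, 0 < K /\ forall c t x, 0 < c < 1 -> Rabs t <= Tc c ->
    Rabs (comp c f t x) <= K * Rpower c theta * / (1 + Rabs (zc c t x)).
Proof.
  intros F C H.
  destruct (class_bound Dom (fun X => Rpower (fst (fst X)) theta * / (1 + Rabs (zc (fst (fst X)) (snd (fst X)) (snd X)))) M f F)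
    as [K [HK HB]].
  - intros [[c t] x] [H1 H2]; auto.
  - intros [[c t] x] _. apply Rmult_le_pos; [left; apply exp_pos|]. left; apply Rinv_0_lt_compat.
    cbv [fst snd]. assert (Hz := Rabs_pos (zc c t x)); lra.
  - intros e k l. destruct (H e k l) as [H0|[Hk Ht]]; [left; auto | right].
    exists (deg p m (wt p k l)). split; [apply C|]. split; auto. set (d := pred (deg p m (wt p k l))) in *.
    exists (2 ^ d). split; [left; apply pow_lt; lra|]. intros c t x [Hc Htt]. cbv [fst snd] in *.
    rewrite <- Rmult_assoc. apply Rmult_le_compat_r.
    { left; apply Rinv_0_lt_compat. assert (Hz := Rabs_pos (zc c t x)); lra. }
    assert (T1 := Tc_ge1 c Hc). assert (T2 := Rabs_pos t).
    apply Rle_trans with (Rpower c (INR l + INR k / (INR p - 1) + half e) * (2 ^ d * Tc c ^ d)).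
    + apply Rmult_le_compat_l; [left; apply exp_pos|]. rewrite <- Rpow_mult_distr. apply pow_incr; lra.
    + unfold Tc. rewrite Rpower_nat_mul.
      replace (Rpower c (INR l + INR k / (INR p - 1) + half e) * (2 ^ d * Rpower c ((- (1/2) - 1/100) * INR d)))
        with (2 ^ d * (Rpower c (INR l + INR k / (INR p - 1) + half e) * Rpower c ((- (1/2) - 1/100) * INR d))) by ring.
      rewrite <- Rpower_plus. apply Rmult_le_compat_l; [left; apply pow_lt; lra|]. apply Rpower_le_exp; auto. lra.
  - exists (K + 1). split; [lra|]. intros c t x Hc Ht. rewrite Rmult_assoc.
    eapply Rle_trans; [apply (HB c t x); split; auto|]. cbv [fst snd]. apply Rmult_le_compat_r; [|lra].
    apply Rmult_le_pos; [left; apply exp_pos|]. left; apply Rinv_0_lt_compat.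
    assert (Hz := Rabs_pos (zc c t x)); lra.
Qed.

(** [deg] decreases with [m], so class 1 is the worst case; there the degree is the integer part of
    [l + (k - 1) / (p - 1)]. *)
Lemma deg_bound m k l : (1 <= m)%nat -> (1 <= k)%nat -> INR (pred (deg p m (wt p k l))) * (INR p - 1) <= (INR p - 1) * INR l + INR k - 1.
Proof.
  intros Hm Hk. assert (E : INR p - 1 = INR (p - 1)) by (rewrite minus_INR by lia; reflexivity).
  rewrite E, <- !mult_INR. replace (INR ((p - 1) * l) + INR k - 1) with (INR ((p - 1) * l + k - 1)).
  2:{ rewrite minus_INR, plus_INR by lia. reflexivity. }
  apply le_INR. fold (wt p k l).
  assert (K1 := deg_anti p hp2 1 m (wt p k l) Hm). rewrite (deg_S p hp2) in K1 by (unfold wt; lia).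
  assert (K2 : (deg p p (wt p k l) * (p - 1) <= wt p k l - 1)%nat).
  { unfold deg. rewrite Nat.mul_comm. eapply Nat.le_trans; [apply Nat.Div0.mul_div_le|]. lia. }
  nia.
Qed.

Lemma comp_Cont c t M f m : 0 < c < 1 -> finF M f -> cls p m f -> Cont (comp c f t).
Proof.
  intros Hc F C x. apply ex_derive_continuous_R. eexists. apply (comp_dx p hp Tb k0 l0 c Hc M); auto.
  exact (cls_ex p _ _ C).
Qed.

Lemma L2_theta theta M f m : finF M f -> cls p m f ->
  (forall e k l, (forall y, f e k l y = 0) \/ ((1 <= k)%nat /\
     theta + 1/4 <= INR l + INR k / (INR p - 1) + half e - (51/100) * INR (pred (deg p m (wt p k l))))) ->
  exists K, 0 < K /\ forall c t, 0 < c < 1 -> Rabs t <= Tc c ->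
    is_L2 (comp c f t) /\ L2norm (comp c f t) <= K * Rpower c theta.
Proof.
  intros F C H. destruct (class_bound_theta (theta + 1/4) M f m F C H) as [K [HK HB]].
  exists (2 * K). split; [lra|]. intros c t Hc Ht.
  destruct (L2_of_bound c t (comp c f t) (K * Rpower c (theta + 1/4)) Hc) as [H1 H2].
  - eapply comp_Cont; eauto.
  - intros x. apply HB; auto.
  - split; auto. eapply Rle_trans; [apply H2|]. apply Req_le.
    replace (2 * (K * Rpower c (theta + 1/4)) * Rpower c (- (1/4)))
      with (2 * K * (Rpower c (theta + 1/4) * Rpower c (- (1/4)))) by ring.
    rewrite <- Rpower_plus. f_equal. f_equal. field.
Qed.

End Estimates.

(** * Norms of the residual and of the correction *)

Section Norms.
Context (p : nat) (hp : (p = 2 \/ p = 3 \/ p = 4)%nat) (Tb : table) (k0 l0 : nat).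
Let hp2 : (2 <= p)%nat := hp_ge2 p hp.
Let Tt : table := trunc k0 l0 Tb.
Notation zc c t x := (sqrt c * ycoord c t x).
Notation yy c t x := (ycoord' p c (ashift Tb) k0 l0 t x).
Notation comp := (evalxt p Tb k0 l0).
Notation kappa c := (Rpower c (1 / (INR p - 1))).

(** As [d <= l + (k - 1)/(p - 1)], the right side is at least [49/100 (l + k/(p - 1)) + 51/100 / (p
    - 1)]. If [k >= k0 + 1] this is at least [49/100 k0/(p - 1) + 1/(p - 1)]; if [l >= l0 + 1], then
    [k >= 1] gives [49/100 (1 + l0) + 1/(p - 1)]. In both cases [1/(p - 1) >= 1/4] pays for the [L2]
    norm. *)
Lemma exponent_S k l e (d : R) : (1 <= k)%nat -> (k0 < k \/ l0 < l)%nat ->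
  d * (INR p - 1) <= (INR p - 1) * INR l + INR k - 1 ->
  (1/2 - 1/100) * Rmin (INR k0 / (INR p - 1)) (1 + INR l0) + 1/4 <= INR l + INR k / (INR p - 1) + half e - 51/100 * d.
Proof.
  intros Hk Hkl Hd. assert (He : 0 <= half e) by (destruct e; simpl; lra).
  assert (Hk' : 1 <= INR k) by (change 1 with (INR 1); apply le_INR; auto).
  assert (Hl' := pos_INR l). assert (Hl0 := pos_INR l0). assert (Hk0 := pos_INR k0).
  assert (M1 := Rmin_l (INR k0 / (INR p - 1)) (1 + INR l0)).
  assert (M2 := Rmin_r (INR k0 / (INR p - 1)) (1 + INR l0)).
  set (mn := Rmin (INR k0 / (INR p - 1)) (1 + INR l0)) in *. clearbody mn.
  assert (H : INR k0 + 1 <= INR k \/ INR l0 + 1 <= INR l).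
  { destruct Hkl as [H|H]; [left | right]; rewrite <- S_INR; apply le_INR; lia. }
  destruct (q_cases p hp) as [E|[E|E]]; rewrite E in *; destruct H; lra.
Qed.

(** The excess over [1/(p - 1)] is at least [l + (k - 1)/(p - 1) - 51/100 d], plus 1/2 from a factor
    [rho]. It is at least [49/100] when [d >= 1], and otherwise at least 1/3 except at
    [(k, l) = (1, 0)], where only the term with [rho] keeps a margin of 1/4. *)
Lemma exponent_w k l e (d : nat) : (1 <= k)%nat -> (e, k, l) <> (false, 1%nat, 0%nat) ->
  INR d * (INR p - 1) <= (INR p - 1) * INR l + INR k - 1 ->
  1 / (INR p - 1) + 1/4 <= INR l + INR k / (INR p - 1) + half e - 51/100 * INR d.
Proof.
  intros Hk Hn Hd. assert (He : 0 <= half e) by (destruct e; simpl; lra).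
  assert (Hk' : 1 <= INR k) by (change 1 with (INR 1); apply le_INR; auto).
  assert (Hq := q_cases p hp).
  destruct l as [|l].
  - destruct d as [|d].
    + destruct (Nat.eq_dec k 1) as [->|Hk1].
      * destruct e; [|congruence]. simpl in *. destruct Hq as [E|[E|E]]; rewrite E in *; lra.
      * assert (Hk2 : 2 <= INR k) by (change 2 with (INR 2); apply le_INR; lia). simpl in *.
        destruct Hq as [E|[E|E]]; rewrite E in *; lra.
    + assert (Hdd := pos_INR d). rewrite S_INR in *. simpl INR in Hd at 2. simpl INR at 1.
      destruct Hq as [E|[E|E]]; rewrite E in *; simpl in *; lra.
  - assert (Hll := pos_INR l). rewrite (S_INR l) in *. destruct Hq as [E|[E|E]]; rewrite E in *; lra.
Qed.

Definition at_10 (e : bool) (k l : nat) : bool := (negb e && ((k =? 1) && (l =? 0)))%bool.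
Definition single (g : fam) : fam := fun e k l y => if at_10 e k l then g e k l y else 0.
Definition rest (g : fam) : fam := fun e k l y => if at_10 e k l then 0 else g e k l y.

Lemma at_10_spec e k l : at_10 e k l = true <-> (e, k, l) = (false, 1%nat, 0%nat).
Proof.
  unfold at_10. rewrite !andb_true_iff, negb_true_iff, !Nat.eqb_eq. split.
  - intros [-> [-> ->]]; auto.
  - intros E; injection E; auto.
Qed.

Lemma finF_rest M g : finF M g -> finF M (rest g).
Proof. intros F e y k l H. unfold rest. destruct (at_10 e k l); auto. apply (F e y k l H). Qed.

Lemma finF_single g : finF 1 (single g).
Proof.
  intros e y k l H. unfold single. destruct (at_10 e k l) eqn:E; auto. apply at_10_spec in E. injection E; lia.
Qed.

Lemma cls_rest m g : cls p m g -> cls p m (rest g).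
Proof. intros C e k l. unfold rest. destruct (at_10 e k l); [apply Pol_zero | apply C]. Qed.

Lemma Ev_rest c M g x r y : finF M g -> Ev c g x r y = x * g false 1%nat 0%nat y + Ev c (rest g) x r y.
Proof.
  intros F. replace g with (fadd (single g) (rest g)) at 1.
  - rewrite (Ev_fadd c (S M)).
    + f_equal. unfold Ev. rewrite !(ev_eq 1) by apply finF_single. unfold ev2, single, at_10. simpl. ring.
    + apply (finF_mono 1); [lia | apply finF_single].
    + apply (finF_mono M); [lia | apply finF_rest; auto].
  - do 4 (apply functional_extensionality; intros ?). unfold fadd, single, rest.
    destruct (at_10 _ _ _); ring.
Qed.

(* The coefficient of index (1,0) is localized near the large soliton, so no power of [c] is lost
   in its [L2] norm.  Since [y] need not be monotone in [x], the weight [1/(1+y^2)] is integrated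
   through [1 <= 2 (1 - beta) + 4 beta^2], where [1 - beta] is the derivative of [y]. *)
Lemma L2_localized M g : finF M g -> cls p 1 g -> (forall e l y, g e 0%nat l y = 0) -> Loc (g false 1%nat 0%nat) ->
  exists K, 0 < K /\ forall c t, 0 < c < 1 -> Rabs t <= Tc c ->
    is_L2 (comp c g t) /\ L2norm (comp c g t) <= K * kappa c.
Proof.
  intros F C Z0 L10.
  set (theta := 1 / (INR p - 1) + 1/4).
  destruct (class_bound_theta p hp Tb k0 l0 theta M (rest g) 1 (finF_rest M g F) (cls_rest 1 g C)) as [K2 [HK2 HB2]].
  { intros e k l. unfold rest. destruct (at_10 e k l) eqn:E; [left; auto|].
    destruct k as [|k]; [left; intros; apply Z0 | right]. split; [lia|].
    apply exponent_w; [lia | | apply (deg_bound p hp k0 l0); lia].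
    intros E'. apply at_10_spec in E'. congruence. }
  destruct (Loc_bound _ L10) as [C0 [HC0 HB0]]. destruct (beta_bound p hp Tb k0 l0) as [Kb [HKb HBb]].
  destruct (Q_bounds p hp2) as [cq0 [cq [Hcq0 [Hcq HQ]]]].
  set (C1 := cq * C0). assert (HC1 : 0 < C1) by (unfold C1; nra).
  set (W0 := 8 * C1 ^ 2 * Kb ^ 2 + 2 * K2 ^ 2). set (B := 16 * C1 ^ 2 + 4 * W0).
  assert (HW0 : 0 <= W0) by (unfold W0; nra). assert (HB : 0 <= B) by (unfold B; nra).
  exists (1 + B). split; [lra|]. intros c t Hc Ht.
  assert (Hs : 0 < sqrt c) by (apply sqrt_lt_R0; lra). assert (Hkap := kappa_le1 p hp c Hc).
  set (ka := kappa c) in *.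
  (* [W] collects what is integrated against the weight in [z]: the remainder, and the term in
     [beta^2]. The division by [sqrt c] is compensated by the 1/4 in [theta] for the former, and by
     [ka ^ 2 <= sqrt c] for the latter. *)
  set (W := (8 * ka ^ 2 * C1 ^ 2 * (Kb ^ 2 * ka ^ 2) + 2 * K2 ^ 2 * Rpower c theta ^ 2) / sqrt c).
  assert (HW : 0 <= W <= ka ^ 2 * W0).
  { assert (P0 := exp_pos (theta * ln c)). fold (Rpower c theta) in P0.
    assert (HWW : W = 8 * ka ^ 2 * C1 ^ 2 * Kb ^ 2 * (ka ^ 2 * / sqrt c) + 2 * K2 ^ 2 * (Rpower c theta ^ 2 * / sqrt c)).
    { unfold W. field. lra. }
    assert (H1 : Rpower c theta ^ 2 * / sqrt c = ka ^ 2).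
    { unfold ka, theta. rewrite inv_sqrt_Rpower, !Rpower_nat_mul by lra. rewrite <- Rpower_plus. f_equal. simpl. field.
      destruct (q_cases p hp) as [E|[E|E]]; rewrite E; lra. }
    assert (H2 : 0 <= ka ^ 2 * / sqrt c <= 1).
    { split; [left; apply Rmult_lt_0_compat; [nra | apply Rinv_0_lt_compat; auto]|].
      unfold ka. rewrite inv_sqrt_Rpower, Rpower_nat_mul by lra. rewrite <- Rpower_plus. apply Rpower_le_1; auto.
      simpl. destruct (q_cases p hp) as [E|[E|E]]; rewrite E; lra. }
    rewrite HWW, H1. assert (P1 : 0 <= 8 * ka ^ 2 * C1 ^ 2 * Kb ^ 2) by (repeat apply Rmult_le_pos; nra).
    assert (P2 : 0 <= K2 ^ 2 * ka ^ 2) by (apply Rmult_le_pos; nra). unfold W0. split; nra. }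
  set (b0 := sqrt c * ((1 - c) * t)).
  assert (Ez : forall x, zc c t x = sqrt c * x + b0) by (intros; unfold ycoord, b0; ring).
  set (be := fun x => ev (betaT Tt) (Qc p c (ycoord c t x)) c).
  destruct (L2_criterion (comp c g t)
     (fun x => 4 * ka ^ 2 * C1 ^ 2 * ((1 - be x) * / (1 + yy c t x ^ 2)) + W * (sqrt c * / (1 + (sqrt c * x + b0) ^ 2)))
     (fun x => 4 * ka ^ 2 * C1 ^ 2 * atan (yy c t x) + W * atan (sqrt c * x + b0))
     (ka ^ 2 * B)) as [R1 R2].
  - eapply (comp_Cont p hp); eauto.
  - intros x. apply is_derive_plus_R; apply is_derive_scal; [|apply is_derive_atan_lin].
    assert (D := is_derive_atan (yy c t x)). rewrite Rsqr_pow2 in D.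
    apply (is_derive_comp atan (fun x => yy c t x)); auto. apply (is_derive_ycoord' p hp).
  - intros x. rewrite <- Ez. unfold evalxt. rewrite (Ev_rest c M) by auto.
    set (v := Ev c (rest g) (Qc p c (ycoord c t x)) (rho p c (ycoord c t x)) (yy c t x)).
    assert (Hv : Rabs v <= K2 * Rpower c theta * / (1 + Rabs (zc c t x))) by (apply HB2; auto).
    specialize (HBb c (ycoord c t x) Hc). fold Tt (be x) in HBb. fold ka in HBb.
    set (z := zc c t x) in *. set (y := yy c t x) in *. set (s := ycoord c t x) in *.
    set (u := Qc p c s * g false 1%nat 0%nat y).
    set (iy := / (1 + y ^ 2)). set (iz := / (1 + z ^ 2)) in *.
    assert (Hy2 := pow2_ge_0 y). assert (Hz2 := pow2_ge_0 z).
    assert (Iy : 0 < iy <= 1).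
    { unfold iy; split; [apply Rinv_0_lt_compat; lra | rewrite <- Rinv_1; apply Rinv_le_contravar; lra]. }
    assert (Iz : 0 < iz <= 1).
    { unfold iz; split; [apply Rinv_0_lt_compat; lra | rewrite <- Rinv_1; apply Rinv_le_contravar; lra]. }
    assert (Hu : Rabs u <= ka * C1 * iy).
    { unfold u. rewrite Rabs_mult. assert (PQ := Q_pos p z). specialize (HQ z).
      assert (He : exp (- Rabs z) <= 1) by (rewrite <- exp_0; apply exp_le; assert (H := Rabs_pos z); lra).
      assert (HR : Rabs (Qc p c s) <= ka * cq).
      { unfold Qc. fold ka z. rewrite Rabs_pos_eq by nra. apply Rmult_le_compat_l; nra. }
      unfold C1. replace (ka * (cq * C0) * iy) with ((ka * cq) * (C0 * iy)) by ring.
      apply Rmult_le_compat; auto using Rabs_pos. }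
    assert (Hu2 : u ^ 2 <= ka ^ 2 * C1 ^ 2 * iy).
    { rewrite <- (pow2_abs u). apply Rle_trans with ((ka * C1 * iy) ^ 2); [apply pow_incr; split; [apply Rabs_pos | auto]|].
      replace ((ka * C1 * iy) ^ 2) with (ka ^ 2 * C1 ^ 2 * (iy * iy)) by ring.
      apply Rmult_le_compat_l; [apply Rmult_le_pos; apply pow2_ge_0 | nra]. }
    assert (Hv2 : v ^ 2 <= K2 ^ 2 * Rpower c theta ^ 2 * iz).
    { rewrite <- (pow2_abs v). apply Rle_trans with ((K2 * Rpower c theta * / (1 + Rabs z)) ^ 2).
      - apply pow_incr; split; [apply Rabs_pos | auto].
      - replace ((K2 * Rpower c theta * / (1 + Rabs z)) ^ 2)
          with (K2 ^ 2 * Rpower c theta ^ 2 * (/ (1 + Rabs z) * / (1 + Rabs z))) by ring.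
        apply Rmult_le_compat_l; [apply Rmult_le_pos; apply pow2_ge_0 | apply inv_sq_le]. }
    assert (Hb2 : be x ^ 2 <= Kb ^ 2 * ka ^ 2 * iz).
    { rewrite <- (pow2_abs (be x)). apply Rle_trans with ((Kb * (ka * iz)) ^ 2).
      - apply pow_incr; split; [apply Rabs_pos | auto].
      - replace ((Kb * (ka * iz)) ^ 2) with (Kb ^ 2 * ka ^ 2 * (iz * iz)) by ring.
        apply Rmult_le_compat_l; [apply Rmult_le_pos; apply pow2_ge_0 | nra]. }
    assert (Hone : 1 <= 2 * (1 - be x) + 4 * be x ^ 2) by (assert (H := pow2_ge_0 (be x - 1/4)); nra).
    assert (Huv : (u + v) ^ 2 <= 2 * u ^ 2 + 2 * v ^ 2) by (assert (H := pow2_ge_0 (u - v)); nra).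
    replace (W * (sqrt c * iz)) with ((8 * ka ^ 2 * C1 ^ 2 * (Kb ^ 2 * ka ^ 2) + 2 * K2 ^ 2 * Rpower c theta ^ 2) * iz)
      by (unfold W; field; lra).
    eapply Rle_trans; [apply Huv|].
    assert (PP : 0 <= ka ^ 2 * C1 ^ 2) by (apply Rmult_le_pos; apply pow2_ge_0).
    assert (S1 : ka ^ 2 * C1 ^ 2 * iy <= ka ^ 2 * C1 ^ 2 * (iy * (2 * (1 - be x)) + 4 * (Kb ^ 2 * ka ^ 2 * iz))).
    { apply Rmult_le_compat_l; auto.
      apply Rle_trans with (iy * (2 * (1 - be x) + 4 * be x ^ 2)); [nra|].
      assert (iy * be x ^ 2 <= be x ^ 2) by (assert (H := pow2_ge_0 (be x)); nra). nra. }
    fold iy. nra.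
  - intros x1 x2 _.
    assert (A1 := atan_le2 (yy c t x1)). assert (A2 := atan_le2 (yy c t x2)).
    assert (A3 := atan_le2 (sqrt c * x1 + b0)). assert (A4 := atan_le2 (sqrt c * x2 + b0)).
    apply Rabs_le_between in A1. apply Rabs_le_between in A2. apply Rabs_le_between in A3. apply Rabs_le_between in A4.
    assert (PP : 0 <= ka ^ 2 * C1 ^ 2) by (apply Rmult_le_pos; apply pow2_ge_0).
    set (y1 := atan (yy c t x1)) in *. set (y2 := atan (yy c t x2)) in *.
    set (z1 := atan (sqrt c * x1 + b0)) in *. set (z2 := atan (sqrt c * x2 + b0)) in *.
    assert (ka ^ 2 * C1 ^ 2 * (y2 - y1) <= ka ^ 2 * C1 ^ 2 * 4) by (apply Rmult_le_compat_l; lra).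
    assert (W * (z2 - z1) <= W * 4) by (apply Rmult_le_compat_l; lra). unfold B. nra.
  - split; auto. apply sq_le_reg; [nra|]. eapply Rle_trans; [apply R2|].
    rewrite Rpow_mult_distr, (Rmult_comm (ka ^ 2)). apply Rmult_le_compat_r; [apply pow2_ge_0 | nra].
Qed.

(** With [c] and [t] fixed, constants may depend on them. Then [y] and [y_c] differ by a bounded
    amount, so decay of [phi] in [y] is decay in [y_c], and the other rows contain a power of
    [Q_c]. *)
Lemma L2_qualitative c t M g phi : 0 < c < 1 -> finF M g -> cls p 1 g -> row0 g phi -> Loc phi -> is_L2 (comp c g t).
Proof.
  intros Hc F C R0 Lp.
  set (g0 := (fun e k l y => match k with O => g e k l y | S _ => 0 end) : fam).
  set (g1 := (fun e k l y => match k with O => 0 | S _ => g e k l y end) : fam).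
  assert (F0 : finF 0 g0).
  { intros e y k l H. unfold g0. destruct k; auto. destruct l; [lia|]. destruct (R0 (S l) y). destruct e; auto. }
  assert (F1 : finF M g1) by (intros e y k l H; unfold g1; destruct k; auto; apply (F e y _ _ H)).
  assert (E : forall x, comp c g t x = phi (yy c t x) + comp c g1 t x).
  { intros x. unfold evalxt. replace g with (fadd g0 g1) at 1.
    - rewrite (Ev_fadd c M) by (auto; apply (finF_mono 0); auto; lia). f_equal.
      unfold Ev. rewrite !(ev_eq 0) by apply F0. unfold ev2. simpl. unfold g0.
      destruct (R0 0%nat (yy c t x)) as [-> ->]. ring.
    - do 4 (apply functional_extensionality; intros ?). unfold fadd, g0, g1. destruct x1; ring. }
  destruct (class_bound p hp Tb k0 l0 (fun X => fst X = (c, t)) (fun X => / (1 + Rabs (zc c t (snd X)))) M g1 F1)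
    as [K [HK HB]].
  - intros [[c' t'] x] HX. simpl in *. injection HX; intros; subst; auto.
  - intros [[c' t'] x] _. left; apply Rinv_0_lt_compat. assert (H := Rabs_pos (zc c t (snd (c', t', x)))); lra.
  - intros e [|k] l; [left; auto | right]. exists (deg p 1 (wt p (S k) l)). split; [apply C|]. split; [lia|].
    exists (Rpower c (INR l + INR (S k) / (INR p - 1) + half e) * (Tc c + Rabs t) ^ pred (deg p 1 (wt p (S k) l))).
    assert (T1 := Tc_ge1 c Hc). assert (T2 := Rabs_pos t).
    split; [apply Rmult_le_pos; [left; apply exp_pos | apply pow_le; lra]|].
    intros c' t' x HX. simpl fst in HX. injection HX; intros; subst. simpl snd. lra.
  - destruct (Loc_bound phi Lp) as [C0 [HC0 HB0]]. destruct (alpha_bound p hp Tb k0 l0) as [Ka [HKa HBa]].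
    assert (Hs : 0 < sqrt c) by (apply sqrt_lt_R0; lra).
    assert (Hi : 0 < / sqrt c) by (apply Rinv_0_lt_compat; auto).
    assert (Hs1 : sqrt c <= 1) by (rewrite <- sqrt_1; apply sqrt_le_1_alt; lra).
    set (B := 1 + Rabs t + Ka * / sqrt c). assert (Ht := Rabs_pos t).
    apply (L2_of_bound c t _ (2 * C0 * B + K)); auto.
    + eapply (comp_Cont p hp); eauto.
    + intros x. rewrite E. eapply Rle_trans; [apply Rabs_triang|]. rewrite Rmult_plus_distr_r.
      apply Rplus_le_compat; [|apply (HB c t x); auto].
      eapply Rle_trans; [apply HB0|]. set (y := yy c t x). set (z := zc c t x).
      assert (Hy := Rabs_pos y). assert (Hz := Rabs_pos z). assert (Hy2 := pow2_ge_0 y).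
      assert (H1 : 1 + Rabs y <= 2 * (1 + y ^ 2)) by (rewrite <- (pow2_abs y); nra).
      assert (H2 : 1 + Rabs z <= B * (1 + Rabs y)).
      { assert (Es : ycoord c t x = y + (1 - c) * t + alpha p c (ashift Tb) k0 l0 (ycoord c t x)).
        { unfold y, ycoord'. unfold ycoord at 1. ring. }
        specialize (HBa c (ycoord c t x) Hc).
        assert (H3 : Rabs (ycoord c t x) <= Rabs y + Rabs t + Ka * / sqrt c).
        { rewrite Es at 1. eapply Rle_trans; [apply Rabs_triang|]. apply Rplus_le_compat; auto.
          eapply Rle_trans; [apply Rabs_triang|]. rewrite (Rabs_mult (1 - c)), (Rabs_pos_eq (1 - c)) by lra. nra. }
        assert (H4 : Rabs z <= Rabs (ycoord c t x)).
        { unfold z. rewrite Rabs_mult, (Rabs_pos_eq (sqrt c)) by lra. assert (H := Rabs_pos (ycoord c t x)). nra. }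
        unfold B. assert (0 < Ka * / sqrt c) by nra. nra. }
      apply (Rmult_le_reg_r ((1 + y ^ 2) * (1 + Rabs z))); [nra|].
      replace (C0 * / (1 + y ^ 2) * ((1 + y ^ 2) * (1 + Rabs z))) with (C0 * (1 + Rabs z)) by (field; lra).
      replace (2 * C0 * B * / (1 + Rabs z) * ((1 + y ^ 2) * (1 + Rabs z))) with (C0 * (B * (2 * (1 + y ^ 2)))) by (field; lra).
      apply Rmult_le_compat_l; [lra|]. eapply Rle_trans; [apply H2|]. apply Rmult_le_compat_l; auto.
      unfold B. nra.
Qed.

Lemma H1norm_le f : H1norm f <= L2norm f + L2norm (Derive f).
Proof.
  assert (H1 := L2norm_pos f). assert (H2 := L2norm_pos (Derive f)).
  apply sq_le_reg; [lra|]. unfold H1norm. rewrite pow2_sqrt; nra.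
Qed.

Lemma dxn_row0 n f : row0 f (fun _ => 0) -> row0 (dxn p Tb k0 l0 n f) (fun _ => 0).
Proof.
  intros R0; induction n; simpl; auto.
  apply (row0_dx p hp2 _ _ (fun _ => 0) (fun _ => 0)); auto. intros; apply @is_derive_const.
Qed.

Definition fzero : fam := fun _ _ _ _ => 0.

Lemma dx_fzero beta : dx p beta fzero = fzero.
Proof.
  do 4 (apply functional_extensionality; intros ?).
  assert (D : forall e k l y, fdy fzero e k l y = 0) by (intros e k l y; exact (Derive_const 0 y)).
  unfold dx, fadd, fsub, bmul, conv. rewrite D.
  rewrite sum_zero by (intros; apply sum_zero; intros; rewrite D; ring).
  unfold fD, fzero, kw, shc, shx. destruct x; [ring|]. destruct x1, (_ <? _)%nat; ring.
Qed.

Lemma dxn_box n f : feqbox k0 l0 f fzero -> feqbox k0 l0 (dxn p Tb k0 l0 n f) fzero.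
Proof.
  intros H; induction n; simpl; auto. rewrite <- (dx_fzero (betaT Tt)).
  apply feqbox_dx; auto. intros i j _ _; auto.
Qed.

(** At index (1,0) the derivative in [y_c] would bring a factor [c] or [R^(p-1)], and [alpha'] pairs
    with row 0, which is empty. Localization thus passes from the correction to its derivative. *)
Lemma dx_at_10 beta g : (forall j, beta 0%nat j = 0) -> (forall e l y, g e 0%nat l y = 0) ->
  dx p beta g false 1%nat 0%nat = Derive (g false 1%nat 0%nat).
Proof.
  intros B Z0. apply functional_extensionality; intros y.
  assert (D : forall y, Derive (g false 0%nat 0%nat) y = 0).
  { intros z. rewrite (Derive_ext _ (fun _ => 0)); [apply Derive_const | intros; apply Z0]. }
  unfold dx, fadd, fsub, bmul, conv, fD, shc, shx, fdy, kw. cbn [sum_f_R0].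
  rewrite !Nat.sub_diag, B, D.
  (* For [p = 2] the shift by [p - 1] reaches row 0, where [g] vanishes. *)
  destruct (Nat.ltb_spec 1 (p - 1)); [ring|]. replace (1 - (p - 1))%nat with 0%nat by lia. rewrite Z0. ring.
Qed.

End Norms.

Theorem theorem4 (p : nat) (hp : (p = 2 \/ p = 3 \/ p = 4)%nat) :
  exists (a : nat -> nat -> R) (A B : nat -> nat -> R -> R),
    (forall k l : nat, (1 <= k)%nat -> smooth (A k l) /\ smooth (B k l)) /\
    forall k0 l0 : nat, (1 <= k0)%nat ->
      (forall j : nat, exists K : R, 0 < K /\
         forall c t : R, 0 < c < 1 -> - Tc c <= t <= Tc c ->
           is_L2 (fun x => Derive_n (fun x' => Serr p c a A B k0 l0 t x') j x) /\
           L2norm (fun x => Derive_n (fun x' => Serr p c a A B k0 l0 t x') j x)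
             <= K * Rpower c ((1/2 - 1/100) * Rmin (INR k0 / (INR p - 1)) (1 + INR l0))) /\
      (forall c t : R, 0 < c < 1 -> is_H1 (fun x => vapp p c a A B k0 l0 t x)) /\
      (exists K : R, 0 < K /\
         forall c t : R, 0 < c < 1 -> - Tc c <= t <= Tc c ->
           let w := fun x => vapp p c a A B k0 l0 t x
                             - Q p (ycoord' p c a k0 l0 t x) - Qc p c (ycoord c t x) in
           is_H1 w /\ H1norm w <= K * Rpower c (1 / (INR p - 1))).
Proof.
  assert (hp2 := hp_ge2 p hp).
  set (Tb := limit_table p). assert (G : goodT p Tb) by apply (limit_good p hp).
  exists (ashift Tb), (Acoef Tb), (Bcoef Tb). split.
  { intros k l Hk. destruct (G k l Hk) as [H1 [_ [_ [H2 _]]]].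
    split; apply Tame_smooth; eapply Pol_Tame; eauto. }
  intros k0 l0 Hk0. set (Tt := trunc k0 l0 Tb).
  assert (GT : goodT p Tt) by (apply goodT_trunc; auto).
  set (N := S (k0 + l0)).
  assert (B0 : forall j, betaT Tt 0%nat j = 0) by reflexivity.
  assert (Habs : forall c t, - Tc c <= t <= Tc c -> Rabs t <= Tc c) by (intros; apply Rabs_le; auto).
  split; [|split].
  - intros j.
    assert (CS : cls p p (ST p Tt)) by (apply cls_Sfam; auto; apply (cls_vfam p hp); auto).
    destruct (finF_ST p hp Tb k0 l0) as [M FS].
    destruct (dxn_fin p hp Tb k0 l0 M j _ FS) as [M' FD].
    assert (CD := dxn_cls p hp Tb k0 l0 p j (ST p Tt) ltac:(auto) CS).
    assert (Row := dxn_row0 p hp Tb k0 l0 j _ (ST_row0 p hp Tt)).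
    assert (Box : feqbox k0 l0 (dxn p Tb k0 l0 j (ST p Tt)) fzero).
    { apply (dxn_box p hp). intros e k l Hk Hl. apply functional_extensionality; intros y.
      destruct k as [|k]; [|apply (trunc_ST p hp); auto; lia].
      destruct (ST_row0 p hp Tt l y) as [E1 E2]. destruct e; [exact E2|]. rewrite E1. destruct l; auto. }
    set (f := dxn p Tb k0 l0 j (ST p Tt)) in *.
    destruct (L2_theta p hp Tb k0 l0 ((1/2 - 1/100) * Rmin (INR k0 / (INR p - 1)) (1 + INR l0)) M' f p FD CD)
      as [K [HK HB]].
    (* Row 0 vanishes because [Q] is an exact solution, the box by construction; the exponent count
       applies to all other indices. *)
    { intros e k l. destruct k as [|k].
      - left. intros y. destruct (Row l y) as [E1 E2]. destruct e; auto. rewrite E1. destruct l; auto.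
      - destruct (Nat.le_gt_cases (S k) k0) as [H1|H1], (Nat.le_gt_cases l l0) as [H2|H2];
          [left; intros y; rewrite (Box e (S k) l) by auto; auto | right ..];
          (split; [lia|]; apply (exponent_S p hp); [lia | lia | apply (deg_bound p hp k0 l0); lia]). }
    exists K. split; auto. intros c t Hc Ht.
    replace (fun x => Derive_n (fun x' => Serr p c (ashift Tb) (Acoef Tb) (Bcoef Tb) k0 l0 t x') j x) with (evalxt p Tb k0 l0 c f t).
    + apply HB; auto.
    + apply functional_extensionality; intros x.
      rewrite (Derive_n_ext _ (fun x => evalxt p Tb k0 l0 c (ST p Tt) t x)) by (intros; apply (Serr_comp p hp); auto).
      symmetry. apply (comp_dxn p hp Tb k0 l0 c Hc p M); auto.
  - intros c t Hc.
    assert (Cv : cls p 1 (vfam p Tt)) by (apply (cls_vfam p hp); auto).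
    assert (Fv := finF_vfam p hp Tb k0 l0). fold Tt N in Fv.
    assert (C1 := cls_dx p hp2 1 (betaT Tt) _ ltac:(lia) Cv).
    assert (F1 := finF_dx p hp2 N _ _ (fin_betaT p hp Tb k0 l0) Fv). fold Tt in F1.
    replace (fun x => vapp p c (ashift Tb) (Acoef Tb) (Bcoef Tb) k0 l0 t x) with (evalxt p Tb k0 l0 c (vfam p Tt) t)
      by (apply functional_extensionality; intros x; symmetry; apply (vapp_comp p hp)).
    assert (D : forall x : R, is_derive (evalxt p Tb k0 l0 c (vfam p Tt) t) x (evalxt p Tb k0 l0 c (dx p (betaT Tt) (vfam p Tt)) t x)).
    { intros x. apply (comp_dx p hp Tb k0 l0 c Hc N); auto. exact (cls_ex p _ _ Cv). }
    split; [intros x; eexists; apply D|]. rewrite (Derive_fun _ _ D). split.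
    + apply (L2_qualitative p hp Tb k0 l0 c t N _ (Q p)); auto; [apply row0_vfam | apply Q_Loc; auto].
    + apply (L2_qualitative p hp Tb k0 l0 c t (2 * N + p) _ (dQ p)); auto.
      * apply (row0_dx p hp2 _ _ (Q p)); auto; [apply (is_derive_Q p hp2) | apply row0_vfam].
      * apply (Loc_dQ p hp).
  - assert (Cw : cls p 1 (wfam Tt)) by (apply cls_wfam; auto).
    assert (Fw := finF_wfam p hp Tb k0 l0). fold Tt N in Fw.
    assert (C1 := cls_dx p hp2 1 (betaT Tt) _ ltac:(lia) Cw).
    assert (F1 := finF_dx p hp2 N _ _ (fin_betaT p hp Tb k0 l0) Fw). fold Tt in F1.
    assert (Zw : forall e l y, wfam Tt e 0%nat l y = 0) by reflexivity.
    assert (Rw : row0 (wfam Tt) (fun _ => 0)) by (intros l y; destruct l; auto).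
    assert (R1 := row0_dx p hp2 _ _ _ (fun _ => 0) B0 ltac:(intros; apply @is_derive_const) Rw).
    assert (Z1 : forall e l y, dx p (betaT Tt) (wfam Tt) e 0%nat l y = 0).
    { intros e l y. destruct (R1 l y) as [E1 E2]. destruct e; auto. rewrite E1. destruct l; auto. }
    assert (L0 : Loc (wfam Tt false 1%nat 0%nat)).
    (* The weight of index (1,0) is 1, below [p], so [deg p p 1 = 0] and the localization clause
       applies. *)
    { destruct (GT 1%nat 0%nat ltac:(lia)) as [_ [_ [HL _]]]. apply HL.
      unfold deg, wt. apply Nat.div_small. lia. }
    assert (L1 : Loc (dx p (betaT Tt) (wfam Tt) false 1%nat 0%nat)).
    { rewrite dx_at_10; auto. apply Loc_Derive; auto. }
    destruct (L2_localized p hp Tb k0 l0 N _ Fw Cw Zw L0) as [K1 [HK1 H1]].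
    destruct (L2_localized p hp Tb k0 l0 (2 * N + p) _ F1 C1 Z1 L1) as [K2 [HK2 H2]].
    exists (K1 + K2). split; [lra|]. intros c t Hc Ht w.
    assert (Ew : w = evalxt p Tb k0 l0 c (wfam Tt) t).
    { apply functional_extensionality; intros x. apply (w_comp p hp). }
    clearbody w. subst w.
    assert (D : forall x : R, is_derive (evalxt p Tb k0 l0 c (wfam Tt) t) x (evalxt p Tb k0 l0 c (dx p (betaT Tt) (wfam Tt)) t x)).
    { intros x. apply (comp_dx p hp Tb k0 l0 c Hc N); auto. exact (cls_ex p _ _ Cw). }
    destruct (H1 c t Hc (Habs c t Ht)) as [I1 B1]. destruct (H2 c t Hc (Habs c t Ht)) as [I2 B2].
    split.
    + split; [intros x; eexists; apply D|]. rewrite (Derive_fun _ _ D). auto.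
    + eapply Rle_trans; [apply H1norm_le|]. rewrite (Derive_fun _ _ D). lra.
Qed.
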